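(* Let $\mathcal T(\mathbb T)$ be the space of all Toeplitz operators on the Hardy space $H^2(\mathbb T)$ associated with the unit disk. Then there exists a completely positive, completely contractive linear mapping $P\colon\mathcal B(H^2(\mathbb T))\to\mathcal B(H^2(\mathbb T))$ such that $P\circ P=P$ and $\operatorname{Ran}P=\mathcal T(\mathbb T)$. In particular, $\mathcal T(\mathbb T)$ is an injective operator space.
   Context: $\mathcal T(\mathbb T)$ is the set of all bounded Toeplitz operators $T_\varphi f=P_{H^2}(\varphi f)$, $\varphi\in L^\infty(\mathbb T)$, where $P_{H^2}$ is the orthogonal projection of $L^2(\mathbb T)$ onto $H^2(\mathbb T)$. It is well known that $\mathcal T(\mathbb T)=\{C\in\mathcal B(H^2(\mathbb T))\mid M_z^*CM_z=C\}$, where $M_z$ is the unilateral shift $(M_zf)(e^{i\theta})=e^{i\theta}f(e^{i\theta})$ on $H^2(\mathbb T)$. An operator space $Y$ is injective if for every complete isometry $\varphi\colon X_0\to X_1$ of operator spaces and every completely bounded $\psi_0\colon X_0\to Y$ there is a completely bounded $\psi\colon X_1\to Y$ with $\psi\circ\varphi=\psi_0$ and $\|\psi\|_{\mathrm{cb}}=\|\psi_0\|_{\mathrm{cb}}$. *)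

(* Defs.v *)
From HB Require Import structures.
From mathcomp Require Import all_boot all_order all_algebra.
From mathcomp Require Import sesquilinear ring_quotient generic_quotient.
From mathcomp Require Import complex.
From mathcomp Require Import all_classical all_reals all_analysis.
From mathcomp Require Import measurable_realfun ess_sup_inf.
From mathcomp Require Import ring lra.
Set Implicit Arguments.
Unset Strict Implicit.
Unset Printing Implicit Defensive.
Import Order.TTheory GRing.Theory Num.Def Num.Theory.
Import numFieldNormedType.Exports.
Local Open Scope classical_set_scope.
Local Open Scope complex_scope.
Local Open Scope ring_scope.

Notation conjR R := (@Num.conj R[i]).

Local Notation normc := Normc.normc.

(* The inner product is linear in its first argument. *)
HB.mixin Record hasInner (R : realType) H of GRing.Lmodule R[i] H := {
  inner : {dot H for conjR R}
}.

#[short(type=innerProductType)]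
HB.structure Definition InnerProduct (R : realType) :=
  {H of GRing.Lmodule R[i] H & hasInner R H}.

Notation "'[ x , y ]" := (inner x y) : ring_scope.

Section InnerProductTheory.
Context (R : realType).
Implicit Types H K : innerProductType R.

Definition hnorm H (x : H) : R := Num.sqrt (complex.Re '[x, x]).

Definition hilbert_space H : Prop :=
  forall u : nat -> H,
    (forall e : R, 0 < e -> exists N, forall m n,
      (N <= m)%N -> (N <= n)%N -> hnorm (u m - u n) < e) ->
    exists l : H, hnorm (u n - l) @[n --> \oo] --> (0 : R).

(* y is the orthogonal projection of x onto the subspace M. *)
Definition orth_proj H (M : set H) (x y : H) : Prop :=
  M y /\ forall z, M z -> '[x - y, z] = 0.

Lemma inner_ge0 H (x : H) : 0 <= '[x, x].
Proof. exact: dnorm_ge0. Qed.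

Lemma hnormE H (x : H) : (hnorm x ^+ 2)%:C = '[x, x].
Proof.
have := inner_ge0 x; rewrite lecE => /andP[/= /eqP im0 re0].
by rewrite sqr_sqrtr//; apply/eqP; rewrite eq_complex/= eqxx im0 eqxx.
Qed.

Lemma hnorm_ge0 H (x : H) : 0 <= hnorm x.
Proof. exact: sqrtr_ge0. Qed.

Lemma hnorm_eq0 H (x : H) : hnorm x = 0 -> x = 0.
Proof.
move=> x0; apply/eqP; rewrite -(dnorm_eq0 (@inner R H)).
by rewrite -hnormE x0 expr0n.
Qed.

Lemma hnorm0 H : hnorm (0 : H) = 0.
Proof. by rewrite /hnorm linear0r sqrtr0. Qed.

Lemma CauchySchwarz H (x y : H) : `|'[x, y]| <= (hnorm x * hnorm y)%:C.
Proof.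
have [->|y0] := eqVneq y 0.
  by rewrite linear0r normr0 ler0c mulr_ge0// hnorm_ge0.
have yy0 : 0 < '[y, y] by rewrite dnorm_gt0.
rewrite -(@ler_pXn2r _ 2)// ?nnegrE ?ler0c ?mulr_ge0 ?hnorm_ge0//.
have -> : (hnorm x * hnorm y)%:C ^+ 2 = '[x, x] * '[y, y].
  by rewrite -!hnormE !rmorphXn rmorphM exprMn.
pose a := '[x, y] / '[y, y].
have cy : conjR R '[y, y] = '[y, y] by apply/CrealP/ger0_real/ltW.
have ca : conjR R a * '[x, y] = `|'[x, y]| ^+ 2 / '[y, y].
  by rewrite /a rmorphM/= fmorphV/= cy mulrAC (mulrC _ '[x, y]) -normCK.
have car : conjR R (conjR R a * '[x, y]) = conjR R a * '[x, y].
  by rewrite ca; apply/CrealP/ger0_real; rewrite divr_ge0 ?exprn_ge0//.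
have := inner_ge0 (x - a *: y).
rewrite dnormB dnormZ linearZr_LR/= car ca /a normrM normfV (gtr0_norm yy0).
set n := `|_| ^+ 2.
have -> : (`|'[x, y]| / '[y, y]) ^+ 2 * '[y, y] = n / '[y, y].
  by rewrite exprMn -mulrA exprVn expr2 invfM mulfVK// gt_eqF.
by rewrite opprD addrA addrK subr_ge0 ler_pdivrMr.
Qed.

Lemma ler_hnormD H (x y : H) : hnorm (x + y) <= hnorm x + hnorm y.
Proof.
rewrite -(@ler_pXn2r _ 2)// ?nnegrE ?addr_ge0 ?hnorm_ge0//.
rewrite -lecR hnormE dnormD sqrrD !rmorphD/= !hnormE -addrA.
rewrite -!addrA lerD2l addrA (addrC _ '[y, y]) lerD2l -rmorphD -mulr2n.
have := CauchySchwarz x y; set d := '[x, y] => dxy.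
have -> : d + d^*%R = (complex.Re d *+ 2)%:C.
  by case: d {dxy} => a b; apply/eqP; rewrite eq_complex/= subrr mulr2n !eqxx.
rewrite lecR lerMn2r /= -lecR; apply: le_trans dxy.
rewrite normc_def lecR; case: d => a b /=.
by rewrite (le_trans (ler_norm _))// -sqrtr_sqr ler_wsqrtr// lerDl sqr_ge0.
Qed.

Lemma hnormZ H (a : R[i]) (x : H) : hnorm (a *: x) = normc a * hnorm x.
Proof.
rewrite /hnorm dnormZ -hnormE.
have -> : `|a| ^+ 2 = (normc a ^+ 2)%:C by rewrite rmorphXn.
rewrite -rmorphM/= -exprMn !sqrtr_sqr normrM; congr (_ * _).
by rewrite ger0_norm//; case: a => ? ?; rewrite sqrtr_ge0.
Qed.

Definition opnorm H K (f : H -> K) : \bar R :=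
  ereal_sup [set (hnorm (f x))%:E | x in [set x | hnorm x <= 1]].

Lemma opnorm_ge0 H K (f : H -> K) : (0 <= opnorm f)%E.
Proof.
apply: (@le_trans _ _ (hnorm (f 0))%:E); first by rewrite lee_fin hnorm_ge0.
by apply: ereal_sup_ubound; exists 0 => //=; rewrite hnorm0.
Qed.

Definition bounded_linear H K : {pred H -> K} :=
  [pred f | `[< linear f /\ (opnorm f < +oo)%E >]].

Lemma bounded_linear_submod_closed H K : submod_closed (@bounded_linear H K).
Proof.
split.
  rewrite inE; split; first by move=> a x y /=; rewrite scaler0 addr0.
  rewrite (@le_lt_trans _ _ 0%E)//; apply: ge_ereal_sup => _ [x _ <-] /=.
  by rewrite hnorm0.
move=> a f g; rewrite !inE => -[lf bf] [lg bg]; split.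
  move=> b x y; rewrite !fctE lf lg !scalerDr !scalerA (mulrC a) !addrA.
  by congr (_ + _); rewrite -!addrA; congr (_ + _); rewrite addrC.
rewrite (@le_lt_trans _ _ ((normc a)%:E * opnorm f + opnorm g)%E)//; last first.
  rewrite lte_add_pinfty// lte_mul_pinfty// lee_fin.
  by case: a => ? ?; rewrite sqrtr_ge0.
apply: ge_ereal_sup => _ [x /= x1 <-]; rewrite fctE.
apply: (@le_trans _ _ (hnorm (a *: f x) + hnorm (g x))%:E).
  by rewrite lee_fin ler_hnormD.
rewrite EFinD hnormZ EFinM leeD//.
  rewrite lee_wpmul2l//; first by case: a => ? ?; rewrite lee_fin sqrtr_ge0.
  by apply: ereal_sup_ubound; exists x.
by apply: ereal_sup_ubound; exists x.
Qed.

HB.instance Definition _ H K := GRing.isSubmodClosed.Build _ _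
  (@bounded_linear H K) (@bounded_linear_submod_closed H K).

End InnerProductTheory.

Record bop (R : realType) (H K : innerProductType R) : Type := Bop {
  bop_fun :> H -> K;
  bopP : bop_fun \in @bounded_linear R H K }.

Section BoundedOperators.
Context (R : realType) (H K : innerProductType R).
HB.instance Definition _ := [isSub for @bop_fun R H K].
HB.instance Definition _ := [Choice of bop H K by <:].
HB.instance Definition _ := [SubChoice_isSubLmodule of bop H K by <:].

Lemma bop_is_linear (T : bop H K) : linear T.
Proof. by case: T => f /= /[!inE] -[]. Qed.

HB.instance Definition _ (T : bop H K) :=
  GRing.isLinear.Build R[i] H K _ T (bop_is_linear T).
End BoundedOperators.

Notation "''B(' H )" := (bop H H) (format "''B(' H )") : type_scope.

Section DirectSum.
Context (R : realType) (H : innerProductType R) (n : nat).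

Definition dsum_inner (x y : {ffun 'I_n -> H}) : R[i] := \sum_i '[x i, y i].

Lemma dsum_linl : forall y, GRing.linear_for *%R (dsum_inner ^~ y).
Proof.
move=> y a x z; rewrite /dsum_inner mulr_sumr -big_split/=.
by apply: eq_bigr => i _; rewrite !ffunE linearPl.
Qed.

Lemma dsum_linr : forall x, GRing.linear_for (conjR R \; *%R) (dsum_inner x).
Proof.
move=> x a y z; rewrite /dsum_inner /= mulr_sumr -big_split/=.
by apply: eq_bigr => i _; rewrite !ffunE linearPr.
Qed.

HB.instance Definition _ := bilinear_isBilinear.Build R[i]
  {ffun 'I_n -> H} {ffun 'I_n -> H} R[i] *%R (conjR R \; *%R) dsum_inner
  (dsum_linl, dsum_linr).

Lemma dsum_herm x y : dsum_inner x y = (-1) ^+ false * conjR R (dsum_inner y x).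
Proof.
rewrite expr0 mul1r rmorph_sum; apply: eq_bigr => i _ /=.
by rewrite hermC expr0 mul1r.
Qed.

HB.instance Definition _ := isHermitianSesquilinear.Build R[i]
  {ffun 'I_n -> H} false (conjR R) dsum_inner dsum_herm.

Lemma dsum_gt0 (x : {ffun 'I_n -> H}) : x != 0 -> 0 < dsum_inner x x.
Proof.
move=> x0; rewrite lt_neqAle sumr_ge0 ?andbT; last by move=> i _; apply: inner_ge0.
apply: contra x0 => /eqP/esym/eqP; rewrite psumr_eq0; last first.
  by move=> i _; apply: inner_ge0.
move=> /allP x0; apply/eqP/ffunP => i; rewrite ffunE; apply/eqP.
by rewrite -(dnorm_eq0 (@inner R H)); apply: x0; rewrite mem_index_enum.
Qed.

HB.instance Definition _ := isDotProduct.Build R[i] {ffun 'I_n -> H}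
  dsum_inner dsum_gt0.

HB.instance Definition _ := hasInner.Build R {ffun 'I_n -> H} dsum_inner.

End DirectSum.

Section OperatorSpaces.
Context (R : realType).
Implicit Types H K : innerProductType R.

(* The matrix [A i j] in M_n(B(H, K)) acting as an operator H^n -> K^n; its
   norm and positivity are those of that operator. *)
Definition mxop H K n (A : 'M[bop H K]_n) (x : {ffun 'I_n -> H}) :
  {ffun 'I_n -> K} := [ffun i => \sum_j A i j (x j)].

Definition mxnorm H K n (A : 'M[bop H K]_n) : \bar R := opnorm (mxop A).

Definition mx_positive H n (A : 'M['B(H)]_n) : Prop :=
  forall x, 0 <= '[mxop A x, x].

Definition completely_positive H K (P : 'B(H) -> 'B(K)) : Prop :=
  forall n (A : 'M['B(H)]_n), mx_positive A -> mx_positive (map_mx P A).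

(* The cb-norm of the restriction of f to the subspace X. *)
Definition cbnorm H K (X : set 'B(H)) (f : 'B(H) -> 'B(K)) : \bar R :=
  ereal_sup [set r | exists n (A : 'M['B(H)]_n),
    [/\ forall i j, X (A i j), (mxnorm A <= 1)%E & r = mxnorm (map_mx f A)]].

Definition completely_bounded H K (X : set 'B(H)) (f : 'B(H) -> 'B(K)) : Prop :=
  (cbnorm X f < +oo)%E.

Definition completely_contractive H K (X : set 'B(H)) (f : 'B(H) -> 'B(K)) :
  Prop := (cbnorm X f <= 1)%E.

(* Concrete operator spaces: norm-closed linear subspaces of B(H), with H a
   Hilbert space. *)
Definition operator_space H (X : set 'B(H)) : Prop :=
  [/\ hilbert_space H,
      X 0,
      forall a S T, X S -> X T -> X (a *: S + T) &
      forall T : 'B(H), (forall e : R, 0 < e ->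
        exists2 S, X S & (opnorm (T - S)%R < e%:E)%E) -> X T].

(* A linear map X -> Y between operator spaces is given by a function on the
   ambient B(H) whose values off X are irrelevant. *)
Definition linear_map H K (X : set 'B(H)) (Y : set 'B(K))
    (f : 'B(H) -> 'B(K)) : Prop :=
  set_fun X Y f /\
  forall a S T, X S -> X T -> f (a *: S + T) = a *: f S + f T.

Definition complete_isometry H K (X : set 'B(H)) (f : 'B(H) -> 'B(K)) : Prop :=
  forall n (A : 'M['B(H)]_n), (forall i j, X (A i j)) ->
    mxnorm (map_mx f A) = mxnorm A.

Definition injective_operator_space K (Y : set 'B(K)) : Prop :=
  operator_space Y /\
  forall H0 H1 (X0 : set 'B(H0)) (X1 : set 'B(H1))
      (phi : 'B(H0) -> 'B(H1)) (psi0 : 'B(H0) -> 'B(K)),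
    operator_space X0 -> operator_space X1 ->
    linear_map X0 X1 phi -> complete_isometry X0 phi ->
    linear_map X0 Y psi0 -> completely_bounded X0 psi0 ->
    exists psi : 'B(H1) -> 'B(K),
      [/\ linear_map X1 Y psi,
          completely_bounded X1 psi,
          forall T, X0 T -> psi (phi T) = psi0 T &
          cbnorm X1 psi = cbnorm X0 psi0].

End OperatorSpaces.

Section ComplexLp.
Context d (T : measurableType d) (R : realType).
Variable mu : {measure set T -> \bar R}.

(* Complex-valued p-integrability is componentwise p-integrability. *)
Definition cLfun (p : \bar R) : {pred T -> R[i]} :=
  [pred f : T -> R[i] | (@complex.Re R \o f \in Lfun mu p) &&
                        (@complex.Im R \o f \in Lfun mu p)].

Definition cintegral (f : T -> R[i]) : R[i] :=
  (\int[mu]_x complex.Re (f x)) +i* (\int[mu]_x complex.Im (f x)).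

Lemma eq_Lfun p (f g : T -> R) : f =1 g -> f \in Lfun mu p -> g \in Lfun mu p.
Proof. by move=> /funext ->. Qed.

Lemma LfunD p (f g : T -> R) : (1 <= p)%E ->
  f \in Lfun mu p -> g \in Lfun mu p -> f \+ g \in Lfun mu p.
Proof. by move=> p1 fp gp; apply: (Lfun_addr_closed mu p1).2. Qed.

Lemma LfunZ p (a : R) (f : T -> R) : (1 <= p)%E ->
  f \in Lfun mu p -> (fun x => a * f x) \in Lfun mu p.
Proof.
move=> p1 fp; have [l0 l1] := @Lfun_submod_closed _ T R mu p p1.
have := l1 a f 0 fp l0; rewrite (_ : _ + _ = fun x => a * f x)//.
by apply/funext => x; rewrite fctE/= addr0.
Qed.

Lemma LfunB p (f g : T -> R) : (1 <= p)%E ->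
  f \in Lfun mu p -> g \in Lfun mu p -> f \- g \in Lfun mu p.
Proof.
move=> p1 fp gp; apply: eq_Lfun (LfunD p1 fp (LfunZ (-1) p1 gp)) => x /=.
by rewrite mulN1r.
Qed.

Lemma cLfun_submod_closed p : (1 <= p)%E -> submod_closed (cLfun p).
Proof.
move=> p1; have [l0 _] := Lfun_addr_closed mu p1; split.
  by apply/andP; split; apply: eq_Lfun l0 => x.
move=> [a b] f g /andP[fr fi] /andP[gr gi].
apply/andP; split.
- apply: eq_Lfun (LfunD p1 (LfunB p1 (LfunZ a p1 fr) (LfunZ b p1 fi)) gr).
  by move=> x /=; rewrite !fctE /=; case: (f x) (g x) => [? ?] [? ?].
- apply: eq_Lfun (LfunD p1 (LfunD p1 (LfunZ a p1 fi) (LfunZ b p1 fr)) gi).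
  by move=> x /=; rewrite !fctE /=; case: (f x) (g x) => [? ?] [? ?].
Qed.

HB.instance Definition _ := GRing.isSubmodClosed.Build _ _
  (cLfun 2%:E) (@cLfun_submod_closed 2%:E (lee1n 2)).

HB.instance Definition _ := GRing.isSubmodClosed.Build _ _
  (cLfun +oo) (@cLfun_submod_closed +oo (leey 1)).

Record L2fun : Type := L2Fun { l2fun :> T -> R[i]; _ : l2fun \in cLfun 2%:E }.
HB.instance Definition _ := [isSub for l2fun].
HB.instance Definition _ := [Choice of L2fun by <:].
HB.instance Definition _ := [SubChoice_isSubLmodule of L2fun by <:].

(* Representatives, not classes: only the class of phi f in L2 is used. *)
Record Linf : Type := LInf { linf :> T -> R[i]; _ : linf \in cLfun +oo }.

Definition null_L2fun : {pred L2fun} :=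
  [pred f : L2fun | `[< (f : T -> R[i]) = cst 0 %[ae mu] >]].

Lemma null_L2fun_submod_closed : submod_closed null_L2fun.
Proof.
split; first by rewrite inE; apply: filterE => x _.
move=> a f g; rewrite !inE => f0 g0.
apply: filterS2 f0 g0 => x f0 g0 _; rewrite [LHS](_ : _ = a *: f x + g x)//.
by rewrite f0// g0// scaler0 addr0.
Qed.

HB.instance Definition _ := GRing.isSubmodClosed.Build _ _
  null_L2fun null_L2fun_submod_closed.

Definition L2 : Type := Quotient.quot null_L2fun.
HB.instance Definition _ := Choice.on L2.
HB.instance Definition _ := EqQuotient.on L2.
HB.instance Definition _ := GRing.Zmodule.on L2.

Local Open Scope quotient_scope.

Lemma L2_eqP (f g : L2fun) :
  \pi_L2 f = \pi_L2 g <-> (f : T -> R[i]) = g %[ae mu].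
Proof.
split=> [/eqP|fg].
  rewrite -Quotient.idealrBE inE; apply: filterS => x fg0 _.
  by apply/eqP; rewrite -subr_eq0; apply/eqP; exact: fg0.
apply/eqP; rewrite -Quotient.idealrBE inE; apply: filterS fg => x fg _.
by rewrite [LHS](_ : _ = f x - g x)// fg// subrr.
Qed.

Lemma L2_reprK (f : L2) : \pi_L2 (repr f) = f.
Proof. exact: reprK. Qed.

Lemma L2_piD f g : \pi_L2 (f + g) = \pi_L2 f + \pi_L2 g.
Proof. by rewrite piE. Qed.

Definition L2_scale (a : R[i]) (f : L2) : L2 := \pi_L2 (a *: repr f).

Lemma L2_piZ a f : \pi_L2 (a *: f) = L2_scale a (\pi_L2 f).
Proof.
apply/L2_eqP; have /L2_eqP := esym (reprK (\pi_L2 f)).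
by apply: filterS => x fx _; rewrite [LHS]/= /GRing.scale /= fx.
Qed.


Lemma L2_scaleA a b v : L2_scale a (L2_scale b v) = L2_scale (a * b) v.
Proof. by rewrite -[v]L2_reprK -3!L2_piZ scalerA. Qed.

Lemma L2_scale1 : left_id 1 L2_scale.
Proof. by move=> v; rewrite -[v]L2_reprK -L2_piZ scale1r. Qed.

Lemma L2_scaleDr : right_distributive L2_scale +%R.
Proof.
by move=> a u v; rewrite -[u]L2_reprK -[v]L2_reprK -L2_piD -3!L2_piZ -L2_piD scalerDr.
Qed.

Lemma L2_scaleDl v : {morph L2_scale^~ v : a b / a + b}.
Proof. by move=> a b; rewrite -[v]L2_reprK -3!L2_piZ scalerDl L2_piD. Qed.

HB.instance Definition _ := GRing.Zmodule_isLmodule.Build R[i] L2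
  L2_scaleA L2_scale1 L2_scaleDr L2_scaleDl.

Lemma cLfun1_conjM (f g : T -> R[i]) : f \in cLfun 2%:E -> g \in cLfun 2%:E ->
  (fun x => f x * conjc (g x)) \in cLfun 1.
Proof.
move=> /andP[fr fi] /andP[gr gi]; apply/andP; split.
- apply: eq_Lfun (LfunD _ (Lfun2_mul_Lfun1 fr gr) (Lfun2_mul_Lfun1 fi gi)) => //.
  by move=> x /=; case: (f x) (g x) => [? ?] [? ?] /=; ring.
- apply: eq_Lfun (LfunB _ (Lfun2_mul_Lfun1 fi gr) (Lfun2_mul_Lfun1 fr gi)) => //.
  by move=> x /=; case: (f x) (g x) => [? ?] [? ?] /=; ring.
Qed.

Lemma cintegralD (f g : T -> R[i]) : f \in cLfun 1 -> g \in cLfun 1 ->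
  cintegral (fun x => f x + g x) = cintegral f + cintegral g.
Proof.
move=> /andP[/Lfun1_integrable fr /Lfun1_integrable fi].
move=> /andP[/Lfun1_integrable gr /Lfun1_integrable gi].
apply/eqP; rewrite eq_complex /=; apply/andP; split; apply/eqP.
- rewrite -RintegralD//; apply: eq_Rintegral => x _ /=.
  by case: (f x) (g x) => [? ?] [? ?].
- rewrite -RintegralD//; apply: eq_Rintegral => x _ /=.
  by case: (f x) (g x) => [? ?] [? ?].
Qed.

Lemma cintegralZ a (f : T -> R[i]) : f \in cLfun 1 ->
  cintegral (fun x => a * f x) = a * cintegral f.
Proof.
move=> /andP[fr fi]; case: a => a b.
have iZ c (h : T -> R) : h \in Lfun mu 1 ->
    mu.-integrable setT (EFin \o (fun x => c * h x)).
  by move=> hi; apply/Lfun1_integrable/LfunZ.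
apply/eqP; rewrite eq_complex /=; apply/andP; split; apply/eqP.
- rewrite -!RintegralZl//; try exact/Lfun1_integrable.
  rewrite -RintegralB//; try exact: iZ.
  by apply: eq_Rintegral => x _ /=; case: (f x).
- rewrite -!RintegralZl//; try exact/Lfun1_integrable.
  rewrite -RintegralD//; try exact: iZ.
  by apply: eq_Rintegral => x _ /=; case: (f x).
Qed.

Lemma cintegral_conj (f : T -> R[i]) : f \in cLfun 1 ->
  cintegral (fun x => conjc (f x)) = conjc (cintegral f).
Proof.
move=> /andP[_ /Lfun1_integrable fi].
apply/eqP; rewrite eq_complex /=; apply/andP; split; apply/eqP.
  by apply: eq_Rintegral => x _ /=; case: (f x).
rewrite -mulN1r -RintegralZl//; apply: eq_Rintegral => x _ /=.
by case: (f x) => ? ? /=; rewrite mulN1r.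
Qed.

Lemma ae_eq_cintegral (f g : T -> R[i]) : f \in cLfun 1 -> g \in cLfun 1 ->
  f = g %[ae mu] -> cintegral f = cintegral g.
Proof.
move=> /andP[/Lfun1_integrable fr /Lfun1_integrable fi].
move=> /andP[/Lfun1_integrable gr /Lfun1_integrable gi] fg.
rewrite /cintegral; congr (_ +i* _); rewrite /Rintegral; congr fine.
- apply: ae_eq_integral; [exact: measurableT| | |].
  + exact: measurable_int fr.
  + exact: measurable_int gr.
  + by apply: filterS fg => x fgx _ /=; rewrite fgx.
- apply: ae_eq_integral; [exact: measurableT| | |].
  + exact: measurable_int fi.
  + exact: measurable_int gi.
  + by apply: filterS fg => x fgx _ /=; rewrite fgx.
Qed.

Definition L2_inner (f g : L2) : R[i] :=
  cintegral (fun x => repr f x * conjc (repr g x)).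

Lemma L2_inner_pi (f g : L2fun) :
  L2_inner (\pi_L2 f) (\pi_L2 g) = cintegral (fun x => f x * conjc (g x)).
Proof.
apply: ae_eq_cintegral; try by apply: cLfun1_conjM; exact: valP.
have /L2_eqP ff := L2_reprK (\pi_L2 f); have /L2_eqP gg := L2_reprK (\pi_L2 g).
by apply: filterS2 ff gg => x ff gg _; rewrite ff// gg.
Qed.

Lemma cLfunZ p a (f : T -> R[i]) : (1 <= p)%E -> f \in cLfun p ->
  (fun x => a * f x) \in cLfun p.
Proof.
move=> p1 fp; have [l0 l1] := cLfun_submod_closed p1.
by have := l1 a f 0 fp l0; rewrite addr0.
Qed.

Lemma L2_linl : forall g, GRing.linear_for *%R (L2_inner ^~ g).
Proof.
move=> g a f h; rewrite -[g]L2_reprK -[f]L2_reprK -[h]L2_reprK.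
rewrite -[a *: _]L2_piZ -L2_piD !L2_inner_pi.
have fg := cLfun1_conjM (valP (repr f)) (valP (repr g)).
have hg := cLfun1_conjM (valP (repr h)) (valP (repr g)).
rewrite -cintegralZ// -cintegralD//; last exact: cLfunZ.
congr cintegral; apply/funext => x.
by rewrite mulrA -mulrDl.
Qed.

Lemma L2_herm f g : L2_inner f g = (-1) ^+ false * conjR R (L2_inner g f).
Proof.
rewrite expr0 mul1r; transitivity (conjc (L2_inner g f)) => //.
rewrite -cintegral_conj; last by apply: cLfun1_conjM; exact: valP.
congr cintegral; apply/funext => x.
by rewrite rmorphM/= conjcK mulrC.
Qed.

Lemma L2_linr : forall f, GRing.linear_for (conjR R \; *%R) (L2_inner f).
Proof.
move=> f a g h; rewrite L2_herm L2_linl rmorphD rmorphM /=.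
by rewrite mul1r [in RHS]L2_herm [in X in _ = _ + X]L2_herm !mul1r.
Qed.

HB.instance Definition _ := bilinear_isBilinear.Build R[i]
  L2 L2 R[i] *%R (conjR R \; *%R) L2_inner (L2_linl, L2_linr).

HB.instance Definition _ := isHermitianSesquilinear.Build R[i]
  L2 false (conjR R) L2_inner L2_herm.

Lemma L2_gt0 (f : L2) : f != 0 -> 0 < L2_inner f f.
Proof.
move=> f0.
have /andP[fr fi] := valP (repr f).
have h1 : (fun x => complex.Re (repr f x) ^+ 2 + complex.Im (repr f x) ^+ 2)
    \in Lfun mu 1.
  exact: LfunD (Lfun2_mul_Lfun1 fr fr) (Lfun2_mul_Lfun1 fi fi).
set h := (X in X \in _) in h1.
have h0 x : 0 <= h x by rewrite addr_ge0// sqr_ge0.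
have -> : L2_inner f f = (\int[mu]_x h x)%:C.
  rewrite /L2_inner /cintegral; congr (_ +i* _).
    by apply: eq_Rintegral => x _; rewrite /h; case: (repr f x) => ? ? /=; ring.
  rewrite /Rintegral (eq_integral (cst 0%E)) ?integral0// => x _ /=.
  by case: (repr f x) => ? ? /=; congr EFin; ring.
rewrite ltcR lt_neqAle Rintegral_ge0// andbT; apply: contra f0 => /eqP/esym ih.
have /Lfun1_integrable ih1 := h1.
have /ae_eq_integral_abs ae0 : (\int[mu]_x `|(h x)%:E| = 0)%E.
  rewrite (eq_integral (EFin \o h)); last first.
    by move=> x _; rewrite gee0_abs ?lee_fin.
  rewrite -[LHS]fineK; first by congr EFin.
  exact: integrable_fin_num.
have {}ae0 := ae0 measurableT (measurable_int _ ih1).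
rewrite -[f]L2_reprK -[0]L2_reprK; apply/eqP/L2_eqP.
have /L2_eqP z0 : \pi_L2 (repr (0 : L2)) = \pi_L2 0 by rewrite L2_reprK piE.
apply: filterS2 ae0 z0 => x /(_ Logic.I)/= [hx0] zx _.
rewrite zx//; apply/eqP; rewrite eq_complex/=.
move/eqP: hx0; rewrite paddr_eq0 ?sqr_ge0// !sqrf_eq0.
by [].
Qed.

HB.instance Definition _ := isDotProduct.Build R[i] L2 L2_inner L2_gt0.

HB.instance Definition _ := hasInner.Build R L2 L2_inner.

Lemma LfunMinf (f g : T -> R) : f \in Lfun mu +oo -> g \in Lfun mu 2%:E ->
  f \* g \in Lfun mu 2%:E.
Proof.
move=> /andP[/[!inE]/= mf ff] /[dup] g2 /andP[/[!inE]/= mg fg].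
apply/andP; split; rewrite inE/=; first exact: measurable_funM.
have [M M0 fM] : exists2 M, 0 <= M & \forall x \ae mu, `|f x| <= M.
  move: ff; rewrite /finite_norm unlock /Lnorm; case: ifPn => [_|mu0 _].
    move=> /ess_supr_bounded[M fM]; exists `|M| => //.
    by apply: filterS fM => x fx; exact: le_trans fx (ler_norm _).
  exists 0 => //; exists setT; split => //.
  by apply/eqP; rewrite eq_le measure_ge0 leNgt mu0.
have mpow (h : T -> R) : measurable_fun [set: T] h ->
    measurable_fun [set: T] (fun x => (`|h x| `^ 2)%:E).
  move=> mh; apply/measurable_EFinP.
  apply: (@measurableT_comp _ _ _ _ _ _ (@powR R ^~ 2)) => //.
  exact: measurableT_comp.
rewrite /finite_norm unlock /Lnorm poweR_lty//.
apply: (@le_lt_trans _ _ (\int[mu]_x (M `^ 2 * `|g x| `^ 2)%:E)%E); last first.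
  under eq_integral do rewrite EFinM.
  rewrite integralZl//; last by apply: Lfun_integrable => //; lra.
  rewrite lte_mul_pinfty ?lee_fin ?powR_ge0//.
  have p12 : 1 <= 2 :> R by lra.
  have /integrableP[_] := Lfun_integrable p12 g2.
  apply: le_lt_trans; apply: ge0_le_integral => //.
  - exact: mpow.
  - by apply: measurableT_comp => //; exact: mpow.
  - by move=> x _; rewrite gee0_abs// lee_fin powR_ge0.
apply: ae_ge0_le_integral => //.
- by move=> x _; rewrite lee_fin powR_ge0.
- by apply: mpow; exact: measurable_funM.
- by move=> x _; rewrite lee_fin mulr_ge0// powR_ge0.
- under eq_fun do rewrite EFinM.
  by apply: emeasurable_funM => //; exact: mpow.
- apply: filterS fM => x fx _ /=.
  rewrite lee_fin normrM powRM// ler_wpM2r ?powR_ge0//.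
  by rewrite ge0_ler_powR ?nnegrE.
Qed.

Lemma cLfunMinf (f g : T -> R[i]) : f \in cLfun +oo -> g \in cLfun 2%:E ->
  (fun x => f x * g x) \in cLfun 2%:E.
Proof.
move=> /andP[fr fi] /andP[gr gi]; have p1 : (1 <= 2%:E :> \bar R)%E by exact: lee1n.
apply/andP; split.
- apply: eq_Lfun (LfunB p1 (LfunMinf fr gr) (LfunMinf fi gi)).
  by move=> x /=; case: (f x) (g x) => [? ?] [? ?].
- apply: eq_Lfun (LfunD p1 (LfunMinf fr gi) (LfunMinf fi gr)).
  by move=> x /=; case: (f x) (g x) => [? ?] [? ?].
Qed.

Lemma linfP (phi : Linf) : (phi : T -> R[i]) \in cLfun +oo.
Proof. by case: phi. Qed.

Definition Linf_mul (phi : Linf) (f : L2) : L2 :=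
  \pi_L2 (L2Fun (cLfunMinf (linfP phi) (valP (repr f)))).

End ComplexLp.

Section UnitCircle.
Context (R : realType).

Lemma twopi_gt0 : 0 < 2 * pi :> R.
Proof. by rewrite mulr_gt0// pi_gt0. Qed.

(* The circle is parametrized by theta |-> e^(i theta), theta in [0, 2 pi];
   functions on it are functions of theta and its normalized arc length is
   the uniform probability on [0, 2 pi]. *)
Definition circle : probability (measurableTypeR R) R := uniform_prob twopi_gt0.

Definition expi (k : int) (t : R) : R[i] := cos (k%:~R * t) +i* sin (k%:~R * t).

Lemma bounded_Lfun2 (f : R -> R) : measurable_fun [set: R] f ->
  (forall t, `|f t| <= 1) -> f \in Lfun circle 2%:E.
Proof.
move=> mf f1; apply: (@Lfun_subset _ _ _ circle 2%:E +oo%E _ _ _ _ f).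
- exact: lee1n.
- exact: leey.
- exact: fin_num_measure.
- exact: leey.
apply/andP; split; rewrite inE//= /finite_norm unlock /Lnorm.
case: ifPn => // _; apply: (@le_lt_trans _ _ 1%E); last exact: ltry.
by apply/ess_supP; apply: filterE => x /=; rewrite lee_fin.
Qed.

Lemma expi_L2 k : expi k \in cLfun circle 2%:E.
Proof.
have mk : measurable_fun [set: R] (fun t : R => k%:~R * t).
  by apply: measurable_funM.
apply/andP; split; apply: bounded_Lfun2.
- apply: (measurableT_comp _ mk).
  by apply: continuous_measurable_fun; exact: continuous_cos.
- by move=> t; rewrite ler_norml cos_geN1 cos_le1.
- apply: (measurableT_comp _ mk).
  by apply: continuous_measurable_fun; exact: continuous_sin.
- by move=> t; rewrite ler_norml sin_geN1 sin_le1.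
Qed.

Definition fourier_coef (f : L2 circle) (k : int) : R[i] :=
  '[f, \pi_(L2 circle)%qT (L2Fun (expi_L2 k))].

Definition hardy : {pred L2 circle} :=
  [pred f | `[< forall k : int, k < 0 -> fourier_coef f k = 0 >]].

Lemma hardy_submod_closed : submod_closed hardy.
Proof.
split.
  by rewrite inE => k _; rewrite /fourier_coef linear0l.
move=> a f g; rewrite !inE => f0 g0 k k0.
by rewrite /fourier_coef linearPl/= [X in _ * X]f0// [X in _ + X]g0// mulr0 addr0.
Qed.

HB.instance Definition _ := GRing.isSubmodClosed.Build _ _
  hardy hardy_submod_closed.

Record H2 : Type := MkH2 { h2_L2 :> L2 circle; _ : h2_L2 \in hardy }.
HB.instance Definition _ := [isSub for h2_L2].
HB.instance Definition _ := [Choice of H2 by <:].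
HB.instance Definition _ := [SubChoice_isSubLmodule of H2 by <:].

Definition H2_inner (f g : H2) : R[i] := '[val f, val g].

Lemma H2_linl : forall g, GRing.linear_for *%R (H2_inner ^~ g).
Proof. by move=> g a f h; exact: (linearPl (@inner R (L2 circle))). Qed.

Lemma H2_linr : forall f, GRing.linear_for (conjR R \; *%R) (H2_inner f).
Proof. by move=> f a g h; exact: (linearPr (@inner R (L2 circle))). Qed.

HB.instance Definition _ := bilinear_isBilinear.Build R[i]
  H2 H2 R[i] *%R (conjR R \; *%R) H2_inner (H2_linl, H2_linr).

Lemma H2_herm f g : H2_inner f g = (-1) ^+ false * conjR R (H2_inner g f).
Proof. exact: hermC. Qed.

HB.instance Definition _ := isHermitianSesquilinear.Build R[i]
  H2 false (conjR R) H2_inner H2_herm.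

Lemma H2_gt0 (f : H2) : f != 0 -> 0 < H2_inner f f.
Proof. by move=> f0; rewrite neq0_dnorm_gt0. Qed.

HB.instance Definition _ := isDotProduct.Build R[i] H2 H2_inner H2_gt0.

HB.instance Definition _ := hasInner.Build R H2 H2_inner.

(* C f = P_{H2} (phi f) for all f in H2, i.e. C = T_phi. *)
Definition toeplitz : set 'B(H2) :=
  [set C : 'B(H2) | exists phi : Linf circle, forall f : H2,
     orth_proj [set` hardy] (Linf_mul phi f) (h2_L2 (C f))].

End UnitCircle.

(* Main.v *)
(* Averaging M_z^{*n} T M_z^n over n with a Banach limit gives a form that is
   linear and positive in T and bounded by |T|. On H^2 it defines P T. On L^2,
   with T replaced by T P_{H^2}, it defines an operator commuting with
   multiplication by z. Such an operator commutes with multiplication by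
   trigonometric polynomials; iterating the polynomial 3y^2 - 2y^3 on them it
   commutes with multiplication by indicators of arcs, then of Borel sets, so it
   is multiplication by its value at 1, which is essentially bounded. Hence P T
   is Toeplitz, and P fixes Toeplitz operators since the average is then constant.

   For injectivity it is enough to extend completely bounded maps into B(K), with
   K Hilbert (Wittstock), and to compose with P. On conj(K) (x) B(H) (x) K take
   the infimum of (|a|^2 + |b|^2) / 2 over the representations
   w = sum a_i (x) x_ij (x) b_j with (x_ij) contractive. A completely
   contractive u : V -> B(K) is the same as a linear functional on
   conj(K) (x) V (x) K dominated by this functional: if w lies over V, compressing
   (x_ij) by the projections onto the column spaces of the Gram matrices of a and
   b leaves w unchanged and puts the entries in V. Hahn-Banach does the rest. *)
From HB Require Import structures.
From mathcomp Require Import all_boot all_order all_algebra.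
From mathcomp Require Import complex.
From mathcomp Require Import all_classical all_reals all_analysis.
From mathcomp Require Import measurable_realfun ess_sup_inf.
From mathcomp Require Import ring lra.
Require Import Defs.
Set Implicit Arguments.
Unset Strict Implicit.
Unset Printing Implicit Defensive.
Import Order.TTheory GRing.Theory Num.Def Num.Theory.
Import numFieldNormedType.Exports.
Local Open Scope classical_set_scope.
Local Open Scope complex_scope.
Local Open Scope ring_scope.

(** A Banach limit is taken because M_z^{*n} T M_z^n need not converge; its invariance under one
    step makes the averaged form invariant under z. Since [toeplitz] asks for a symbol, this
    invariance alone does not conclude: the symbol has to be built. On H^2 the shift is only an
    isometry; on L^2 it is unitary, and there invariance of the form turns into commutation with z.

    In the extension theorem the weight is a mean of squares and not |a| |b| because squared norms
    add under concatenation, which makes the infimum subadditive; the product bound comes back by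
    scaling a and b inversely. The values prescribed by u are subtracted inside the infimum, so all
    that Hahn-Banach has to supply is a linear functional below a sublinear one. That functional is
    real; complex linearity is recovered afterwards. *)

Local Notation Re := complex.Re.
Local Notation Im := complex.Im.

(** * Hilbert spaces *)

Section ComplexParts.
Context (R : realType).
Implicit Types z w : R[i].

Lemma complex_eqP z w : Re z = Re w -> Im z = Im w -> z = w.
Proof. by case: z w => [a b] [c d] /= -> ->. Qed.

Lemma cReD z w : Re (z + w) = Re z + Re w. Proof. by case: z w => [? ?] []. Qed.
Lemma cImD z w : Im (z + w) = Im z + Im w. Proof. by case: z w => [? ?] []. Qed.
Lemma cReN z : Re (- z) = - Re z. Proof. by case: z. Qed.
Lemma cImN z : Im (- z) = - Im z. Proof. by case: z. Qed.
Lemma cReB z w : Re (z - w) = Re z - Re w. Proof. by rewrite cReD cReN. Qed.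
Lemma cImB z w : Im (z - w) = Im z - Im w. Proof. by rewrite cImD cImN. Qed.
Lemma cReM z w : Re (z * w) = Re z * Re w - Im z * Im w.
Proof. by case: z w => [? ?] []. Qed.
Lemma cImM z w : Im (z * w) = Re z * Im w + Im z * Re w.
Proof. by case: z w => [? ?] []. Qed.
Lemma cRe_conj z : Re (conjR R z) = Re z. Proof. by case: z. Qed.
Lemma cIm_conj z : Im (conjR R z) = - Im z. Proof. by case: z. Qed.
Lemma conjR_i : conjR R 'i = - 'i.
Proof. by apply: complex_eqP; rewrite /= ?oppr0. Qed.
Lemma cReiM z : Re ('i * z) = - Im z.
Proof. by rewrite cReM /= mul0r mul1r sub0r. Qed.
Lemma cRe_realM (t : R) z : Re (t%:C * z) = t * Re z.
Proof. by rewrite cReM /= mul0r subr0. Qed.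
Lemma cIm_realM (t : R) z : Im (t%:C * z) = t * Im z.
Proof. by rewrite cImM /= mul0r addr0. Qed.
Lemma cRe_sum I (r : seq I) (P : pred I) (F : I -> R[i]) :
  Re (\sum_(i <- r | P i) F i) = \sum_(i <- r | P i) Re (F i).
Proof. exact: (big_morph _ cReD). Qed.

Lemma conjRK : involutive (conjR R).
Proof. by case=> a b; apply: complex_eqP; rewrite /= ?opprK. Qed.

Lemma conjR_real (t : R) : conjR R t%:C = t%:C.
Proof. by apply: complex_eqP; rewrite /= ?oppr0. Qed.

Lemma Re_le_norm z (M : R) : `|z| <= M%:C -> Re z <= M.
Proof.
rewrite normc_def lecR; apply: le_trans; rewrite (le_trans (ler_norm _))//.
by rewrite -sqrtr_sqr ler_wsqrtr// lerDl sqr_ge0.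
Qed.

End ComplexParts.

Section HilbertGeometry.
Context (R : realType).
Implicit Types H K : innerProductType R.

Lemma innerDl H (x y z : H) : '[x + y, z] = '[x, z] + '[y, z].
Proof. exact: linearDl. Qed.
Lemma innerDr H (x y z : H) : '[z, x + y] = '[z, x] + '[z, y].
Proof. exact: linearDr. Qed.
Lemma innerBl H (x y z : H) : '[x - y, z] = '[x, z] - '[y, z].
Proof. exact: linearBl. Qed.
Lemma innerBr H (x y z : H) : '[z, x - y] = '[z, x] - '[z, y].
Proof. exact: linearBr. Qed.
Lemma innerZl H a (x z : H) : '[a *: x, z] = a * '[x, z].
Proof. exact: linearZl_LR. Qed.
Lemma innerZr H a (x z : H) : '[z, a *: x] = conjR R a * '[z, x].
Proof. exact: linearZr_LR. Qed.
Lemma inner0l H (z : H) : '[0, z] = 0.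
Proof. exact: linear0l. Qed.
Lemma inner0r H (z : H) : '[z, 0] = 0.
Proof. exact: linear0r. Qed.
Lemma inner_suml H I (r : seq I) (P : pred I) (F : I -> H) (z : H) :
  '[\sum_(i <- r | P i) F i, z] = \sum_(i <- r | P i) '[F i, z].
Proof. by apply: (big_morph (fun x => '[x, z])) => [x y|]; rewrite ?innerDl ?inner0l. Qed.
Lemma inner_sumr H I (r : seq I) (P : pred I) (F : I -> H) (z : H) :
  '[z, \sum_(i <- r | P i) F i] = \sum_(i <- r | P i) '[z, F i].
Proof. by apply: (big_morph (fun x => '[z, x])) => [x y|]; rewrite ?innerDr ?inner0r. Qed.
Lemma innerC H (x y : H) : '[x, y] = conjR R '[y, x].
Proof. by rewrite hermC expr0 mul1r. Qed.

Lemma hnorm_sqrE H (x : H) : hnorm x ^+ 2 = Re '[x, x].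
Proof. by rewrite -hnormE. Qed.

Lemma Re_innerC H (x y : H) : Re '[x, y] = Re '[y, x].
Proof. by rewrite innerC cRe_conj. Qed.

Lemma hnormD_sqr H (x y : H) :
  hnorm (x + y) ^+ 2 = hnorm x ^+ 2 + hnorm y ^+ 2 + 2 * Re '[x, y].
Proof.
rewrite !hnorm_sqrE innerDl !innerDr !cReD (Re_innerC y x); ring.
Qed.

Lemma hnormZr H (t : R) (x : H) : hnorm (t%:C *: x) = `|t| * hnorm x.
Proof. by rewrite hnormZ /= expr0n/= addr0 sqrtr_sqr. Qed.

Lemma hnormN H (x : H) : hnorm (- x) = hnorm x.
Proof. by rewrite /hnorm -scaleN1r innerZl innerZr rmorphN1 mulrA mulrNN !mul1r. Qed.

Lemma hnormBC H (x y : H) : hnorm (x - y) = hnorm (y - x).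
Proof. by rewrite -hnormN opprB. Qed.

Lemma Re_CauchySchwarz H (x y : H) : Re '[x, y] <= hnorm x * hnorm y.
Proof. exact/Re_le_norm/CauchySchwarz. Qed.

Lemma Im_CauchySchwarz H (x y : H) : `|Im '[x, y]| <= hnorm x * hnorm y.
Proof.
have nI : hnorm ('i *: x) = hnorm x.
  by rewrite /hnorm innerZl innerZr mulrA conjR_i mulrN -expr2 sqr_i opprK mul1r.
rewrite ler_norml; apply/andP; split.
  rewrite lerNl -cReiM -innerZl; apply: le_trans (Re_CauchySchwarz _ _) _.
  by rewrite nI.
rewrite -[Im _]opprK -cReiM -innerZl -cReN -(linearNl (@inner R H)).
by apply: le_trans (Re_CauchySchwarz _ _) _; rewrite hnormN nI.
Qed.

Lemma inner_eql H (x y : H) : (forall z, '[x, z] = '[y, z]) -> x = y.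
Proof.
move=> xy; apply/eqP; rewrite -subr_eq0; apply/eqP/hnorm_eq0/eqP.
by rewrite -sqrf_eq0 hnorm_sqrE innerBl xy subrr.
Qed.

Lemma hilbert_limP H (u : nat -> H) (l : H) :
  hnorm (u n - l) @[n --> \oo] --> (0 : R) ->
  forall e, 0 < e -> exists N, forall n, (N <= n)%N -> hnorm (u n - l) < e.
Proof.
move=> /cvgrPdist_lt ul e e0; have [N _ uN] := ul _ e0; exists N => n Nn.
by have := uN n Nn; rewrite /= sub0r normrN ger0_norm// hnorm_ge0.
Qed.

(* The representing vector minimizes |x|^2 - 2 Re f(x). *)
Theorem riesz_representation H (f : H -> R[i]) (M : R) : hilbert_space H ->
  (forall a x y, f (a *: x + y) = a * f x + f y) ->
  (forall x, Re (f x) <= M * hnorm x) ->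
  exists y, forall x, f x = '[x, y].
Proof.
move=> hH flin fM.
have fD x y : f (x + y) = f x + f y by rewrite -[x in LHS]scale1r flin mul1r.
have f0 : f 0 = 0 by apply/(addIr (f 0)); rewrite -fD !add0r.
have fZ a x : f (a *: x) = a * f x by rewrite -[a *: x]addr0 flin f0 addr0.
have fZr (t : R) x : Re (f (t%:C *: x)) = t * Re (f x) by rewrite fZ cRe_realM.
pose J x := hnorm x ^+ 2 - 2 * Re (f x).
have Jge x : - M ^+ 2 <= J x.
  rewrite /J; have := fM x; have := sqr_ge0 (hnorm x - M); nra.
pose S := [set J x | x in [set: H]].
have Sinf : has_inf S.
  by split; [exists (J 0), 0 | exists (- M ^+ 2) => _ [x _ <-]].
pose I := inf S.
have Jinf x : I <= J x by apply: ge_inf; [exact: Sinf.2|exists x].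
have /choice[u uJ] : forall n : nat, exists x, J x < I + n.+1%:R^-1.
  move=> n; have : I < I + n.+1%:R^-1 by rewrite ltrDl invr_gt0.
  by move=> /(inf_lt Sinf.1)[_ [x _ <-] Jx]; exists x.
(* Parallelogram law; the linear part of [J] cancels. As [J] of the midpoint is at least [I],
   near-minimizers are close to each other, which gives the Cauchy property. *)
have par x y : hnorm (x - y) ^+ 2 = 2 * J x + 2 * J y - 4 * J (2^-1%:C *: (x + y)).
  rewrite /J hnormZr fZr fD cReD exprMn hnormD_sqr hnormD_sqr hnormN.
  rewrite -scaleN1r innerZr rmorphN1 mulN1r cReN.
  by rewrite [`|_|]ger0_norm ?invr_ge0//; field.
have cauchy : forall e : R, 0 < e -> exists N, forall m n,
    (N <= m)%N -> (N <= n)%N -> hnorm (u m - u n) < e.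
  move=> e e0; have e2 : 0 < e ^+ 2 / 4 by rewrite divr_gt0// exprn_gt0.
  have [N _ NP] : \forall n \near \oo, n.+1%:R^-1 < e ^+ 2 / 4.
    exact: near_infty_natSinv_lt (PosNum e2).
  exists N => m n Nm Nn; have mN : m.+1%:R^-1 < e ^+ 2 / 4 by exact: NP.
  have nN : n.+1%:R^-1 < e ^+ 2 / 4 by exact: NP.
  rewrite -(@ltr_pXn2r _ 2) ?nnegrE ?hnorm_ge0 ?ltW// par.
  have := uJ m; have := uJ n; have := Jinf (2^-1%:C *: (u m + u n)).
  move: (m.+1%:R^-1) (n.+1%:R^-1) mN nN => a b; lra.
have [l /hilbert_limP ul] := hH _ cauchy.
(* Instead of continuity of [J], expand it around [u n]: the first-order terms in [d] are at most
   [2 * hnorm l + 2 * |M|] times [hnorm d], and the extra 1 keeps the divisor positive. *)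
have Jl : J l <= I.
  apply/ler_addgt0Pr => e e0; have K0 : 0 < 2 * hnorm l + 2 * `|M| + 1.
    by have := hnorm_ge0 l; have := normr_ge0 M; lra.
  have e1 : 0 < e / 2 / (2 * hnorm l + 2 * `|M| + 1) by rewrite !divr_gt0.
  have [N1 N1P] := ul _ e1.
  have e2 : 0 < e / 2 by rewrite divr_gt0.
  have [N2 _ N2P] := near_infty_natSinv_lt (PosNum e2).
  pose n := maxn N1 N2.
  have := N1P n (leq_maxl _ _); have : n.+1%:R^-1 < e / 2 by exact/N2P/leq_maxr.
  have := uJ n; set d := u n - l; move: (n.+1%:R^-1) => a un n2.
  rewrite ltr_pdivlMr// => dn.
  have -> : J l = J (u n) - 2 * Re '[l, d] - hnorm d ^+ 2 + 2 * Re (f d).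
    have -> : u n = l + d by rewrite /d addrC subrK.
    by rewrite /J hnormD_sqr fD cReD; ring.
  have h1 : - (hnorm l * hnorm d) <= Re '[l, d].
    by rewrite lerNl -cReN -(linearNl (@inner R H)) -(hnormN l) Re_CauchySchwarz.
  have h2 : Re (f d) <= `|M| * hnorm d.
    by rewrite (le_trans (fM d))// ler_wpM2r ?hnorm_ge0// ler_norm.
  have := sqr_ge0 (hnorm d); have := hnorm_ge0 d; nra.
have Jmin x : J l <= J x by exact: le_trans Jl (Jinf x).
have Rel x : Re (f x) = Re '[x, l].
  have key (t : R) : 0 <= 2 * t * (Re '[x, l] - Re (f x)) + t ^+ 2 * hnorm x ^+ 2.
    have := Jmin (l + t%:C *: x); rewrite /J hnormD_sqr fD cReD fZr innerZr.
    rewrite conjR_real cRe_realM Re_innerC hnormZr exprMn real_normK ?num_real//; lra.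
  set D := Re '[x, l] - Re (f x) in key.
  suff : D = 0 by rewrite /D; lra.
  set s := hnorm x ^+ 2 in key; have s0 : 0 <= s by exact: sqr_ge0.
  have s1 : s + 1 != 0 by rewrite gt_eqF// ltr_wpDl.
  (* The quadratic is smallest at [- D / s]; [s + 1] also covers [x = 0]. *)
  have := key (- D / (s + 1)).
  have -> : 2 * (- D / (s + 1)) * D + (- D / (s + 1)) ^+ 2 * s =
    - (D / (s + 1)) ^+ 2 * (s + 2) by field.
  rewrite mulNr oppr_ge0 => h.
  have : (D / (s + 1)) ^+ 2 <= 0 by have := sqr_ge0 (D / (s + 1)); nra.
  rewrite le_eqVlt ltNge sqr_ge0 orbF sqrf_eq0 mulf_eq0 invr_eq0 => /orP[/eqP//|/eqP].
  lra.
exists l => x; apply: complex_eqP; first exact: Rel.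
(* The imaginary part at [x] is minus the real part at ['i *: x]. *)
by have := Rel ('i *: x); rewrite fZ innerZl !cReiM; lra.
Qed.

Lemma opnorm_le H K (f : H -> K) (M : R) :
  (forall x, hnorm x <= 1 -> hnorm (f x) <= M) -> (opnorm f <= M%:E)%E.
Proof.
by move=> fM; apply: ge_ereal_sup => _ [x /= x1 <-]; rewrite lee_fin; exact: fM.
Qed.

(** Asking only for real homogeneity lets the lemma serve both bundled operators and the bare
    functions [mxop A]. *)
Lemma opnorm_leP H K (f : H -> K) (M : R) :
  (forall (t : R) x, f (t%:C *: x) = t%:C *: f x) ->
  (opnorm f <= M%:E)%E -> forall x, hnorm (f x) <= M * hnorm x.
Proof.
move=> fZ fM x; have [x0|x0] := eqVneq (hnorm x) 0.
  have -> : x = 0 by exact: hnorm_eq0.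
  by have := fZ 0 0; rewrite scale0r => ->; rewrite scale0r !hnorm0 mulr0.
have xp : 0 < hnorm x by rewrite lt_neqAle eq_sym x0 hnorm_ge0.
have : ((hnorm (f ((hnorm x)^-1%:C *: x)))%:E <= M%:E)%E.
  apply: le_trans fM; apply: ereal_sup_ubound; exists ((hnorm x)^-1%:C *: x) => //=.
  by rewrite hnormZr ger0_norm ?invr_ge0 ?hnorm_ge0// mulVf.
rewrite lee_fin fZ hnormZr ger0_norm ?invr_ge0 ?hnorm_ge0//.
by rewrite mulrC ler_pdivrMr.
Qed.

Lemma opnorm_leE H K (f : H -> K) (M : R) : 0 <= M ->
  (forall x, hnorm (f x) <= M * hnorm x) -> (opnorm f <= M%:E)%E.
Proof.
move=> M0 fM; apply: opnorm_le => x x1; rewrite (le_trans (fM x))//.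
by rewrite ler_piMr.
Qed.

Lemma hnorm_le_pairing H (x : H) (M : R) : 0 <= M ->
  (forall y, Re '[x, y] <= M * hnorm y) -> hnorm x <= M.
Proof.
move=> M0 /(_ x); rewrite -hnorm_sqrE expr2; have [->//|x0] := eqVneq (hnorm x) 0.
by rewrite ler_pM2r// lt_neqAle eq_sym x0 hnorm_ge0.
Qed.

End HilbertGeometry.

(** * Bounded operators, matrix norms and cb-norms *)

Section Operators.
Context (R : realType).
Implicit Types H K : innerProductType R.

Lemma bop_ext H K (S T : bop H K) : (forall x, S x = T x) -> S = T.
Proof. by move=> ST; apply/val_inj/funext. Qed.

Lemma bopD H K (S T : bop H K) x : (S + T : bop H K) x = S x + T x. Proof. by []. Qed.
Lemma bopB H K (S T : bop H K) x : (S - T : bop H K) x = S x - T x. Proof. by []. Qed.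
Lemma bopZ H K a (T : bop H K) x : (a *: T : bop H K) x = a *: T x. Proof. by []. Qed.
Lemma bop0 H K x : (0 : bop H K) x = 0. Proof. by []. Qed.
Lemma bop_sum H K I (r : seq I) (P : pred I) (F : I -> bop H K) x :
  (\sum_(i <- r | P i) F i : bop H K) x = \sum_(i <- r | P i) F i x.
Proof. by apply: (big_morph (fun T : bop H K => T x)). Qed.

Lemma bop_leP H K (T : bop H K) (M : R) : (opnorm T <= M%:E)%E ->
  forall x, hnorm (T x) <= M * hnorm x.
Proof. by apply: opnorm_leP => t x; rewrite linearZ. Qed.

Lemma bop_bounded H K (T : bop H K) :
  exists2 M, 0 <= M & forall x, hnorm (T x) <= M * hnorm x.
Proof.
have := bopP T; rewrite inE => -[_ fT]; exists (fine (opnorm T)).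
  by rewrite fine_ge0// opnorm_ge0.
by apply: bop_leP; rewrite fineK// ge0_fin_numE// opnorm_ge0.
Qed.

Lemma bop_of_linear H K (f : H -> K) M : 0 <= M ->
  (forall a x y, f (a *: x + y) = a *: f x + f y) ->
  (forall x, hnorm (f x) <= M * hnorm x) ->
  exists T : bop H K, forall x, T x = f x.
Proof.
move=> M0 fl fM.
have fP : f \in @bounded_linear R H K.
  rewrite inE; split => //.
  by apply: le_lt_trans (ltry M); exact: opnorm_leE.
by exists (Bop fP).
Qed.

(** For fixed [x] the conjugate of [B x] is linear and bounded, so Riesz gives the value at [x].
    Adjoints, averages and the Wittstock extension are all produced this way. *)
Lemma bop_of_form H K (B : H -> K -> R[i]) M : hilbert_space K -> 0 <= M ->
  (forall a x x' y, B (a *: x + x') y = a * B x y + B x' y) ->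
  (forall a x y y', B x (a *: y + y') = conjR R a * B x y + B x y') ->
  (forall x y, Re (B x y) <= M * hnorm x * hnorm y) ->
  exists T : bop H K, forall x y, '[T x, y] = B x y.
Proof.
move=> hK M0 Bl Br BM.
have /choice[f fB] : forall x, exists z, forall y, '[z, y] = B x y.
  move=> x; have [|y|z zB] := @riesz_representation R K (fun y => conjR R (B x y))
    (M * hnorm x) hK.
  - by move=> a y y'; rewrite Br rmorphD rmorphM/= conjRK.
  - by rewrite cRe_conj.
  - by exists z => y; rewrite innerC -zB conjRK.
have [||T TB] := @bop_of_linear H K f M M0.
- by move=> a x x'; apply: inner_eql => z; rewrite innerDl innerZl !fB Bl.
- move=> x; apply: hnorm_le_pairing; first by rewrite mulr_ge0// hnorm_ge0.
  by move=> y; rewrite fB BM.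
- by exists T => x y; rewrite TB.
Qed.

Lemma dsumE H n (x y : {ffun 'I_n -> H}) : '[x, y] = \sum_i '[x i, y i].
Proof. by []. Qed.

Lemma hnorm_dsum H n (x : {ffun 'I_n -> H}) :
  hnorm x ^+ 2 = \sum_i hnorm (x i) ^+ 2.
Proof.
by rewrite hnorm_sqrE dsumE cRe_sum; apply: eq_bigr => i _; rewrite hnorm_sqrE.
Qed.

Lemma mxopZ H K n (A : 'M[bop H K]_n) a x : mxop A (a *: x) = a *: mxop A x.
Proof.
apply/ffunP => i; rewrite !ffunE scaler_sumr; apply: eq_bigr => j _.
by rewrite ffunE linearZ.
Qed.

Lemma inner_mxop H K n (A : 'M[bop H K]_n) x y :
  '[mxop A x, y] = \sum_i \sum_j '[A i j (x j), y i].
Proof. by rewrite dsumE; apply: eq_bigr => i _; rewrite ffunE inner_suml. Qed.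

(** Testing with [y = mxop A x] shows that real parts of pairings determine the norm. This form of
    the bound passes through Banach limits and real linear functionals. *)
Lemma mxnorm_leP H K n (A : 'M[bop H K]_n) (M : R) : 0 <= M ->
  (mxnorm A <= M%:E)%E <->
  (forall x y, Re '[mxop A x, y] <= M * hnorm x * hnorm y).
Proof.
move=> M0; split=> [AM x y|AM].
  apply: le_trans (Re_CauchySchwarz _ _) _; rewrite ler_wpM2r ?hnorm_ge0//.
  by apply: opnorm_leP => // t z; rewrite mxopZ.
apply: opnorm_leE => // x; apply: hnorm_le_pairing => [|y].
  by rewrite mulr_ge0// hnorm_ge0.
exact: AM.
Qed.

Lemma cbnorm_leP H K (X : set 'B(H)) (f : 'B(H) -> 'B(K)) (M : R) :
  (cbnorm X f <= M%:E)%E <->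
  (forall n (A : 'M['B(H)]_n), (forall i j, X (A i j)) -> (mxnorm A <= 1)%E ->
     (mxnorm (map_mx f A) <= M%:E)%E).
Proof.
split=> [fM n A XA A1|fM].
  by apply: le_trans fM; apply: ereal_sup_ubound; exists n, A.
by apply: ge_ereal_sup => _ [n [A [XA A1 ->]]]; exact: fM.
Qed.

Lemma cbnorm_ge0 H K (X : set 'B(H)) (f : 'B(H) -> 'B(K)) : (0 <= cbnorm X f)%E.
Proof.
apply: (@le_trans _ _ (mxnorm (map_mx f (0 : 'M['B(H)]_0)))).
  exact: opnorm_ge0.
apply: ereal_sup_ubound; exists 0%N, 0; split => //; first by case.
apply/mxnorm_leP => // x y; rewrite mul1r inner_mxop big_ord0.
by rewrite mulr_ge0// hnorm_ge0.
Qed.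

Lemma opnorm_mx11 H K (T : bop H K) : mxnorm (const_mx T : 'M[bop H K]_1) = opnorm T.
Proof.
apply/eqP; rewrite eq_le; apply/andP; split.
- apply: ge_ereal_sup => _ [x /= x1 <-].
  apply: ereal_sup_ubound; exists (x ord0) => /=.
    apply: le_trans x1; rewrite -(@ler_pXn2r _ 2) ?nnegrE ?hnorm_ge0//.
    by rewrite hnorm_dsum big_ord1.
  congr EFin; apply/eqP; rewrite -(@eqrXn2 _ 2)// ?hnorm_ge0//.
  by rewrite hnorm_dsum big_ord1 ffunE big_ord1 mxE.
- apply: ge_ereal_sup => _ [x /= x1 <-].
  apply: ereal_sup_ubound; exists [ffun=> x] => /=.
    apply: le_trans x1; rewrite -(@ler_pXn2r _ 2) ?nnegrE ?hnorm_ge0//.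
    by rewrite hnorm_dsum big_ord1 ffunE.
  congr EFin; apply/eqP; rewrite -(@eqrXn2 _ 2)// ?hnorm_ge0//.
  by rewrite hnorm_dsum big_ord1 ffunE big_ord1 mxE ffunE.
Qed.

Lemma opnorm_eq0 H K (T : bop H K) : (opnorm T <= 0)%E -> T = 0.
Proof.
move=> T0; apply: bop_ext => x; apply: hnorm_eq0; apply/eqP.
by rewrite eq_le hnorm_ge0 andbT; have := bop_leP T0 x; rewrite mul0r.
Qed.

End Operators.

(** * Hahn-Banach *)

Section HahnBanach.
Context (R : realType).

Lemma le_inf_add (A B : set R) (c : R) : A !=set0 -> B !=set0 ->
  (forall x y, A x -> B y -> c <= x + y) -> c <= inf A + inf B.
Proof.
move=> A0 B0 cAB; rewrite -lerBlDr; apply: lb_le_inf => // x Ax.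
rewrite lerBlDr -lerBlDl; apply: lb_le_inf => // y By.
by rewrite lerBlDl cAB.
Qed.

Lemma le_scale_inf (A : set R) (t c : R) : 0 < t -> A !=set0 ->
  (forall x, A x -> c <= t * x) -> c <= t * inf A.
Proof.
move=> t0 A0 cA; rewrite -ler_pdivrMl//; apply: lb_le_inf => // x Ax.
by rewrite ler_pdivrMl// cA.
Qed.

Context (V : lmodType R) (D : set V).
Hypothesis D0 : D 0.
Hypothesis Dlin : forall a x y, D x -> D y -> D (a *: x + y).

Definition sublinear_on (q : V -> R) : Prop :=
  (forall x y, D x -> D y -> q (x + y) <= q x + q y) /\
  (forall (t : R) x, 0 < t -> D x -> q (t *: x) <= t * q x).

Let DD x y : D x -> D y -> D (x + y).
Proof. by move=> Dx Dy; rewrite -[x]scale1r; exact: Dlin. Qed.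

Let DZ a x : D x -> D (a *: x).
Proof. by move=> Dx; rewrite -[a *: x]addr0; exact: Dlin. Qed.

Let DN x : D x -> D (- x).
Proof. by move=> Dx; rewrite -scaleN1r; exact: DZ. Qed.

Lemma sublinear0 q : sublinear_on q -> q 0 = 0.
Proof.
move=> [_ qZ]; have h2 : 0 < 2 :> R by [].
have h3 : 0 < 2^-1 :> R by rewrite invr_gt0.
by have := qZ _ 0 h2 D0; have := qZ _ 0 h3 D0; rewrite !scaler0; lra.
Qed.

Lemma sublinear_ge q x : sublinear_on q -> D x -> - q (- x) <= q x.
Proof.
move=> qs Dx; have := qs.1 x (- x) Dx (DN Dx).
by rewrite subrr sublinear0//; lra.
Qed.

(* A sublinear minorant of q; if q is minimal it equals q, which gives the
   superadditivity q x + q y <= q (x + y). *)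
Let relax (q : V -> R) (y x : V) : R :=
  inf [set q (x + t *: y) - t * q y | t in [set t : R | 0 <= t]].

Let relax_lb q y x : sublinear_on q -> D x -> D y ->
  has_lbound [set q (x + t *: y) - t * q y | t in [set t : R | 0 <= t]].
Proof.
move=> qs Dx Dy; exists (- q (- x)) => _ [t /= t0 <-].
(* Sublinearity assumes one inequality; scaling back by [t^-1] gives the other. *)
rewrite lerBrDr; have : t * q y = q (t *: y).
  move: t0; rewrite le_eqVlt => /orP[/eqP<-|t0].
    by rewrite scale0r sublinear0// mul0r.
  apply/eqP; rewrite eq_le qs.2// andbT -ler_pdivlMl//.
  have := qs.2 t^-1 (t *: y); rewrite scalerA mulVf ?gt_eqF// scale1r.
  by apply; [rewrite invr_gt0|exact: DZ].
move=> ->; have := qs.1 (x + t *: y) (- x) (DD Dx (DZ t Dy)) (DN Dx).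
by rewrite addrAC subrr add0r; lra.
Qed.

Let relax_n0 (q : V -> R) y x :
  [set q (x + t *: y) - t * q y | t in [set t : R | 0 <= t]] !=set0.
Proof. by exists (q (x + 0 *: y) - 0 * q y), 0 => /=. Qed.

Let relax_le q y x t : sublinear_on q -> D x -> D y -> 0 <= t ->
  relax q y x <= q (x + t *: y) - t * q y.
Proof. by move=> qs Dx Dy t0; apply: ge_inf; [exact: relax_lb|exists t]. Qed.

Let relax_sublinear q y : sublinear_on q -> D y -> sublinear_on (relax q y).
Proof.
move=> qs Dy; split=> [x x' Dx Dx'|t x t0 Dx].
  apply: le_inf_add; [exact: relax_n0|exact: relax_n0|].
  move=> _ _ [s /= s0 <-] [s' /= s'0 <-].
  apply: (le_trans (@relax_le q y (x + x') (s + s') qs _ Dy _)).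
  - exact: DD.
  - exact: addr_ge0.
  have := qs.1 (x + s *: y) (x' + s' *: y) (DD Dx (DZ s Dy)) (DD Dx' (DZ s' Dy)).
  by rewrite scalerDl addrACA; lra.
apply: le_scale_inf; [exact: t0|exact: relax_n0|].
move=> _ [s /= s0 <-].
apply: (le_trans (@relax_le q y (t *: x) (t * s) qs _ Dy _)).
- exact: DZ.
- by rewrite mulr_ge0// ltW.
have := qs.2 t (x + s *: y) t0 (DD Dx (DZ s Dy)).
by rewrite scalerDr scalerA; lra.
Qed.

Theorem sublinear_dominates_linear (p : V -> R) : sublinear_on p ->
  exists f : V -> R,
    (forall a x y, D x -> D y -> f (a *: x + y) = a * f x + f y) /\
    (forall x, D x -> f x <= p x).
Proof.
move=> ps.
(* Zorn is applied to an antisymmetric order; vanishing off [D] makes functionals that agree on [D]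
   equal. *)
pose good (q : V -> R) := [/\ sublinear_on q, forall x, D x -> q x <= p x &
                           forall x, ~ D x -> q x = 0].
pose T := {q | good q}.
(* The order is reversed, so that a maximal element is a minimal functional. *)
pose ord (q q' : T) : bool := `[< forall x, D x -> sval q' x <= sval q x >].
pose trunc (q : V -> R) x : R := if `[< D x >] then q x else 0.
have truncE q x : D x -> trunc q x = q x by move=> Dx; rewrite /trunc asboolT.
have truncs q : sublinear_on q -> sublinear_on (trunc q).
  move=> qs; split=> [x y Dx Dy|t x t0 Dx].
    by rewrite !truncE//; [exact: qs.1|exact: DD].
  by rewrite !truncE//; [exact: qs.2|exact: DZ].
have mkT q : sublinear_on q -> (forall x, D x -> q x <= p x) ->
    exists q' : T, forall x, D x -> sval q' x = q x.
  move=> qs qp.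
  have qT : good (trunc q).
    split; [exact: truncs| by move=> x Dx; rewrite truncE// qp|].
    by move=> x Dx; rewrite /trunc asboolF.
  by exists (exist good _ qT) => x Dx /=; rewrite truncE.
have [||||q qmin] := @Zorn T ord.
- by move=> q; apply/asboolP.
- move=> q r s /asboolP qr /asboolP rs; apply/asboolP => x Dx.
  exact: le_trans (rs x Dx) (qr x Dx).
- move=> [q [qs qp q0]] [r [rs rp r0]] /asboolP/= qr /asboolP/= rq.
  apply: eq_exist; apply/funext => x; have [Dx|Dx] := pselect (D x).
    by apply/eqP; rewrite eq_le qr// rq.
  by rewrite q0// r0.
- move=> A tA; have [[q0 Aq0]|A0] := pselect (exists q, A q); last first.
    have [q _] := mkT p ps (fun x _ => lexx (p x)).
    by exists q => s As; exfalso; apply: A0; exists s.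
  (* The bound of a chain is its pointwise infimum, finite because of [- p (- x)]. In the proof of
     subadditivity, two members of the chain are replaced by the smaller one. *)
  pose S x := [set sval q x | q in A].
  have Sn0 x : S x !=set0 by exists (sval q0 x), q0.
  have Slb x : D x -> has_lbound (S x).
    move=> Dx; exists (- p (- x)) => _ [q _ <-].
    have [qs qp _] := svalP q; apply: le_trans (sublinear_ge qs Dx).
    by rewrite lerN2 qp//; exact: DN.
  have Sle q x : A q -> D x -> inf (S x) <= sval q x.
    by move=> Aq Dx; apply: ge_inf; [exact: Slb|exists q].
  have [||q qE] := mkT (fun x => inf (S x)).
  + split=> [x y Dx Dy|t x t0 Dx].
      apply: le_inf_add => // _ _ [q Aq <-] [r Ar <-].
      have [qs _ _] := svalP q; have [rs _ _] := svalP r.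
      have [/asboolP qr|/asboolP rq] := tA q r Aq Ar.
      * apply: le_trans (Sle r _ Ar (DD Dx Dy)) _.
        by apply: le_trans (rs.1 _ _ Dx Dy) _; rewrite lerD2r qr.
      * apply: le_trans (Sle q _ Aq (DD Dx Dy)) _.
        by apply: le_trans (qs.1 _ _ Dx Dy) _; rewrite lerD2l rq.
    apply: le_scale_inf => // _ [q Aq <-]; have [qs _ _] := svalP q.
    by apply: le_trans (Sle q _ Aq (DZ t Dx)) _; exact: qs.2.
  + move=> x Dx; have [_ qp _] := svalP q0.
    by apply: le_trans (Sle q0 _ Aq0 Dx) _; exact: qp.
  + by exists q => s As; apply/asboolP => x Dx; rewrite qE// Sle.
have [qs qp _] := svalP q; set f := sval q in qs qp.
have superadd x y : D x -> D y -> f x + f y <= f (x + y).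
  move=> Dx Dy.
  have fle z : D z -> relax f y z <= f z.
    move=> Dz; have := relax_le qs Dz Dy (lexx 0).
    by rewrite scale0r addr0 mul0r subr0.
  have [||r rE] := mkT (relax f y); first exact: relax_sublinear.
    by move=> z Dz; apply: le_trans (fle _ Dz) (qp _ Dz).
  have : ord q r by apply/asboolP => z Dz; rewrite rE// fle.
  (* Minimality turns the relaxation back into [f]; its bound at [t = 1] is superadditivity. *)
  move=> /qmin rq; have := relax_le qs Dx Dy ler01.
  by rewrite -rE// rq scale1r mul1r lerBrDr.
have fD x y : D x -> D y -> f (x + y) = f x + f y.
  by move=> Dx Dy; apply/eqP; rewrite eq_le superadd// qs.1.
have f0 : f 0 = 0 by exact: sublinear0.
have fN x : D x -> f (- x) = - f x.
  by move=> Dx; have := fD x (- x) Dx (DN Dx); rewrite subrr f0; lra.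
have fZp t x : 0 < t -> D x -> f (t *: x) = t * f x.
  move=> t0 Dx; apply/eqP; rewrite eq_le qs.2// -ler_pdivlMl//.
  have := qs.2 t^-1 (t *: x); rewrite scalerA mulVf ?gt_eqF// scale1r.
  by apply; [rewrite invr_gt0|exact: DZ].
exists f; split=> // a x y Dx Dy; rewrite fD//; last exact: DZ.
congr (_ + _); have [a0|a0|->] := ltgtP a 0.
- by rewrite -[a]opprK scaleNr fN ?fZp ?oppr_gt0//; [rewrite !mulNr|exact: DZ].
- exact: fZp.
- by rewrite scale0r f0 mul0r.
Qed.

End HahnBanach.

(** * Wittstock's extension theorem *)

Section DualFamily.
Context (R : realType) (K : innerProductType R).

(* Q is the orthogonal projection onto the column space of the Gram matrix G of
   a; it factors as G *m L, and k is L^* applied to a. *)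
Lemma gram_dual n (a : {ffun 'I_n -> K}) : exists k : {ffun 'I_n -> K},
  [/\ forall i, \sum_j '[a i, k j] *: a j = a i,
      forall i j, '[a i, k j] = conjR R '[a j, k i] &
      forall i j, \sum_l '[a i, k l] * '[a l, k j] = '[a i, k j]].
Proof.
pose G : 'M[R[i]]_n := \matrix_(i, j) '[a i, a j].
have Gh : map_mx (conjR R) G^T = G.
  by apply/matrixP => i j; rewrite !mxE -innerC.
have /orthomx_spectralP GE : G \is normalmx.
  by apply/normalmxP; rewrite Gh.
have := spectral_unitarymx G; set P := spectralmx G in GE *.
set d := spectral_diag G in GE *; move=> Pu.
rewrite invmx_unitary// in GE.
(* Pseudo-inverse of the spectrum: since [0^-1] is [0], the product with [d] is the 0/1 row [dp],
   which makes [Q] a self-adjoint idempotent. *)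
pose di : 'rV[R[i]]_n := \row_i (d 0 i)^-1.
pose dp : 'rV[R[i]]_n := \row_i (d 0 i != 0)%:R.
pose Pt := map_mx (conjR R) P^T.
have PPt : P *m Pt = 1%:M by apply/eqP; exact: Pu.
have diagM (u v : 'rV[R[i]]_n) :
    diag_mx u *m diag_mx v = diag_mx (\row_i (u 0 i * v 0 i)).
  apply/matrixP => i j; rewrite mul_diag_mx !mxE.
  by case: (i == j); rewrite ?mulr1n ?mulr0n ?mulr0.
have sandwich u v : (Pt *m diag_mx u *m P) *m (Pt *m diag_mx v *m P) =
    Pt *m diag_mx (\row_i (u 0 i * v 0 i)) *m P.
  by rewrite -diagM !mulmxA -(mulmxA (Pt *m _)) PPt mulmx1.
pose L := Pt *m diag_mx di *m P.
pose Q := Pt *m diag_mx dp *m P.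
have GL : G *m L = Q.
  rewrite GE sandwich; congr (_ *m diag_mx _ *m _); apply/rowP => i; rewrite !mxE.
  by have [->|d0] := eqVneq (d 0 i) 0; rewrite ?mul0r// divff.
have QG : Q *m G = G.
  rewrite GE sandwich; congr (_ *m diag_mx _ *m _); apply/rowP => i; rewrite !mxE.
  by have [->|d0] := eqVneq (d 0 i) 0; rewrite ?mulr0// mul1r.
have QQ : Q *m Q = Q.
  rewrite sandwich; congr (_ *m diag_mx _ *m _); apply/rowP => i; rewrite !mxE.
  by case: (d 0 i != 0); rewrite ?mulr1 ?mulr0.
have Qh : map_mx (conjR R) Q^T = Q.
  rewrite /Q !trmx_mul !map_mxM tr_diag_mx -mulmxA; congr (_ *m (_ *m _)).
  - apply/matrixP => i j; rewrite !mxE rmorphMn/=.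
    by congr (_ *+ _); case: (_ == _); rewrite ?rmorph0 ?rmorph1.
  - by apply/matrixP => i j; rewrite !mxE; exact: conjRK.
pose k := [ffun j => \sum_l conjR R (L l j) *: a l].
have kE i j : '[a i, k j] = Q i j.
  rewrite -GL mxE ffunE inner_sumr; apply: eq_bigr => l _.
  by rewrite innerZr conjRK [G _ _]mxE mulrC.
exists k; split=> [i|i j|i j].
- under eq_bigr do rewrite kE.
  (* [s - a i] lies in the span of the family and, by [Q *m G = G], is orthogonal to it. *)
  set s := \sum_j _; apply/eqP; rewrite -subr_eq0; apply/eqP.
  have sa l : '[s - a i, a l] = 0.
    rewrite innerBl inner_suml.
    have -> : '[a i, a l] = (Q *m G) i l by rewrite QG mxE.
    rewrite [(Q *m G) i l]mxE.
    apply/eqP; rewrite subr_eq0; apply/eqP/eq_bigr => j _.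
    by rewrite innerZl [G _ _]mxE.
  apply: hnorm_eq0; apply/eqP; rewrite -sqrf_eq0 hnorm_sqrE innerBr sa subr0.
  by rewrite inner_sumr big1// => j _; rewrite innerZr sa mulr0.
- by rewrite !kE -[in LHS]Qh [LHS]mxE; congr (conjR R _); rewrite mxE.
- by rewrite kE -[in RHS]QQ mxE; apply: eq_bigr => l _; rewrite !kE.
Qed.

End DualFamily.

(** * Direct sums of tuples and block-diagonal matrices *)

Section Concatenation.
Context (R : realType).
Implicit Types H K : innerProductType R.

Definition ffcat (T : Type) n m (a : {ffun 'I_n -> T}) (b : {ffun 'I_m -> T}) :
    {ffun 'I_(n + m) -> T} :=
  [ffun i => match fintype.split i with inl j => a j | inr j => b j end].

Lemma ffcatl (T : Type) n m (a : {ffun 'I_n -> T}) (b : {ffun 'I_m -> T})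
    (i : 'I_n) :
  ffcat a b (lshift m i) = a i.
Proof. by rewrite ffunE (unsplitK (inl i)). Qed.

Lemma ffcatr (T : Type) n m (a : {ffun 'I_n -> T}) (b : {ffun 'I_m -> T})
    (i : 'I_m) :
  ffcat a b (rshift n i) = b i.
Proof. by rewrite ffunE (unsplitK (inr i)). Qed.

Lemma ffcatP (T : Type) n m (a : {ffun 'I_(n + m) -> T}) :
  exists b c, a = @ffcat T n m b c.
Proof.
exists [ffun i => a (lshift m i)], [ffun i => a (rshift n i)].
by apply/ffunP => i; rewrite -(splitK i) ffunE unsplitK; case: (fintype.split i) => j;
   rewrite ffunE.
Qed.

Lemma inner_ffcat H n m (a a' : {ffun 'I_n -> H}) (b b' : {ffun 'I_m -> H}) :
  '[ffcat a b, ffcat a' b'] = '[a, a'] + '[b, b'].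
Proof.
rewrite !dsumE big_split_ord; congr (_ + _); apply: eq_bigr => i _.
  by rewrite !ffcatl.
by rewrite !ffcatr.
Qed.

Lemma hnorm_ffcat H n m (a : {ffun 'I_n -> H}) (b : {ffun 'I_m -> H}) :
  hnorm (ffcat a b) ^+ 2 = hnorm a ^+ 2 + hnorm b ^+ 2.
Proof. by rewrite !hnorm_sqrE inner_ffcat cReD. Qed.

Lemma mxop_block H K n m (A : 'M[bop H K]_n) (B : 'M[bop H K]_m) x y :
  mxop (block_mx A 0 0 B) (ffcat x y) = ffcat (mxop A x) (mxop B y).
Proof.
apply/ffunP => i; rewrite -(splitK i) [LHS]ffunE big_split_ord.
case: (fintype.split i) => k /=.
- rewrite ffcatl [in RHS]ffunE [X in _ + X]big1 ?addr0; last first.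
    by move=> j _; rewrite block_mxEur mxE.
  by apply: eq_bigr => j _; rewrite block_mxEul ffcatl.
- rewrite ffcatr [in RHS]ffunE big1 ?add0r; last first.
    by move=> j _; rewrite block_mxEdl mxE.
  by apply: eq_bigr => j _; rewrite block_mxEdr ffcatr.
Qed.

Lemma mxnorm_le1P H K n (A : 'M[bop H K]_n) :
  (mxnorm A <= 1)%E <-> (forall x, hnorm (mxop A x) ^+ 2 <= hnorm x ^+ 2).
Proof.
split=> [A1 x|A1].
  rewrite ler_pXn2r ?nnegrE ?hnorm_ge0// -[leRHS]mul1r.
  by apply: opnorm_leP => // t z; rewrite mxopZ.
apply: opnorm_leE => // x; rewrite mul1r.
by rewrite -(@ler_pXn2r _ 2) ?nnegrE ?hnorm_ge0.
Qed.

Lemma mxnorm_block_le1 H K n m (A : 'M[bop H K]_n) (B : 'M[bop H K]_m) :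
  (mxnorm A <= 1)%E -> (mxnorm B <= 1)%E ->
  (mxnorm (block_mx A 0 0 B : 'M[bop H K]_(n + m)) <= 1)%E.
Proof.
move=> /mxnorm_le1P A1 /mxnorm_le1P B1; apply/mxnorm_le1P => z.
have [x [y ->]] := ffcatP z.
by rewrite mxop_block !hnorm_ffcat lerD.
Qed.

End Concatenation.

Section Compression.
Context (R : realType).
Implicit Types H K : innerProductType R.

(** The scalar matrix [Q] tensored with the identity of [H], acting on [H^n]. *)
Definition scalop H n (Q : 'I_n -> 'I_n -> R[i]) (x : {ffun 'I_n -> H}) :
  {ffun 'I_n -> H} := [ffun i => \sum_j Q i j *: x j].

Lemma scalop_adjoint H n (Q : 'I_n -> 'I_n -> R[i]) (x y : {ffun 'I_n -> H}) :
  (forall i j, Q i j = conjR R (Q j i)) -> '[scalop Q x, y] = '[x, scalop Q y].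
Proof.
move=> Qh; rewrite !dsumE.
transitivity (\sum_i \sum_j Q i j * '[x j, y i]).
  apply: eq_bigr => i _; rewrite ffunE inner_suml.
  by apply: eq_bigr => j _; rewrite innerZl.
rewrite exchange_big; apply: eq_bigr => j _; rewrite ffunE inner_sumr.
by apply: eq_bigr => i _; rewrite innerZr -Qh.
Qed.

(** For a self-adjoint idempotent, |Q x|^2 is the pairing of x with Q x; Cauchy-Schwarz
    concludes. *)
Lemma scalop_contract H n (Q : 'I_n -> 'I_n -> R[i]) (x : {ffun 'I_n -> H}) :
  (forall i j, Q i j = conjR R (Q j i)) ->
  (forall i j, \sum_k Q i k * Q k j = Q i j) ->
  hnorm (scalop Q x) ^+ 2 <= hnorm x ^+ 2.
Proof.
move=> Qh QQ; set y := scalop Q x.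
have Qy : scalop Q y = y.
  apply/ffunP => i; rewrite !ffunE.
  under eq_bigr do rewrite ffunE scaler_sumr.
  rewrite exchange_big/=; apply: eq_bigr => j _.
  under eq_bigr do rewrite scalerA.
  by rewrite -scaler_suml QQ.
have yy : '[y, y] = '[x, y] by rewrite {1}/y scalop_adjoint// Qy.
have := Re_CauchySchwarz x y; rewrite -yy -hnorm_sqrE => h.
have := hnorm_ge0 x; have := hnorm_ge0 y; nra.
Qed.

(** As an operator on [H^n], [z] is the product P x Q of three contractions. *)
Lemma compression_le1 H n (P Q : 'I_n -> 'I_n -> R[i]) (x z : 'M['B(H)]_n) :
  (forall i j, P i j = conjR R (P j i)) ->
  (forall i j, \sum_k P i k * P k j = P i j) ->
  (forall i j, Q i j = conjR R (Q j i)) ->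
  (forall i j, \sum_k Q i k * Q k j = Q i j) ->
  (forall i j, z i j = \sum_k \sum_l (P i k * Q l j) *: x k l) ->
  (mxnorm x <= 1)%E -> (mxnorm z <= 1)%E.
Proof.
move=> Ph PP Qh QQ zE /mxnorm_le1P x1; apply/mxnorm_le1P => h.
have -> : mxop z h = scalop P (mxop x (scalop Q h)).
  apply/ffunP => i; rewrite !ffunE.
  under eq_bigr do rewrite zE bop_sum.
  rewrite exchange_big/=; apply: eq_bigr => k _; rewrite ffunE.
  under eq_bigr do rewrite bop_sum.
  rewrite exchange_big/= scaler_sumr; apply: eq_bigr => l _.
  rewrite ffunE linear_sum scaler_sumr; apply: eq_bigr => j _.
  by rewrite linearZ scalerA.
apply: le_trans (scalop_contract _ Ph PP) _.
by apply: le_trans (x1 _) _; exact: scalop_contract.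
Qed.

End Compression.

(** * Tensors in real coordinates *)

Section Tensors.
Context (R : realType) (H K : innerProductType R).

(* The element sum_ij a_i (x) x_ij (x) b_j of conj(K) (x) B(H) (x) K, seen as a
   function K x K -> B(H). *)
Definition tens n (a b : {ffun 'I_n -> K}) (x : 'M['B(H)]_n) (k l : K) : 'B(H) :=
  \sum_i \sum_j ('[k, a i] * '[b j, l]) *: x i j.

(* tens in real coordinates, so as to live in a real vector space. *)
Definition ctens n (a b : {ffun 'I_n -> K}) (x : 'M['B(H)]_n) :
    K * K * H * H -> R^o :=
  fun q => Re '[tens a b x q.1.1.1 q.1.1.2 q.1.2, q.2].

Definition ctens1 (a : K) (x : 'B(H)) (b : K) : K * K * H * H -> R^o :=
  fun q => Re ('[q.1.1.1, a] * '[b, q.1.1.2] * '[x q.1.2, q.2]).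

(** Real coordinates lose nothing: the imaginary part is read off by testing against ['i *: h']. *)
Lemma ctens_inj n m (a b : {ffun 'I_n -> K}) x (a' b' : {ffun 'I_m -> K}) x' k l :
  ctens a b x = ctens a' b' x' -> tens a b x k l = tens a' b' x' k l.
Proof.
move=> E; apply: bop_ext => h; apply: inner_eql => h'; apply: complex_eqP.
  by have /(congr1 (fun f => f (k, l, h, h'))) := E.
have /(congr1 (fun f => f (k, l, h, 'i *: h'))) := E.
by rewrite /ctens /= !innerZr conjR_i !mulNr !cReN !cReiM !opprK.
Qed.

Lemma ctens_sum n (a b : {ffun 'I_n -> K}) x :
  ctens a b x = \sum_i \sum_j ctens1 (a i) (x i j) (b j).
Proof.
apply/funext => q; rewrite /ctens bop_sum inner_suml cRe_sum fct_sumE.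
apply: eq_bigr => i _; rewrite bop_sum inner_suml cRe_sum fct_sumE.
by apply: eq_bigr => j _; rewrite bopZ innerZl.
Qed.

Lemma ctens1E a x b :
  ctens1 a x b = ctens ([ffun=> a] : {ffun 'I_1 -> K}) [ffun=> b] (const_mx x).
Proof. by rewrite ctens_sum !big_ord1 !ffunE mxE. Qed.

(** Representations add by direct sum. With [hnorm_ffcat] and [mxnorm_block_le1], this is the source
    of subadditivity in the extension theorem. *)
Lemma ctens_cat n m (a b : {ffun 'I_n -> K}) x (a' b' : {ffun 'I_m -> K}) x' :
  ctens (ffcat a a') (ffcat b b') (block_mx x 0 0 x') =
  ctens a b x + ctens a' b' x'.
Proof.
have c0 k l : ctens1 k 0 l = 0.
  by apply/funext => q; rewrite /ctens1 bop0 inner0l mulr0.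
rewrite !ctens_sum big_split_ord; congr (_ + _); apply: eq_bigr => i _.
- rewrite big_split_ord/= [X in _ + X]big1 ?addr0; last first.
    by move=> j _; rewrite block_mxEur mxE c0.
  by apply: eq_bigr => j _; rewrite block_mxEul !ffcatl.
- rewrite big_split_ord/= big1 ?add0r; last first.
    by move=> j _; rewrite block_mxEdl mxE c0.
  by apply: eq_bigr => j _; rewrite block_mxEdr !ffcatr.
Qed.

Lemma ctens1_realZ s r t a x b :
  ctens1 (s%:C *: a) (r%:C *: x) (t%:C *: b) = (s * r * t) *: ctens1 a x b.
Proof.
apply/funext => q; rewrite /ctens1 !innerZl !innerZr conjR_real.
have -> : forall z w y : R[i], s%:C * z * (t%:C * w) * (r%:C * y) =
    (s * r * t)%:C * (z * w * y) by move=> z w y; rewrite !rmorphM/=; ring.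
by rewrite cRe_realM.
Qed.

Lemma ctens_realZ s t n (a b : {ffun 'I_n -> K}) x :
  ctens (s%:C *: a) (t%:C *: b) x = (s * t) *: ctens a b x.
Proof.
rewrite !ctens_sum scaler_sumr; apply: eq_bigr => i _.
rewrite scaler_sumr; apply: eq_bigr => j _.
by rewrite !ffunE -[x i j]scale1r -[1]/(1%:C) ctens1_realZ scale1r mulr1.
Qed.

Lemma ctensN n (a b : {ffun 'I_n -> K}) x : ctens (- a) b x = - ctens a b x.
Proof.
have := ctens_realZ (-1) 1 a b x.
by rewrite rmorphN1 !scaleN1r scale1r mulr1 scaleN1r.
Qed.

Lemma ctens1Dl a a' x b : ctens1 (a + a') x b = ctens1 a x b + ctens1 a' x b.
Proof. by apply/funext => q; rewrite /ctens1 innerDr !mulrDl cReD. Qed.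

Lemma ctens1Dr a x b b' : ctens1 a x (b + b') = ctens1 a x b + ctens1 a x b'.
Proof. by apply/funext => q; rewrite /ctens1 innerDl mulrDr mulrDl cReD. Qed.

Lemma ctens1Dm a x x' b : ctens1 a (x + x') b = ctens1 a x b + ctens1 a x' b.
Proof. by apply/funext => q; rewrite /ctens1 bopD innerDl mulrDr cReD. Qed.

(** A dominated functional on tensors is only real linear. Moving complex scalars onto [b] reduces
    linearity in [x], and conjugate linearity in [a], to linearity in [b]. *)
Lemma ctens1_swap_right z a x b : ctens1 a (z *: x) b = ctens1 a x (z *: b).
Proof.
apply/funext => q; rewrite /ctens1 bopZ !innerZl; congr (Re _).
by rewrite mulrA [_ * z]mulrC !mulrA [z * _]mulrC.
Qed.

Lemma ctens1_swap_left z a x b : ctens1 (conjR R z *: a) x b = ctens1 a x (z *: b).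
Proof.
apply/funext => q; rewrite /ctens1 innerZl innerZr conjRK; congr (Re (_ * _)).
by rewrite -mulrA mulrCA.
Qed.

End Tensors.

(** * Extension of a completely bounded map *)

Section Wittstock.
Context (R : realType) (H K : innerProductType R).
Context (V : set 'B(H)) (u : 'B(H) -> 'B(K)) (c : R).
Hypothesis V0 : V 0.
Hypothesis Vlin : forall a S T, V S -> V T -> V (a *: S + T).
Hypothesis ulin : forall a S T, V S -> V T -> u (a *: S + T) = a *: u S + u T.
Hypothesis c0 : 0 <= c.
Hypothesis uc : (cbnorm V u <= c%:E)%E.

Let VZ a T : V T -> V (a *: T).
Proof. by move=> VT; rewrite -[_ *: _]addr0; exact: Vlin. Qed.

Let VD S T : V S -> V T -> V (S + T).
Proof. by move=> VS VT; rewrite -[S]scale1r; exact: Vlin. Qed.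

Let Vsum n (F : 'I_n -> 'B(H)) : (forall i, V (F i)) -> V (\sum_i F i).
Proof. by move=> VF; apply: (big_ind V) => // i _. Qed.

Let u0 : u 0 = 0.
Proof.
have := ulin 1 V0 V0; rewrite !scale1r addr0 => /eqP.
by rewrite -subr_eq0 opprD addrA subrr add0r oppr_eq0 => /eqP.
Qed.

Let uD S T : V S -> V T -> u (S + T) = u S + u T.
Proof. by move=> VS VT; rewrite -[S in LHS]scale1r ulin// scale1r. Qed.

Let uZ a T : V T -> u (a *: T) = a *: u T.
Proof. by move=> VT; rewrite -[_ *: T]addr0 ulin// u0 addr0. Qed.

Let usum n (F : 'I_n -> 'B(H)) : (forall i, V (F i)) ->
  u (\sum_i F i) = \sum_i u (F i).
Proof.
move=> VF.
suff : V (\sum_i F i) /\ u (\sum_i F i) = \sum_i u (F i) by case.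
apply: (big_ind2 (fun S T => V S /\ u S = T)) => // S T S' T' [VS <-] [VS' <-].
by split; [exact: VD|exact: uD].
Qed.

Let Vtens n (a b : {ffun 'I_n -> K}) (v : 'M['B(H)]_n) k l :
  (forall i j, V (v i j)) -> V (tens a b v k l).
Proof. by move=> Vv; apply: Vsum => i; apply: Vsum => j; exact: VZ. Qed.

(** Expanding [a] over [e] and [b] over [f] leaves only values of the tensor at the dual vectors
    [k], [l]; hence the pairing depends on the tensor and not on its representation. *)
Lemma pairing_tens n m (a b : {ffun 'I_n -> K}) (v : 'M['B(H)]_n)
    (e k f l : {ffun 'I_m -> K}) :
  (forall i j, V (v i j)) ->
  (forall i, \sum_j '[a i, k j] *: e j = a i) ->
  (forall i, \sum_j '[b i, l j] *: f j = b i) ->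
  '[mxop (map_mx u v) b, a] =
  \sum_s \sum_t '[u (tens a b v (k s) (l t)) (f t), e s].
Proof.
move=> Vv ka lb; rewrite inner_mxop.
transitivity (\sum_i \sum_j \sum_s \sum_t
    ('[k s, a i] * '[b j, l t]) * '[u (v i j) (f t), e s]).
  apply: eq_bigr => i _; apply: eq_bigr => j _.
  rewrite mxE -{1}(ka i) inner_sumr; apply: eq_bigr => s _.
  rewrite innerZr -innerC -(lb j) linear_sum inner_suml mulr_sumr.
  apply: eq_bigr => t _; rewrite linearZ innerZl mulrA lb.
  by [].
under eq_bigr do rewrite exchange_big/=.
rewrite exchange_big/=; apply: eq_bigr => s _.
under eq_bigr do rewrite exchange_big/=.
rewrite exchange_big/=; apply: eq_bigr => t _.
rewrite /tens usum; last by move=> i; apply: Vsum => j; exact: VZ.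
rewrite bop_sum inner_suml; apply: eq_bigr => i _.
rewrite usum; last by move=> j; exact: VZ.
rewrite bop_sum inner_suml; apply: eq_bigr => j _.
by rewrite uZ// bopZ innerZl.
Qed.

Lemma pairing_eq n m (a b : {ffun 'I_n -> K}) (v : 'M['B(H)]_n)
    (a' b' : {ffun 'I_m -> K}) (v' : 'M['B(H)]_m) :
  (forall i j, V (v i j)) -> (forall i j, V (v' i j)) ->
  (forall k l, tens a b v k l = tens a' b' v' k l) ->
  '[mxop (map_mx u v) b, a] = '[mxop (map_mx u v') b', a'].
Proof.
move=> Vv Vv' E.
(* Dual families of the concatenated tuples expand both representations at once. *)
have [k [ka _ _]] := gram_dual (ffcat a a').
have [l [lb _ _]] := gram_dual (ffcat b b').
rewrite (@pairing_tens _ _ a b v (ffcat a a') k (ffcat b b') l)//; first last.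
- by move=> i; have := lb (lshift m i); rewrite ffcatl.
- by move=> i; have := ka (lshift m i); rewrite ffcatl.
rewrite (@pairing_tens _ _ a' b' v' (ffcat a a') k (ffcat b b') l)//; first last.
- by move=> i; have := lb (rshift n i); rewrite ffcatr.
- by move=> i; have := ka (rshift n i); rewrite ffcatr.
by apply: eq_bigr => s _; apply: eq_bigr => t _; rewrite E.
Qed.

(* Compressing x by the Gram projections of a' and b' leaves the tensor unchanged
   and moves the entries of x into V. *)
Lemma pairing_le n m (a b : {ffun 'I_n -> K}) (v : 'M['B(H)]_n)
    (a' b' : {ffun 'I_m -> K}) (x : 'M['B(H)]_m) :
  (forall i j, V (v i j)) -> (mxnorm x <= 1)%E ->
  ctens a b v = ctens a' b' x ->
  Re '[mxop (map_mx u v) b, a] <= c / 2 * (hnorm a' ^+ 2 + hnorm b' ^+ 2).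
Proof.
move=> Vv x1 /ctens_inj E.
have [k [ka kh kk]] := gram_dual a'.
have [l [lb lh ll]] := gram_dual b'.
(* The compressed matrix, written as values of the tensor: computed from [v] they lie in [V],
   computed from [x] they show the compression. *)
pose z : 'M['B(H)]_m := \matrix_(i, j) tens a b v (k i) (l j).
have Vz i j : V (z i j) by rewrite mxE; exact: Vtens.
have z1 : (mxnorm z <= 1)%E.
  apply: (@compression_le1 R H m (fun i j => '[a' i, k j]) (fun i j => '[b' i, l j]) x z) => //.
  move=> i j; rewrite mxE E; apply: eq_bigr => s _; apply: eq_bigr => t _.
  by rewrite [in RHS]kh -innerC.
rewrite (@pairing_eq _ _ a b v a' b' z)//; last first.
  move=> p q; rewrite E /tens.
  (* By the reproducing identities [ka] and [lb] the coefficient of each [x s t] is unchanged; the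
     rest is reordering of sums. *)
  transitivity (\sum_s \sum_t (\sum_i \sum_j
     ('[p, a' i] * '[b' j, q] * ('[k i, a' s] * '[b' t, l j]))) *: x s t).
    apply: eq_bigr => s _; apply: eq_bigr => t _; congr (_ *: _).
    transitivity ((\sum_i '[p, a' i] * '[k i, a' s]) *
                  (\sum_j '[b' j, q] * '[b' t, l j])).
      congr (_ * _).
        rewrite -{1}(ka s) inner_sumr; apply: eq_bigr => i _.
        by rewrite innerZr -innerC mulrC.
      rewrite -{1}(lb t) inner_suml; apply: eq_bigr => j _.
      by rewrite innerZl mulrC.
    rewrite mulr_suml; apply: eq_bigr => i _.
    by rewrite mulr_sumr; apply: eq_bigr => j _; rewrite mulrACA.
  transitivity (\sum_i \sum_j \sum_s \sum_t
     ('[p, a' i] * '[b' j, q] * ('[k i, a' s] * '[b' t, l j])) *: x s t).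
    under eq_bigr do under eq_bigr do rewrite scaler_suml.
    under eq_bigr do rewrite exchange_big/=.
    rewrite exchange_big/=; apply: eq_bigr => i _.
    under eq_bigr do under eq_bigr do rewrite scaler_suml.
    under eq_bigr do rewrite exchange_big/=.
    by rewrite exchange_big/=.
  apply: eq_bigr => i _; apply: eq_bigr => j _; rewrite mxE E /tens scaler_sumr.
  apply: eq_bigr => s _; rewrite scaler_sumr; apply: eq_bigr => t _.
  by rewrite scalerA.
have /cbnorm_leP/(_ _ _ Vz z1)/mxnorm_leP := uc => /(_ c0 b' a') h.
apply: le_trans h _; have := mulr_ge0 c0 (sqr_ge0 (hnorm a' - hnorm b')); lra.
Qed.


(** A real subspace in spite of the norm condition: scalars are absorbed by [a], and sums become
    direct sums. *)
Let dom (w : K * K * H * H -> R^o) : Prop :=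
  exists n (a b : {ffun 'I_n -> K}) x, (mxnorm x <= 1)%E /\ w = ctens a b x.

Let dom_ctens n (a b : {ffun 'I_n -> K}) (x : 'M['B(H)]_n) : (mxnorm x <= 1)%E -> dom (ctens a b x).
Proof. by exists n, a, b, x. Qed.

Let nil0 (a b : {ffun 'I_0 -> K}) (x : 'M['B(H)]_0) : ctens a b x = 0.
Proof. by rewrite ctens_sum big_ord0. Qed.

Let norm0 (x : 'M['B(H)]_0) : (mxnorm x <= 1)%E.
Proof. by apply/mxnorm_le1P => z; rewrite !hnorm_dsum !big_ord0. Qed.

Let dom0 : dom 0.
Proof. by rewrite -(nil0 0 0 0); apply: dom_ctens; exact: norm0. Qed.

Let dom_lin t w w' : dom w -> dom w' -> dom (t *: w + w').
Proof.
move=> [n [a [b [x [x1 ->]]]]] [m [a' [b' [x' [x'1 ->]]]]].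
have -> : t *: ctens a b x = ctens (t%:C *: a) (1%:C *: b) x.
  by rewrite ctens_realZ mulr1.
by rewrite -ctens_cat; apply: dom_ctens; exact: mxnorm_block_le1.
Qed.

(* The infimum of reps w is a sublinear functional; a linear functional below it
   is below c (|a|^2 + |b|^2) / 2 on tensors with a contractive middle factor and
   agrees with the pairing of u on tensors over V. *)
Let reps (w : K * K * H * H -> R^o) : set R := [set r |
  exists n (a b : {ffun 'I_n -> K}) x m (a' b' : {ffun 'I_m -> K})
    (v : 'M['B(H)]_m),
    [/\ (mxnorm x <= 1)%E, forall i j, V (v i j),
        ctens a b x = w + ctens a' b' v &
        r = c / 2 * (hnorm a ^+ 2 + hnorm b ^+ 2) -
            Re '[mxop (map_mx u v) b', a'] ] ].

Let reps_n0 w : dom w -> reps w !=set0.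
Proof.
move=> [n [a [b [x [x1 ->]]]]]; eexists; exists n, a, b, x, 0%N, 0, 0, 0.
by split => //; [case|rewrite nil0 addr0].
Qed.

(** The cb-bound of [u] enters here, through [pairing_le]. If [w] is the tensor of [x], then [E]
    writes the tensor of [v] over the contraction with diagonal blocks [y] and [x], with [- a] in
    the second slot. *)
Let reps_lb w : dom w -> has_lbound (reps w).
Proof.
move=> [n [a [b [x [x1 ->]]]]].
exists (- (c / 2 * (hnorm a ^+ 2 + hnorm b ^+ 2))).
move=> _ [p [s [t [y [m [a' [b' [v [y1 Vv E ->]]]]]]]]].
have vE : ctens a' b' v = ctens (ffcat s (- a)) (ffcat t b) (block_mx y 0 0 x).
  by rewrite ctens_cat ctensN E addrAC subrr add0r.
have := pairing_le Vv (mxnorm_block_le1 y1 x1) vE.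
rewrite !hnorm_ffcat hnormN; lra.
Qed.

Let reps_sublinear : sublinear_on dom (fun w => inf (reps w)).
Proof.
split=> [w w' dw dw'|t w t0 dw].
  apply: le_inf_add; [exact: reps_n0|exact: reps_n0|] => r r'.
  move=> [n [a [b [x [m [a' [b' [v [x1 Vv E ->]]]]]]]]].
  move=> [p [s [q [y [l [s' [q' [z [y1 Vz E' ->]]]]]]]]].
  apply: ge_inf.
    by apply: reps_lb; rewrite -[w]scale1r; exact: dom_lin.
  exists (n + p)%N, (ffcat a s), (ffcat b q), (block_mx x 0 0 y),
    (m + l)%N, (ffcat a' s'), (ffcat b' q'), (block_mx v 0 0 z); split.
  - exact: mxnorm_block_le1.
  - move=> i j; rewrite -(splitK i) -(splitK j).
    case: (fintype.split i) => i'; case: (fintype.split j) => j' /=.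
    + by rewrite block_mxEul.
    + by rewrite block_mxEur mxE.
    + by rewrite block_mxEdl mxE.
    + by rewrite block_mxEdr.
  - by rewrite !ctens_cat E E' addrACA.
  - have map0 k k' : map_mx u (0 : 'M['B(H)]_(k, k')) = 0.
      by apply/matrixP => i j; rewrite !mxE u0.
    rewrite map_block_mx !map0 mxop_block inner_ffcat !hnorm_ffcat cReD; lra.
apply: le_scale_inf => [//||r]; first exact: reps_n0.
move=> [n [a [b [x [m [a' [b' [v [x1 Vv E ->]]]]]]]]].
apply: ge_inf.
  by apply: reps_lb; rewrite -[_ *: _]addr0; exact: dom_lin.
(* The weight is quadratic, so each of [a] and [b] takes a square root of [t]; the pairing is
   bilinear over the reals, so there [a'] takes the whole factor. *)
have tt : Num.sqrt t ^+ 2 = t by rewrite sqr_sqrtr// ltW.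
exists n, ((Num.sqrt t)%:C *: a), ((Num.sqrt t)%:C *: b), x,
  m, (t%:C *: a'), (1%:C *: b'), v; split => //.
  by rewrite !ctens_realZ -expr2 tt mulr1 E scalerDr.
rewrite !hnormZr innerZr conjR_real cRe_realM !exprMn !real_normK ?num_real//.
by rewrite tt rmorph1 scale1r; lra.
Qed.

Let linsum (F : (K * K * H * H -> R^o) -> R) (I : Type) (r : seq I) f :
  (forall t w w', dom w -> dom w' -> F (t *: w + w') = t * F w + F w') ->
  (forall i, dom (f i)) ->
  dom (\sum_(i <- r) f i) /\ F (\sum_(i <- r) f i) = \sum_(i <- r) F (f i).
Proof.
move=> Fl df; have F0 : F 0 = 0.
  by have := Fl 1 0 0 dom0 dom0; rewrite scale1r mul1r addr0; lra.
apply: (big_ind2 (fun w s => dom w /\ F w = s)) => // w s w' s' [dw <-] [dw' <-].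
rewrite -[w in w + _]scale1r; split; first exact: dom_lin.
by rewrite Fl// mul1r.
Qed.

Let dom_ctens1 a x b : dom (ctens1 a x b).
Proof.
have [M M0 xM] := bop_bounded x.
have M1 : 0 < M + 1 by rewrite ltr_wpDl.
(* Dividing by [M + 1], which is positive even for [M = 0], makes the middle factor contractive; [a]
   absorbs the factor. *)
have -> : ctens1 a x b = ctens1 ((M + 1)%:C *: a) ((M + 1)^-1%:C *: x) (1%:C *: b).
  by rewrite ctens1_realZ divff ?gt_eqF// mulr1 scale1r.
rewrite ctens1E; apply: dom_ctens; rewrite opnorm_mx11.
apply: opnorm_leE => // h; rewrite bopZ hnormZr ger0_norm ?invr_ge0 ?(ltW M1)//.
rewrite mul1r ler_pdivrMl// (le_trans (xM h))// ler_wpM2r ?hnorm_ge0//.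
by rewrite lerDl.
Qed.

Theorem wittstock_extension : hilbert_space K ->
  exists U : 'B(H) -> 'B(K),
    [/\ forall a S T, U (a *: S + T) = a *: U S + U T,
        forall T, V T -> U T = u T &
        (cbnorm [set: 'B(H)] U <= c%:E)%E].
Proof.
move=> hK.
have [F [Flin Fle]] := sublinear_dominates_linear dom0 dom_lin reps_sublinear.
have FD w w' : dom w -> dom w' -> F (w + w') = F w + F w'.
  by move=> dw dw'; rewrite -[w in LHS]scale1r Flin// mul1r.
have F0 : F 0 = 0 by have := FD 0 0 dom0 dom0; rewrite addr0; lra.
have FZ t w : dom w -> F (t *: w) = t * F w.
  by move=> dw; rewrite -[t *: w]addr0 Flin// F0 addr0.
have Frep w r : dom w -> reps w r -> F w <= r.
  move=> dw wr; apply: le_trans (Fle _ dw) _; apply: ge_inf => //.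
  exact: reps_lb.
have F1 n (a b : {ffun 'I_n -> K}) (x : 'M['B(H)]_n) : (mxnorm x <= 1)%E ->
    F (ctens a b x) <= c / 2 * (hnorm a ^+ 2 + hnorm b ^+ 2).
  move=> x1; apply: Frep; first exact: dom_ctens.
  exists n, a, b, x, 0%N, 0, 0, 0; split => //; first by case.
    by rewrite nil0 addr0.
  by rewrite inner_mxop big_ord0 subr0.
have F2 n (a b : {ffun 'I_n -> K}) (x : 'M['B(H)]_n) : (mxnorm x <= 1)%E ->
    F (ctens a b x) <= c * hnorm b * hnorm a.
  move=> x1.
  have [a0|a0] := eqVneq (hnorm a) 0.
    have -> : ctens a b x = 0.
      rewrite (hnorm_eq0 a0) -(scale0r 0) -[b]scale1r.
      by rewrite (ctens_realZ 0 1) mul0r scale0r.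
    by rewrite F0 a0 mulr0.
  have [b0|b0] := eqVneq (hnorm b) 0.
    have -> : ctens a b x = 0.
      rewrite (hnorm_eq0 b0) -(scale0r 0) -[a]scale1r.
      by rewrite (ctens_realZ 1 0) mulr0 scale0r.
    by rewrite F0 b0 mulr0 mul0r.
  have ap : 0 < hnorm a by rewrite lt_neqAle eq_sym a0 hnorm_ge0.
  have bp : 0 < hnorm b by rewrite lt_neqAle eq_sym b0 hnorm_ge0.
  (* Replacing (a, b) by (t a, b / t) keeps the tensor. This [t] makes both squared norms equal to
     |a| |b|, so the mean in [F1] becomes a product. *)
  pose t := Num.sqrt (hnorm b / hnorm a).
  have tp : 0 < t by rewrite sqrtr_gt0 divr_gt0.
  have tt : t ^+ 2 = hnorm b / hnorm a by rewrite sqr_sqrtr// divr_ge0 ?hnorm_ge0.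
  have := F1 n (t%:C *: a) (t^-1%:C *: b) x x1.
  rewrite ctens_realZ divff ?gt_eqF// scale1r !hnormZr !exprMn.
  rewrite !real_normK ?num_real// exprVn tt.
  suff -> : c / 2 * (hnorm b / hnorm a * hnorm a ^+ 2 +
    (hnorm b / hnorm a)^-1 * hnorm b ^+ 2) = c * hnorm b * hnorm a by [].
  by field; rewrite a0 b0.
have Fv (a b : K) v : V v -> F (ctens1 a v b) = Re '[u v b, a].
  move=> Vv.
  (* The empty tensor on the contractive side and [v] on the other represent this element at cost
     exactly minus the pairing. Applying it to [a] and [- a] gives equality. *)
  have key (a' : K) : F (- ctens1 a' v b) <= - Re '[u v b, a'].
    apply: Frep.
      by rewrite -scaleN1r -[_ *: _]addr0; exact: dom_lin.
    exists 0%N, 0, 0, 0, 1%N, [ffun=> a'], [ffun=> b], (const_mx v); split => //.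
    - by move=> i j; rewrite mxE.
    - by rewrite -ctens1E nil0 addNr.
    - rewrite inner_mxop !big_ord1 !ffunE !mxE.
      rewrite !hnorm_dsum !big_ord0; lra.
  have n1 w : - ctens1 w v b = ctens1 (- w) v b by rewrite !ctens1E -ctensN;
    congr ctens; apply/ffunP => i; rewrite !ffunE.
  have FN w : dom w -> F (- w) = - F w by move=> dw; rewrite -scaleN1r FZ// mulN1r.
  apply/eqP; rewrite eq_le; apply/andP; split.
    have := key (- a); rewrite n1 opprK (linearNr (@inner R K)) cReN opprK.
    by [].
  by have := key a; rewrite FN// lerN2.
(* The form <U(x) b, a> is recovered from its real part. *)
pose Phi (x : 'B(H)) (b a : K) : R[i] :=
  F (ctens1 a x b) +i* (- F (ctens1 a x ('i *: b))).
have clin (g : K -> R) z b b' :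
    (forall b b', g (b + b') = g b + g b') ->
    (forall (t : R) b, g (t%:C *: b) = t * g b) ->
    (g (z *: b + b') +i* (- g ('i *: (z *: b + b')))) =
    z * (g b +i* (- g ('i *: b))) + (g b' +i* (- g ('i *: b'))).
  move=> gD gZ; rewrite scalerDr !gD scalerA.
  case: z => s t.
  have zb : (s +i* t) *: b = s%:C *: b + t%:C *: ('i *: b).
    by rewrite scalerA -scalerDl; congr (_ *: _); apply: complex_eqP => /=; ring.
  have izb : ('i * (s +i* t)) *: b = s%:C *: ('i *: b) + (- t)%:C *: b.
    by rewrite scalerA -scalerDl; congr (_ *: _); apply: complex_eqP => /=; ring.
  by rewrite zb izb !gD !gZ; apply: complex_eqP => /=; ring.
have FrightD a x b b' : F (ctens1 a x (b + b')) = F (ctens1 a x b) + F (ctens1 a x b').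
  by rewrite ctens1Dr FD.
have FrightZ a x t b : F (ctens1 a x (t%:C *: b)) = t * F (ctens1 a x b).
  rewrite -FZ//; congr F.
  by rewrite -[a in LHS]scale1r -[x in LHS]scale1r (@ctens1_realZ R H K 1 1) !mul1r.
have PhiE x z b b' a : Phi x (z *: b + b') a = z * Phi x b a + Phi x b' a.
  by apply: (clin (fun b => F (ctens1 a x b))) => *; [exact: FrightD|exact: FrightZ].
have Phix z x x' b a : Phi (z *: x + x') b a = z * Phi x b a + Phi x' b a.
  rewrite /Phi !ctens1Dm !ctens1_swap_right !FD//.
  have := PhiE x z b 0 a; rewrite addr0.
  have -> : Phi x 0 a = 0.
    have := PhiE x (-1) 0 0 a; rewrite scaler0 addr0 mulN1r addNr; exact.
  rewrite addr0 /Phi => <-; rewrite scalerA mulrC -scalerA.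
  by apply: complex_eqP => //=; rewrite opprD.
have Phia x z b a a' : Phi x b (z *: a + a') = conjR R z * Phi x b a + Phi x b a'.
  rewrite /Phi !ctens1Dl -[z]conjRK !ctens1_swap_left conjRK !FD//.
  have := PhiE x (conjR R z) b 0 a; rewrite addr0.
  have -> : Phi x 0 a = 0.
    have := PhiE x (-1) 0 0 a; rewrite scaler0 addr0 mulN1r addNr; exact.
  rewrite addr0 /Phi => <-; rewrite scalerA mulrC -scalerA.
  by apply: complex_eqP => //=; rewrite opprD.
have /choice[U UE] : forall x, exists T : 'B(K), forall b a, '[T b, a] = Phi x b a.
  move=> x; have [M M0 xM] := bop_bounded x.
  have M1 : 0 < M + 1 by rewrite ltr_wpDl.
  apply: (@bop_of_form R K K (Phi x) (c * (M + 1)) hK) => [|//|//|b a] /=.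
    by rewrite mulr_ge0// ltW.
  have -> : ctens1 a x b = (M + 1) *: ctens1 a ((M + 1)^-1%:C *: x) b.
    rewrite -[a in RHS]scale1r -[b in RHS]scale1r (@ctens1_realZ R H K 1 _ 1).
    by rewrite scalerA mul1r mulr1 divff ?gt_eqF// scale1r.
  rewrite FZ// ctens1E [c * _]mulrC -!mulrA ler_pM2l//.
  have fK (h : K) : hnorm ([ffun=> h] : {ffun 'I_1 -> K}) = hnorm h.
    apply/eqP; rewrite -(@eqrXn2 _ 2)// ?hnorm_ge0//.
    by rewrite hnorm_dsum big_ord1 ffunE.
  rewrite mulrA -(fK a) -(fK b); apply: F2; rewrite opnorm_mx11.
  apply: opnorm_leE => // h; rewrite bopZ hnormZr ger0_norm ?invr_ge0 ?(ltW M1)//.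
  rewrite mul1r ler_pdivrMl// (le_trans (xM h))// ler_wpM2r ?hnorm_ge0//.
  by rewrite lerDl.
exists U; split.
- move=> z S T; apply: bop_ext => b; apply: inner_eql => a.
  by rewrite bopD bopZ innerDl innerZl !UE Phix.
- move=> T VT; apply: bop_ext => b; apply: inner_eql => a.
  rewrite UE /Phi !Fv// linearZ innerZl cReiM opprK.
  by apply: complex_eqP.
- apply/cbnorm_leP => n A _ A1; apply/mxnorm_leP => // b a.
  (* The entrywise values add up to [F] of the single tensor [ctens a b A], so [F2] bounds all
     matrix sizes uniformly. *)
  rewrite inner_mxop cRe_sum.
  apply: le_trans (F2 n a b A A1); rewrite ctens_sum.
  have ds i := linsum (index_enum 'I_n) Flin (fun j => dom_ctens1 (a i) (A i j) (b j)).
  have [_ ->] := linsum (index_enum 'I_n) Flin (fun i => (ds i).1).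
  apply: ler_sum => i _; rewrite (ds i).2 cRe_sum; apply: ler_sum => j _.
  by rewrite mxE UE.
Qed.

End Wittstock.

(** * Completeness of L2 *)

Section RieszFischer.
Context d (T : measurableType d) (R : realType).
Variable mu : {measure set T -> \bar R}.

Definition sqint (f : T -> R) : \bar R := (\int[mu]_x ((f x) ^+ 2)%:E)%E.

Lemma measurable_sqr (f : T -> R) : measurable_fun [set: T] f ->
  measurable_fun [set: T] (fun x => (f x ^+ 2 : R)%:E).
Proof. by move=> mf; apply/measurable_EFinP; exact: measurable_funX. Qed.

Lemma sqr_sub_cvg (u : nat -> R) (l a : R) : u n @[n --> \oo] --> l ->
  (fun n => (u n - a) ^+ 2) @ \oo --> (l - a) ^+ 2.
Proof.
move=> ul; rewrite expr2; under eq_fun do rewrite expr2.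
by apply: cvgM; apply: cvgB => //; exact: cvg_cst.
Qed.

Lemma limn_einf_le (u : nat -> \bar R) (M : \bar R) (N : nat) :
  (forall n, (N <= n)%N -> (u n <= M)%E) -> (limn_einf u <= M)%E.
Proof.
move=> uM; rewrite limn_einf_lim; apply: lime_le; first exact: is_cvg_einfs.
exists N => // n /= Nn; apply: le_trans (uM n Nn).
by apply: ereal_inf_lbound; exists n => /=.
Qed.

Lemma fatou_sqint (g : nat -> T -> R) (f : T -> R) (M : \bar R) (N : nat) :
  (forall n, measurable_fun [set: T] (g n)) ->
  (forall x, g n x @[n --> \oo] --> f x) ->
  (forall n, (N <= n)%N -> (sqint (g n) <= M)%E) -> (sqint f <= M)%E.
Proof.
move=> mg gf gM; apply: le_trans (limn_einf_le gM).
apply: le_trans (fatou _ _ _ _); last first.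
- by move=> n x _; rewrite lee_fin sqr_ge0.
- by move=> n; apply: measurable_sqr.
- exact: measurableT.
rewrite /sqint le_eqVlt; apply/orP; left; apply/eqP/eq_integral => x _.
apply/esym/(cvg_limn_einf_sup _).1; apply: cvg_EFin; first by near=> n.
have := sqr_sub_cvg (gf x) (a := 0); rewrite subr0.
by under eq_fun do rewrite subr0.
Unshelve. all: by end_near. Qed.

Lemma geometric_increments_cvg (u : nat -> R) (C : R) : 0 <= C ->
  (forall k, `|u k.+1 - u k| <= C * 2^-1 ^+ k) -> cvgn u.
Proof.
move=> C0 uC.
have : cvgn (series (telescope u)).
  apply: (@normed_cvg R R^o); apply: (@series_le_cvg _ _ (geometric C 2^-1)).
  - by move=> n; exact: normr_ge0.
  - by move=> n; rewrite /= mulr_ge0// exprn_ge0.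
  - by move=> n; exact: uC.
  - by apply: is_cvg_geometric_series; rewrite ger0_norm// invf_lt1// ltr1n.
move=> /cvg_ex[l ul]; apply/cvg_ex; exists (u 0%N + l).
have E : u = (fun n => u 0%N + series (telescope u) n).
  by apply/funext => n; rewrite -eq_sum_telescope.
rewrite [X in X @ _ --> _]E.
by apply: cvgD; [exact: cvg_cst|exact: ul].
Qed.

(* Small enough for 4^k |g_(k+1) - g_k|^2 to be summable in k. *)
Let delta (k : nat) : R := 4^-1 ^+ k / (2 ^ k.+1)%:R.

Lemma delta_gt0 k : 0 < delta k.
Proof. by rewrite divr_gt0// ?exprn_gt0// ltr0n expn_gt0. Qed.

Lemma fast_cauchy_limit (g : nat -> T -> R) :
  (forall k, measurable_fun [set: T] (g k)) ->
  (forall j k, (k <= j)%N -> (sqint (g j \- g k)%R <= (delta k)%:E)%E) ->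
  exists2 f : T -> R, measurable_fun [set: T] f &
    forall k, (sqint (f \- g k)%R <= (delta k)%:E)%E.
Proof.
move=> mg gd.
pose D k x := (4 ^+ k * (g k.+1 x - g k x) ^+ 2)%:E.
have D0 k x : (0 <= D k x)%E by rewrite lee_fin mulr_ge0 ?sqr_ge0// exprn_ge0.
have mD k : measurable_fun [set: T] (D k).
  apply/measurable_EFinP; apply: measurable_funM => //.
  by apply: measurable_funX; exact: measurable_funB.
pose F x := (\sum_(k <oo) D k x)%E.
have F0 x : (0 <= F x)%E by apply: nneseries_ge0 => *; exact: D0.
have mF : measurable_fun [set: T] F.
  by apply: ge0_emeasurable_sum => // *; exact: D0.
have iF : (\int[mu]_x F x <= 1)%E.
  rewrite integral_nneseries//.
  (* [4 ^+ k * delta k] is 2^-(k+1), whose series has sum 1. *)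
  apply: le_trans (epsilon_trick0 xpredT ler01); apply: lee_nneseries => k _.
    by move=> _; apply: integral_ge0 => x _; exact: D0.
  rewrite /D; under eq_integral do rewrite EFinM.
  rewrite ge0_integralZl; last 4 first.
  - exact: measurableT.
  - by apply: measurable_sqr; exact: measurable_funB.
  - by move=> x _; rewrite lee_fin sqr_ge0.
  - by rewrite lee_fin exprn_ge0.
  apply: (@le_trans _ _ ((4 ^+ k)%:E * (delta k)%:E)%E).
    by rewrite lee_pmul2l// ?lte_fin ?exprn_gt0//; exact: gd.
  rewrite -EFinM lee_fin /delta mulrA -exprMn divff// expr1n.
  by rewrite mul1r.
have Fae : {ae mu, forall x, F x \is a fin_num}.
  have : mu.-integrable [set: T] F.
    apply/integrableP; split => //; under eq_integral do rewrite gee0_abs//.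
    exact: le_lt_trans iF (ltry 1).
  by move=> /(integrable_ae measurableT); apply: filterS => x; exact.
pose E := [set x | (F x < +oo)%E].
have mE : measurable E.
  rewrite -[E]setTI; exact: emeasurable_fun_infty_o.
have Eae : {ae mu, forall x, E x}.
  by apply: filterS Fae => x; rewrite ge0_fin_numE.
(* Cutting off outside the conull set [E] gives convergence at every point, as [fatou_sqint]
   requires. On [E] the increments are at most 2^-k times the square root of [F]. *)
pose h k x := \1_E x * g k x.
have mh k : measurable_fun [set: T] (h k).
  by apply: measurable_funM => //; exact: measurable_indic.
have hcvg x : cvgn (h ^~ x).
  have [Ex|Ex] := pselect (E x); last first.
    rewrite (_ : h ^~ x = cst 0); first exact: is_cvg_cst.
    by apply/funext => k; rewrite /h indicE memNset// mul0r.
  rewrite (_ : h ^~ x = g ^~ x); last first.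
    by apply/funext => k; rewrite /h indicE mem_set// mul1r.
  have Ffin : F x \is a fin_num by rewrite ge0_fin_numE.
  apply: (@geometric_increments_cvg _ (Num.sqrt (fine (F x)))).
    exact: sqrtr_ge0.
  move=> k; rewrite -(@ler_pXn2r _ 2) ?nnegrE ?mulr_ge0 ?sqrtr_ge0 ?exprn_ge0//.
  rewrite real_normK ?num_real// exprMn sqr_sqrtr ?fine_ge0//.
  have DF : (D k x <= F x)%E.
    rewrite /F (@nneseriesD1 _ _ k)// leeDl//.
    by apply: nneseries_ge0 => *; exact: D0.
  have {}DF : 4 ^+ k * (g k.+1 x - g k x) ^+ 2 <= fine (F x).
    by rewrite -lee_fin fineK.
  have q1 : 4 ^+ k * (2^-1 ^+ k) ^+ 2 = 1 :> R.
    by rewrite -exprM mulnC exprM -exprMn (_ : 4 * _ = 1) ?expr1n//; field.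
  have -> : (g k.+1 x - g k x) ^+ 2 =
      4 ^+ k * (g k.+1 x - g k x) ^+ 2 * (2^-1 ^+ k) ^+ 2.
    by rewrite mulrAC q1 mul1r.
  by rewrite ler_wpM2r// sqr_ge0.
pose f x := limn (h ^~ x).
have hf x : h n x @[n --> \oo] --> f x by exact: hcvg.
have mf : measurable_fun [set: T] f by apply: measurable_fun_cvg mh _ => x _; exact: hf.
exists f => // k.
have := @fatou_sqint (fun n => h n \- h k) (f \- h k) (delta k)%:E k.
have ae_sq (u v : T -> R) : measurable_fun [set: T] u -> measurable_fun [set: T] v ->
    {ae mu, forall x, u x = v x} -> sqint u = sqint v.
  move=> mu' mv uv; apply: ae_eq_integral => //.
  - exact: measurable_sqr.
  - exact: measurable_sqr.
  - by apply: filterS uv => x -> _.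
have hE j x : E x -> h j x = g j x by move=> Ex; rewrite /h indicE mem_set// mul1r.
rewrite (ae_sq (f \- h k) (f \- g k)).
- apply.
  + by move=> n; exact: measurable_funB.
  + by move=> x; apply: cvgB; [exact: hf|exact: cvg_cst].
  + move=> n kn; rewrite (ae_sq _ (g n \- g k)).
    * exact: gd.
    * exact: measurable_funB.
    * exact: measurable_funB.
    * by apply: filterS Eae => x Ex /=; rewrite !hE.
- exact: measurable_funB.
- exact: measurable_funB.
- by apply: filterS Eae => x Ex /=; rewrite hE.
Qed.

End RieszFischer.

Section L2Complete.
Context d (T : measurableType d) (R : realType).
Variable mu : {measure set T -> \bar R}.

Local Notation "\pi2 f" := (\pi_(L2 mu)%qT f) (at level 10).

Lemma Lfun2P (f : T -> R) :
  f \in Lfun mu 2%:E <-> measurable_fun [set: T] f /\ (sqint mu f < +oo)%E.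
Proof.
split=> [f2|[mf fi]].
  split; first by case/andP: f2 => /[!inE].
  have /Lfun1_integrable/integrableP[_] := Lfun2_mul_Lfun1 f2 f2.
  apply: le_lt_trans; rewrite /sqint le_eqVlt; apply/orP; left; apply/eqP.
  by apply: eq_integral => x _; rewrite /= ger0_norm -expr2 ?sqr_ge0.
apply/andP; split; rewrite inE//= /finite_norm unlock /Lnorm poweR_lty//.
apply: le_lt_trans fi; rewrite le_eqVlt; apply/orP; left; apply/eqP.
apply: eq_integral => x _ /=; congr EFin.
by rewrite -[2]/(2%:R) powR_mulrn// real_normK ?num_real.
Qed.

Lemma hnorm_pi (f : L2fun mu) :
  ((hnorm (\pi2 f)) ^+ 2)%:E =
  (sqint mu (@Re R \o f) + sqint mu (@Im R \o f))%E.
Proof.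
have /andP[fr fi] := valP f.
have mr : measurable_fun [set: T] (@Re R \o f) by case/andP: fr => /[!inE].
have mi : measurable_fun [set: T] (@Im R \o f) by case/andP: fi => /[!inE].
rewrite hnorm_sqrE [inner _ _]L2_inner_pi /= /Rintegral fineK; last first.
  have /Lfun1_integrable := LfunD (lexx 1%E) (Lfun2_mul_Lfun1 fr fr) (Lfun2_mul_Lfun1 fi fi).
  move=> /(integrable_fin_num measurableT); congr (_ \is a fin_num).
  by apply: eq_integral => x _ /=; case: (\val f x) => ? ? /=; congr EFin; ring.
rewrite /sqint -ge0_integralD//.
- by apply: eq_integral => x _ /=; case: (\val f x) => ? ? /=; congr EFin; ring.
- by move=> x _; rewrite lee_fin sqr_ge0.
- exact: measurable_sqr.
- by move=> x _; rewrite lee_fin sqr_ge0.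
- exact: measurable_sqr.
Qed.

Lemma sqint_ge0 (f : T -> R) : (0 <= sqint mu f)%E.
Proof. by apply: integral_ge0 => x _; rewrite lee_fin sqr_ge0. Qed.

Theorem hilbert_L2 : hilbert_space (L2 mu).
Proof.
move=> u uC.
pose delta k : R := 4^-1 ^+ k / (2 ^ k.+1)%:R.
have d0 k : 0 < delta k := delta_gt0 R k.
have /choice[N NP] : forall k, exists N, forall m n, (N <= m)%N -> (N <= n)%N ->
    hnorm (u m - u n) < Num.sqrt (delta k).
  by move=> k; apply: uC; rewrite sqrtr_gt0.
(* A sum in place of a maximum: [n j] dominates [N k] for every [k <= j]. *)
pose n k := (\sum_(i < k.+1) N i)%N.
have nN k j : (k <= j)%N -> (N k <= n j)%N.
  by move=> kj; rewrite /n (bigD1 (inord k))//= inordK ?ltnS// leq_addr.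
pose g k := repr (u (n k)).
have gE k : \pi2 (g k) = u (n k) by exact: L2_reprK.
have gd j k : (k <= j)%N ->
    (sqint mu (@Re R \o (g j - g k)%R) + sqint mu (@Im R \o (g j - g k)%R) <= (delta k)%:E)%E.
  move=> kj; rewrite -hnorm_pi lee_fin.
  have -> : \pi2 (g j - g k) = u (n j) - u (n k) by rewrite -!gE !piE.
  rewrite -[leRHS]sqr_sqrtr ?(ltW (d0 k))//.
  by rewrite ler_pXn2r ?nnegrE ?hnorm_ge0 ?sqrtr_ge0// ltW// NP// nN.
have mg k : measurable_fun [set: T] (@Re R \o g k) /\ measurable_fun [set: T] (@Im R \o g k).
  by have /andP[/Lfun2P[? _] /Lfun2P[? _]] := valP (g k).
have gdr j k : (k <= j)%N ->
    (sqint mu ((@Re R \o g j) \- (@Re R \o g k))%R <= (delta k)%:E)%E.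
  move=> kj; apply: le_trans (gd j k kj); rewrite (_ : _ \- _ = @Re R \o (g j - g k)).
    by rewrite leeDl// sqint_ge0.
  by apply/funext => x /=; rewrite -cReB.
have gdi j k : (k <= j)%N ->
    (sqint mu ((@Im R \o g j) \- (@Im R \o g k))%R <= (delta k)%:E)%E.
  move=> kj; apply: le_trans (gd j k kj); rewrite (_ : _ \- _ = @Im R \o (g j - g k)).
    by rewrite leeDr// sqint_ge0.
  by apply/funext => x /=; rewrite -cImB.
have [fr mfr frP] := fast_cauchy_limit (fun k => (mg k).1) gdr.
have [fi mfi fiP] := fast_cauchy_limit (fun k => (mg k).2) gdi.
have p1 : (1 <= 2%:E :> \bar R)%E by exact: lee1n.
have /andP[g0r g0i] := valP (g 0%N).
have L (h h0 : T -> R) : measurable_fun [set: T] h -> h0 \in Lfun mu 2%:E ->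
    (sqint mu (h \- h0)%R <= (delta 0%N)%:E)%E -> h \in Lfun mu 2%:E.
  move=> mh h02 hd; have : (h \- h0)%R \in Lfun mu 2%:E.
    apply/Lfun2P; split; last exact: le_lt_trans hd (ltry _).
    by apply: measurable_funB => //; case/Lfun2P: h02.
  by move=> h12; have := LfunD p1 h12 h02; apply: eq_Lfun => x /=; rewrite subrK.
have f2 : (fun x => fr x +i* fi x) \in cLfun mu 2%:E.
  have Lr := L _ _ mfr g0r (frP 0%N); have Li := L _ _ mfi g0i (fiP 0%N).
  by apply/andP.
pose f := L2Fun f2.
have fd k : hnorm (\pi2 f - u (n k)) ^+ 2 <= 2 * delta k.
  rewrite -lee_fin; have -> : \pi2 f - u (n k) = \pi2 (f - g k) by rewrite -!gE !piE.
  rewrite hnorm_pi mulr_natl mulr2n EFinD; apply: leeD.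
    apply: le_trans (frP k); rewrite le_eqVlt; apply/orP; left; apply/eqP.
    by congr sqint; apply/funext => x /=; rewrite cReB.
  apply: le_trans (fiP k); rewrite le_eqVlt; apply/orP; left; apply/eqP.
  by congr sqint; apply/funext => x /=; rewrite cImB.
have dsmall : forall e : R, 0 < e -> exists k, 2 * delta k < e.
  move=> e e0; have [k _ kP] := near_infty_natSinv_lt (PosNum e0).
  exists k; have h : k.+1%:R^-1 < e by exact: (kP k (leqnn k)).
  apply: le_lt_trans h.
  have e4 : 4^-1 ^+ k <= 1 :> R by rewrite exprn_ile1// invf_le1// ler1n.
  have e2 : 0 < (2 ^ k)%:R :> R by rewrite ltr0n expn_gt0.
  have -> : 2 * delta k = 4^-1 ^+ k / (2 ^ k)%:R.
    by rewrite /delta expnS natrM; field; rewrite gt_eqF.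
  apply: (@le_trans _ _ (2 ^ k)%:R^-1); first by rewrite ler_piMl// invr_ge0 ltW.
  by rewrite lef_pV2 ?posrE ?ltr0n ?expn_gt0// ler_nat ltn_expl.
exists (\pi2 f); apply/cvgrPdist_lt => e e0.
have e2 : 0 < e / 2 by rewrite divr_gt0.
have [k kP] := dsmall _ (exprn_gt0 2 e2).
have fk : hnorm (u (n k) - \pi2 f) < e / 2.
  rewrite hnormBC -(@ltr_pXn2r _ 2) ?nnegrE ?hnorm_ge0 ?(ltW e2)//.
  exact: le_lt_trans (fd k) kP.
have sk : Num.sqrt (delta k) < e / 2.
  rewrite -(@ltr_pXn2r _ 2) ?nnegrE ?sqrtr_ge0 ?(ltW e2)//.
  rewrite sqr_sqrtr ?(ltW (d0 k))//; apply: le_lt_trans kP.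
  by rewrite mulr_natl mulr2n lerDl ltW.
exists (N k) => // m /= Nm; rewrite sub0r normrN ger0_norm ?hnorm_ge0//.
rewrite -[u m](subrK (u (n k))) -addrA.
apply: le_lt_trans (ler_hnormD _ _) _; rewrite [e]splitr.
by rewrite ltrD// (lt_trans _ sk)// NP// nN.
Qed.

End L2Complete.

(** * Multiplication operators on L2 *)

Section BoundedMultipliers.
Context d (T : measurableType d) (R : realType).
Variable mu : {measure set T -> \bar R}.
Implicit Types m : T -> R[i].

(** Bounded everywhere rather than essentially, so that sums, products and conjugates of symbols
    involve no null sets. *)
Definition bounded_measurable m : Prop :=
  [/\ measurable_fun [set: T] (@Re R \o m), measurable_fun [set: T] (@Im R \o m) &
      exists C, forall x, `|Re (m x)| <= C /\ `|Im (m x)| <= C].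

Lemma bounded_Linfty (f : T -> R) C : measurable_fun [set: T] f ->
  (forall x, `|f x| <= C) -> f \in Lfun mu +oo.
Proof.
move=> mf fC; apply/andP; split; rewrite inE//= /finite_norm unlock /Lnorm.
case: ifPn => // _; apply: (@le_lt_trans _ _ C%:E); last exact: ltry.
by apply/ess_supP; apply: filterE => x /=; rewrite lee_fin.
Qed.

Lemma bounded_measurable_Linfty m : bounded_measurable m -> m \in cLfun mu +oo.
Proof.
case=> mr mi [C mC]; apply/andP.
by split; apply: (@bounded_Linfty _ C) => // x; have [] := mC x.
Qed.

Lemma bounded_measurable_cst a : bounded_measurable (fun=> a).
Proof.
split; [exact: measurable_cst|exact: measurable_cst|].
by exists (maxr `|Re a| `|Im a|) => _; rewrite !le_max !lexx orbT.
Qed.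

Lemma bounded_measurableD m m' : bounded_measurable m -> bounded_measurable m' ->
  bounded_measurable (fun x => m x + m' x).
Proof.
move=> [mr mi [C mC]] [mr' mi' [C' mC']]; split.
- rewrite (_ : _ \o _ = (@Re R \o m) \+ (@Re R \o m')); first exact: measurable_funD.
  by apply/funext => x /=; rewrite cReD.
- rewrite (_ : _ \o _ = (@Im R \o m) \+ (@Im R \o m')); first exact: measurable_funD.
  by apply/funext => x /=; rewrite cImD.
- exists (C + C') => x; have [? ?] := mC x; have [? ?] := mC' x.
  by rewrite cReD cImD !(le_trans (ler_normD _ _))// lerD.
Qed.

Lemma bounded_measurableM m m' : bounded_measurable m -> bounded_measurable m' ->
  bounded_measurable (fun x => m x * m' x).
Proof.
move=> [mr mi [C mC]] [mr' mi' [C' mC']]; split.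
- rewrite (_ : _ \o _ = ((@Re R \o m) \* (@Re R \o m')) \-
                        ((@Im R \o m) \* (@Im R \o m'))).
    by apply: measurable_funB; exact: measurable_funM.
  by apply/funext => x /=; rewrite cReM.
- rewrite (_ : _ \o _ = ((@Re R \o m) \* (@Im R \o m')) \+
                        ((@Im R \o m) \* (@Re R \o m'))).
    by apply: measurable_funD; exact: measurable_funM.
  by apply/funext => x /=; rewrite cImM.
- exists (C * C' + C * C') => x; have [? ?] := mC x; have [? ?] := mC' x.
  rewrite cReM cImM.
  rewrite (le_trans (ler_normB _ _)) ?(le_trans (ler_normD _ _)) ?normrM//.
    by rewrite lerD// ler_pM.
  by rewrite lerD// ler_pM.
Qed.

Lemma bounded_measurable_conj m : bounded_measurable m ->
  bounded_measurable (fun x => conjR R (m x)).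
Proof.
move=> [mr mi [C mC]]; split.
- by rewrite (_ : _ \o _ = @Re R \o m)//; apply/funext => x /=; rewrite cRe_conj.
- rewrite (_ : _ \o _ = (fun x => - (@Im R \o m) x)); first exact: measurableT_comp.
  by apply/funext => x /=; rewrite cIm_conj.
- by exists C => x; rewrite cRe_conj cIm_conj normrN.
Qed.

Lemma bounded_measurable_real (f : T -> R) C : measurable_fun [set: T] f ->
  (forall x, `|f x| <= C) -> bounded_measurable (fun x => (f x)%:C).
Proof.
move=> mf fC; split; first exact: mf.
  by rewrite (_ : _ \o _ = cst 0)//; exact: measurable_cst.
by exists C => x /=; rewrite normr0; split=> //; exact: le_trans (fC x).
Qed.

Lemma bounded_measurable_indic (E : set T) : measurable E ->
  bounded_measurable (fun x => (\1_E x)%:C).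
Proof.
move=> mE; apply: (@bounded_measurable_real _ 1); first exact: measurable_indic.
by move=> x; rewrite indicE; case: (_ \in _); rewrite ?normr1 ?normr0.
Qed.

Lemma bounded_measurable_L2 m :
  bounded_measurable m -> mu [set: T] \is a fin_num -> m \in cLfun mu 2%:E.
Proof.
move=> mb fmu; have /andP[mr mi] := bounded_measurable_Linfty mb.
have sub f : f \in Lfun mu +oo -> f \in Lfun mu 2%:E.
  apply: (@Lfun_subset _ _ _ mu 2%:E +oo%E _ _ _ _ f) => //.
  - exact: lee1n.
  - exact: leey.
  - exact: leey.
by apply/andP; split; exact: sub.
Qed.

(* Junk value 0 if m is not essentially bounded. *)
Definition mulop m (f : L2 mu) : L2 mu :=
  match pselect (m \in cLfun mu +oo) with
  | left mb => Linf_mul (LInf mb) f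
  | right _ => 0
  end.

Local Notation piL2 f := (\pi_(L2 mu)%qT f).

Lemma Linf_mul_pi (phi : Linf mu) (F G : L2fun mu) :
  (forall x, G x = phi x * F x) -> Linf_mul phi (piL2 F) = piL2 G.
Proof.
move=> GE; apply/L2_eqP; have /L2_eqP := L2_reprK (piL2 F).
by apply: filterS => x Fx _; rewrite GE /= Fx.
Qed.

Lemma mulop_pi m (F G : L2fun mu) : m \in cLfun mu +oo ->
  (forall x, G x = m x * F x) -> mulop m (piL2 F) = piL2 G.
Proof.
move=> mb GE; rewrite /mulop; case: pselect => // mb'.
exact: Linf_mul_pi.
Qed.

Lemma mulop_ex m : m \in cLfun mu +oo -> forall F : L2fun mu,
  exists2 G : L2fun mu, forall x, G x = m x * F x & mulop m (piL2 F) = piL2 G.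
Proof.
move=> mb F; exists (L2Fun (cLfunMinf mb (valP F))) => //.
by apply: mulop_pi.
Qed.

Lemma inner_pi (F G : L2fun mu) :
  '[piL2 F, piL2 G] = cintegral mu (fun x => F x * conjR R (G x)).
Proof. exact: L2_inner_pi. Qed.

Lemma inner_mulop m (F G : L2fun mu) : m \in cLfun mu +oo ->
  '[mulop m (piL2 F), piL2 G] = cintegral mu (fun x => m x * (F x * conjR R (G x))).
Proof.
move=> mb; have [H HE ->] := mulop_ex mb F.
by rewrite inner_pi; congr cintegral; apply/funext => x; rewrite HE mulrA.
Qed.

Lemma L2_ind (P : L2 mu -> Prop) : (forall F, P (piL2 F)) -> forall f, P f.
Proof. by move=> PF f; rewrite -[f]L2_reprK. Qed.

Lemma scale_pi a (F : L2fun mu) : a *: piL2 F = piL2 (a *: F).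
Proof. by rewrite L2_piZ. Qed.

Lemma mulop_linear m : bounded_measurable m ->
  forall a f g, mulop m (a *: f + g) = a *: mulop m f + mulop m g.
Proof.
move=> /bounded_measurable_Linfty mb a; apply: L2_ind => F; apply: L2_ind => G.
have [F' FE ->] := mulop_ex mb F; have [G' GE ->] := mulop_ex mb G.
rewrite !scale_pi -!L2_piD; apply: mulop_pi => // x.
rewrite [LHS](_ : _ = a * F' x + G' x)// FE GE mulrDr mulrCA.
by [].
Qed.

Lemma mulopM m m' f : bounded_measurable m -> bounded_measurable m' ->
  mulop m (mulop m' f) = mulop (fun x => m x * m' x) f.
Proof.
move=> mb mb'; move: f; apply: L2_ind => F.
have [G GE ->] := mulop_ex (bounded_measurable_Linfty mb') F.
have [K KE ->] := mulop_ex (bounded_measurable_Linfty (bounded_measurableM mb mb')) F.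
by apply: mulop_pi => [|x]; [exact: bounded_measurable_Linfty|rewrite KE GE mulrA].
Qed.

Lemma mulop_linear_symbol m m' a f : bounded_measurable m -> bounded_measurable m' ->
  mulop (fun x => a * m x + m' x) f = a *: mulop m f + mulop m' f.
Proof.
move=> mb mb'; move: f; apply: L2_ind => F.
have [G GE ->] := mulop_ex (bounded_measurable_Linfty mb) F.
have [K KE ->] := mulop_ex (bounded_measurable_Linfty mb') F.
rewrite scale_pi -L2_piD; apply: mulop_pi.
  apply/bounded_measurable_Linfty/bounded_measurableD => //.
  by apply: bounded_measurableM => //; exact: bounded_measurable_cst.
by move=> x; rewrite [LHS](_ : _ = a * G x + K x)// KE GE mulrDl mulrA.
Qed.

Lemma mulop1 f : mulop (fun=> 1) f = f.
Proof.
move: f; apply: L2_ind => F; apply: mulop_pi => [|x]; last by rewrite mul1r.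
exact/bounded_measurable_Linfty/bounded_measurable_cst.
Qed.

Lemma mulop_adjoint m f g : bounded_measurable m ->
  '[mulop m f, g] = '[f, mulop (fun x => conjR R (m x)) g].
Proof.
move=> mb; move: f g; apply: L2_ind => F; apply: L2_ind => G.
have [H HE ->] := mulop_ex (bounded_measurable_Linfty (bounded_measurable_conj mb)) G.
rewrite inner_mulop; last exact: bounded_measurable_Linfty.
rewrite inner_pi; congr cintegral; apply/funext => x.
by rewrite HE rmorphM/= conjRK mulrCA.
Qed.

Lemma eq_mulop_ae m m' f : bounded_measurable m -> bounded_measurable m' ->
  m = m' %[ae mu] -> mulop m f = mulop m' f.
Proof.
move=> mb mb' mm'; move: f; apply: L2_ind => F.
have [G GE ->] := mulop_ex (bounded_measurable_Linfty mb) F.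
have [K KE ->] := mulop_ex (bounded_measurable_Linfty mb') F.
by apply/L2_eqP; apply: filterS mm' => x mx _; rewrite GE KE mx.
Qed.

End BoundedMultipliers.

Section DominatedMultipliers.
Context d (T : measurableType d) (R : realType).
Variable mu : {measure set T -> \bar R}.

Local Notation piL2 f := (\pi_(L2 mu)%qT f).

Lemma Rintegral_dominated (m : nat -> T -> R) (l h : T -> R) :
  (forall n, measurable_fun [set: T] (m n)) ->
  (forall n x, `|m n x| <= 1) ->
  (forall x, m n x @[n --> \oo] --> l x) -> h \in Lfun mu 1%E ->
  (\int[mu]_x (m n x * h x))%R @[n --> \oo] --> (\int[mu]_x (l x * h x))%R.
Proof.
move=> mm m1 ml /Lfun1_integrable hi.
have mh : measurable_fun [set: T] h by apply/measurable_EFinP; exact: measurable_int hi.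
have mfl : measurable_fun [set: T] l by apply: measurable_fun_cvg mm _ => x _; exact: ml.
have hi' : mu.-integrable [set: T] (fun x => `|h x|%:E).
  exact: integrable_abse hi.
have [|||||li _ cv] := @dominated_convergence _ _ _ mu setT measurableT
  (fun n x => (m n x * h x)%:E) (fun x => (l x * h x)%:E) (fun x => `|h x|%:E).
- by move=> n; apply/measurable_EFinP; exact: measurable_funM.
- by apply/measurable_EFinP; exact: measurable_funM.
- apply: filterE => x _; apply: cvg_EFin; first by near=> n.
  by apply: cvgM; [exact: ml|exact: cvg_cst].
- exact: hi'.
- by apply: filterE => x n _; rewrite lee_fin normrM ler_piMl.
apply: fine_cvg; rewrite fineK; first exact: cv.
exact: integrable_fin_num.
Unshelve. all: by end_near. Qed.

Lemma Lfun1_bounded_mul (m h : T -> R) : measurable_fun [set: T] m ->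
  (forall x, `|m x| <= 1) -> h \in Lfun mu 1%E -> (fun x => m x * h x) \in Lfun mu 1%E.
Proof.
move=> mm m1 /Lfun1_integrable hi; apply/Lfun1_integrable.
apply: le_integrable (hi) => //.
  apply/measurable_EFinP; apply: measurable_funM => //.
  by apply/measurable_EFinP; exact: measurable_int hi.
by move=> x _ /=; rewrite lee_fin normrM ler_piMl.
Qed.

Lemma norm_lim_le1 (u : nat -> R) (l : R) : (forall n, `|u n| <= 1) ->
  u n @[n --> \oo] --> l -> `|l| <= 1.
Proof.
move=> u1 ul; have nl : `|u n| @[n --> \oo] --> `|l| by exact: cvg_norm.
rewrite -(cvg_lim _ nl)//; apply: limr_le; first by apply/cvg_ex; exists `|l|.
by near=> n.
Unshelve. all: by end_near. Qed.

(** Weak convergence is enough for commutation; it follows by dominated convergence, the product of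
    f and the conjugate of k being integrable. *)
Lemma mulop_limit (m : nat -> T -> R) (l : T -> R) (f k : L2 mu) :
  (forall n, measurable_fun [set: T] (m n)) ->
  (forall n x, `|m n x| <= 1) ->
  (forall x, m n x @[n --> \oo] --> l x) ->
  Re '[mulop (fun x => (m n x)%:C) f, k] @[n --> \oo] -->
  Re '[mulop (fun x => (l x)%:C) f, k].
Proof.
move=> mm m1 ml.
have mfl : measurable_fun [set: T] l by apply: measurable_fun_cvg mm _ => x _; exact: ml.
have l1 x : `|l x| <= 1 by exact: norm_lim_le1 (m1^~ x) (ml x).
move: f k; apply: L2_ind => F; apply: L2_ind => K.
have FK := cLfun1_conjM (valP F) (valP K).
have E (p : T -> R) : measurable_fun [set: T] p -> (forall x, `|p x| <= 1) ->
    Re '[mulop (fun x => (p x)%:C) (piL2 F), piL2 K] =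
    (\int[mu]_x (p x * Re (F x * conjR R (K x))))%R.
  move=> mp p1; rewrite inner_mulop; last first.
    exact/bounded_measurable_Linfty/(bounded_measurable_real mp p1).
  by apply: eq_Rintegral => x _; rewrite cRe_realM.
under eq_fun do rewrite E//.
rewrite E//; apply: Rintegral_dominated => //.
by case/andP: FK.
Qed.

Lemma mulop_limit_eq (m : nat -> T -> R) (l : T -> R) (f k f' k' : L2 mu) :
  (forall n, measurable_fun [set: T] (m n)) ->
  (forall n x, `|m n x| <= 1) ->
  (forall x, m n x @[n --> \oo] --> l x) ->
  (forall n, '[mulop (fun x => (m n x)%:C) f, k] =
             '[mulop (fun x => (m n x)%:C) f', k']) ->
  '[mulop (fun x => (l x)%:C) f, k] = '[mulop (fun x => (l x)%:C) f', k'].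
Proof.
move=> mm m1 ml mE; apply: complex_eqP.
  have := @mulop_limit m l f k mm m1 ml; under eq_fun do rewrite mE.
  by move=> /cvg_unique; apply => //; exact: mulop_limit.
have ImE (x y : L2 mu) : Im '[x, y] = Re '[x, 'i *: y].
  by rewrite innerZr conjR_i mulNr cReN cReiM opprK.
rewrite !ImE; have := @mulop_limit m l f ('i *: k) mm m1 ml.
under eq_fun do rewrite innerZr mE -innerZr.
by move=> /cvg_unique; apply => //; exact: mulop_limit.
Qed.

End DominatedMultipliers.

(** * Step functions as limits of polynomials *)

Section Smoothstep.
Context (R : realType).

(* A polynomial whose iterates converge on [0, 1] to a step at 1/2: this turns
   trigonometric polynomials into indicator functions of arcs. *)
Definition smoothstep (y : R) : R := y ^+ 2 * (3 - 2 * y).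

Lemma smoothstep_bound y : 0 <= y <= 1 -> 0 <= smoothstep y <= 1.
Proof.
move=> /andP[y0 y1]; rewrite /smoothstep; apply/andP; split.
  by rewrite mulr_ge0 ?sqr_ge0//; lra.
have : 0 <= (1 - y) ^+ 2 * (1 + 2 * y) by rewrite mulr_ge0 ?sqr_ge0//; lra.
by lra.
Qed.

Lemma iter_smoothstep_bound y n : 0 <= y <= 1 -> 0 <= iter n smoothstep y <= 1.
Proof. by move=> y01; elim: n => //= n; exact: smoothstep_bound. Qed.

Lemma iter_smoothstepC y n :
  iter n smoothstep (1 - y) = 1 - iter n smoothstep y.
Proof. by elim: n => //= n ->; rewrite /smoothstep; ring. Qed.

(** The distance to 1 is multiplied by (1 - z) (1 + 2 z) at each iteration. This factor is below 1
    beyond 1/2 and decreases there; the iterates stay above [y], so its value [q] at [y] serves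
    throughout. *)
Lemma iter_smoothstep_cvg1 y : 2^-1 < y <= 1 ->
  iter n smoothstep y @[n --> \oo] --> (1 : R).
Proof.
move=> /andP[y2 y1]; pose q := (1 - y) * (1 + 2 * y).
have q0 : 0 <= q by rewrite mulr_ge0//; lra.
have q1 : q < 1.
  have : 0 < y * (2 * y - 1) by rewrite mulr_gt0//; lra.
  by rewrite /q; lra.
have key n : y <= iter n smoothstep y <= 1 /\ 1 - iter n smoothstep y <= q ^+ n.
  elim: n => [|n [/andP[yn n1] nq]] /=.
    by rewrite lexx y1 expr0; split=> //; lra.
  set z := iter n smoothstep y in yn n1 nq *.
  have zq : (1 - z) * (1 + 2 * z) <= q.
    have : 0 <= (z - y) * (2 * (z + y) - 1) by rewrite mulr_ge0//; lra.
    by rewrite /q; lra.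
  have sz : 1 - smoothstep z = (1 - z) * ((1 - z) * (1 + 2 * z)).
    by rewrite /smoothstep; ring.
  have zz : z <= smoothstep z.
    have : 0 <= z * (1 - z) * (2 * z - 1) by rewrite !mulr_ge0//; lra.
    by rewrite /smoothstep; lra.
  have z01 : 0 <= z <= 1 by apply/andP; split=> //; lra.
  have /andP[_ sz1] := smoothstep_bound z01.
  split; first by rewrite (le_trans yn zz).
  rewrite sz exprSr ler_pM//; first by lra.
  by rewrite mulr_ge0//; lra.
apply: (@squeeze_cvgr _ _ _ _ (fun n => 1 - q ^+ n) (cst 1)).
- by apply: nearW => n; have [/andP[_ ->] h] := key n; rewrite andbT; lra.
- rewrite -[X in _ --> X]subr0; apply: cvgB; first exact: cvg_cst.
  by apply: cvg_expr; rewrite ger0_norm.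
- exact: cvg_cst.
Qed.

Lemma iter_smoothstep_half n : iter n smoothstep 2^-1 = 2^-1 :> R.
Proof. by elim: n => //= n ->; rewrite /smoothstep; field. Qed.

Definition step_limit (y : R) : R :=
  if 2^-1 < y then 1 else if y == 2^-1 then 2^-1 else 0.

Lemma iter_smoothstep_cvg y : 0 <= y <= 1 ->
  iter n smoothstep y @[n --> \oo] --> step_limit y.
Proof.
move=> /andP[y0 y1]; rewrite /step_limit; case: ltP => [y2|].
  by apply: iter_smoothstep_cvg1; rewrite y2.
case: eqVneq => [->|yN yle].
  move=> _;  rewrite (_ : (fun n => _) = cst 2^-1); first exact: cvg_cst.
  by apply/funext => n; exact: iter_smoothstep_half.
have y2 : y < 2^-1 by rewrite lt_neqAle yN.
have : 1 - iter n smoothstep (1 - y) @[n --> \oo] --> 1 - (1 : R).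
  by apply: cvgB; [exact: cvg_cst|apply: iter_smoothstep_cvg1; apply/andP; split; lra].
rewrite subrr; under eq_fun do rewrite iter_smoothstepC subKr.
by [].
Qed.

(** The fixed point 1/2 of the iteration survives in the limit; 2 s^2 - s sends 1, 1/2, 0 to 1, 0, 0
    and removes it. *)
Lemma step_limit_indicator y :
  2 * step_limit y ^+ 2 - step_limit y = (2^-1 < y)%R%:R.
Proof. by rewrite /step_limit; case: ltP => _ /=; [ring|case: eqP => _; [field|ring]]. Qed.

End Smoothstep.

(** * The commutant of the shift of L2(T) *)

Lemma ae_eq_on d (T : measurableType d) (R : realType) (mu : {measure set T -> \bar R})
    (U : Type) (P : T -> Prop) (f g : T -> U) :
  {ae mu, forall x, P x} -> (forall x, P x -> f x = g x) -> f = g %[ae mu].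
Proof. by move=> muP fg; apply: filterS muP => x /fg + _. Qed.

Section CircleCommutant.
Context (R : realType).
Notation mu := (circle R).
Notation L := (L2 (circle R)).

Lemma circle_conull : {ae mu, forall t, 0 < t < 2 * pi}.
Proof.
exists ([set 0 : R] `|` [set 2 * pi] `|` ~` `[0, 2 * pi]%classic); split.
- by apply: measurableU; [apply: measurableU|apply: measurableC].
- apply/eqP; rewrite eq_le measure_ge0 andbT.
  apply: le_trans (measureU2 _ _ _) _ => //.
    exact: measurableU.
    exact: measurableC.
  have pt (x : R) : (mu [set x] <= 0)%E.
    have /null_content_dominatesP := dominates_uniform_prob (twopi_gt0 R).
    move=> /(_ [set x]) h; rewrite le_eqVlt; apply/orP; left; apply/eqP; apply: h.
      exact: measurable_set1.
    exact: lebesgue_measure_set1.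
  have out : (mu (~` `[0%R, (2 * pi)%R]%classic) <= 0)%E.
    rewrite le_eqVlt; apply/orP; left; apply/eqP.
    apply: integral0_eq => x /=; rewrite in_itv/= => /negP/negbTE.
    by rewrite /uniform_pdf => ->.
  apply: (@le_trans _ _ (0 + 0 + 0)%E); last by rewrite !adde0.
  apply: leeD => //; apply: le_trans (measureU2 _ _ _) _ => //.
  by apply: leeD; exact: pt.
- move=> t /= /negP; rewrite negb_and -!leNgt => h.
  have [t0|t0] := ltP t 0; first by right; rewrite /= in_itv/= leNgt t0.
  have [t1|t1] := ltP (2 * pi) t; first by right; rewrite /= in_itv/= [t <= _]leNgt t1 andbF.
  left; case/orP: h => h; [left|right] => /=; apply/eqP; rewrite eq_le.
    by rewrite h t0.
  by rewrite h t1.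
Qed.

(** The chord from 1 to e^(ic) cuts off the arc: the right-hand side is cos (t - c/2), and the
    difference of both sides is 2 sin (t/2) sin ((c - t)/2). *)
Lemma arc_threshold (c t : R) : 0 < c < 2 * pi -> 0 < t < 2 * pi ->
  (cos (c / 2) < cos (c / 2) * cos t + sin (c / 2) * sin t) = (t < c).
Proof.
move=> /andP[c0 c1] /andP[t0 t1].
have cx : c / 2 = t / 2 + (c - t) / 2 by field.
have e1 : cos (c / 2) = cos (t / 2) * cos ((c - t) / 2) - sin (t / 2) * sin ((c - t) / 2).
  by rewrite cx cosD.
have e2 : cos (c / 2) * cos t + sin (c / 2) * sin t =
    cos (t / 2) * cos ((c - t) / 2) + sin (t / 2) * sin ((c - t) / 2).
  by rewrite -cosB -cosB -[RHS]cosN; congr cos; field.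
rewrite {1}e1 e2 -subr_gt0.
have -> : forall a b : R, a + b - (a - b) = 2 * b by move=> a b; ring.
rewrite pmulr_rgt0// pmulr_rgt0; last by apply: sin_gt0_pi; apply/andP; split; lra.
have [tc|ct|->] := ltgtP t c.
- by apply: sin_gt0_pi; apply/andP; split; lra.
- apply/negbTE; rewrite -leNgt ltW// -oppr_gt0 -sinN.
  by apply: sin_gt0_pi; apply/andP; split; lra.
- by rewrite subrr mul0r sin0 ltxx.
Qed.

Context (A A' : bop L L).
Hypothesis AA' : forall f g, '[A f, g] = '[f, A' g].

Definition commutes (m : measurableTypeR R -> R[i]) : Prop :=
  bounded_measurable m /\ forall f : L, A (mulop m f) = mulop m (A f).

Lemma commutes_cst a : commutes (fun=> a).
Proof.
split; first exact: bounded_measurable_cst.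
have ca (f : L) : mulop (fun=> a) f = a *: f.
  move: f; apply: L2_ind => F; rewrite scale_pi; apply: mulop_pi => //.
  exact/bounded_measurable_Linfty/bounded_measurable_cst.
by move=> f; rewrite !ca linearZ.
Qed.

Lemma commutes_lin a m m' : commutes m -> commutes m' ->
  commutes (fun x => a * m x + m' x).
Proof.
move=> [mb mc] [mb' mc']; split.
  apply: bounded_measurableD => //.
  by apply: bounded_measurableM => //; exact: bounded_measurable_cst.
by move=> f; rewrite !mulop_linear_symbol// linearD linearZ /= mc mc'.
Qed.

Lemma commutesM m m' : commutes m -> commutes m' ->
  commutes (fun x => m x * m' x).
Proof.
move=> [mb mc] [mb' mc']; split; first exact: bounded_measurableM.
by move=> f; rewrite -!mulopM// mc mc'.
Qed.

(** Moving [A] across the pairing as [A'] leaves multiplication operators only, so commutation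
    becomes an equality of pairings that survives the weak limit. *)
Lemma commutes_limit (m : nat -> R -> R) (l : R -> R) :
  (forall n x, `|m n x| <= 1) -> (forall x, m n x @[n --> \oo] --> l x) ->
  (forall n, commutes (fun x => (m n x)%:C)) -> commutes (fun x => (l x)%:C).
Proof.
move=> m1 ml mc.
have mm n : measurable_fun [set: R] (m n) by have [[+ _ _] _] := mc n.
have mfl : measurable_fun [set: R] l by apply: measurable_fun_cvg mm _ => x _; exact: ml.
have l1 x : `|l x| <= 1 by exact: norm_lim_le1 (m1^~ x) (ml x).
split; first exact: bounded_measurable_real mfl l1.
move=> f; apply: inner_eql => g; rewrite AA'.
apply: (@mulop_limit_eq _ _ _ mu m l f (A' g) (A f) g mm m1 ml) => n.
by rewrite -AA' (mc n).2.
Qed.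

Lemma commutes_ae m m' : commutes m -> bounded_measurable m' ->
  m = m' %[ae mu] -> commutes m'.
Proof.
move=> [mb mc] mb' mm'; split=> // f.
by rewrite -!(eq_mulop_ae _ mb mb' mm').
Qed.

Lemma eq_commutes m m' : m =1 m' -> commutes m -> commutes m'.
Proof. by move=> /funext ->. Qed.

Lemma commutes_smoothstep m n : (forall x, 0 <= m x <= 1) ->
  commutes (fun x => (m x)%:C) ->
  commutes (fun x => (iter n (@smoothstep R) (m x))%:C).
Proof.
move=> m01 mc; elim: n => [//|n ih].
have := commutesM (commutesM ih ih) (commutes_lin (- 2) ih (commutes_cst 3)).
apply: eq_commutes => x /=; rewrite /smoothstep -!rmorphM/=.
by apply: complex_eqP => /=; ring.
Qed.

Hypothesis Az : commutes (expi 1).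

(** On the circle the conjugate of z is its inverse, and [A] commutes with the inverse of an
    operator with which it commutes. *)
Lemma commutes_conj_expi : commutes (fun t => conjR R (expi 1 t)).
Proof.
have zb := bounded_measurable_conj Az.1.
have zz : (fun t => expi 1 t * conjR R (expi 1 t)) = fun=> 1 :> R[i].
  apply/funext => t; apply: complex_eqP => /=.
    by rewrite mulrN opprK -!expr2 cos2Dsin2.
  by ring.
have zz' : (fun t => conjR R (expi 1 t) * expi 1 t) = fun=> 1 :> R[i].
  by rewrite -zz; apply/funext => t; rewrite mulrC.
split=> // f.
rewrite -[LHS]mulop1 -zz' -(mulopM _ zb Az.1) -Az.2 mulopM//; last exact: Az.1.
by rewrite zz mulop1.
Qed.

Lemma commutes_trig (a b c : R) :
  commutes (fun t => (a * cos t + b * sin t + c)%:C).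
Proof.
have z := Az; have zc := commutes_conj_expi.
pose u : R[i] := (a / 2) -i* (b / 2).
have := commutes_lin u z (commutes_lin (conjR R u) zc (commutes_cst c%:C)).
apply: eq_commutes => t; rewrite /expi mul1r /u.
by apply: complex_eqP => /=; field.
Qed.

Definition good_set (E : set R) : Prop :=
  measurable E /\ commutes (fun t => (\1_E t)%:C).

Lemma good_ray (c : R) : good_set `]-oo, c[%classic.
Proof.
have mE : measurable (`]-oo, c[%classic : set (measurableTypeR R)).
  exact: measurable_itv.
have bE := bounded_measurable_indic R mE.
split=> //.
have [c0|c0] := leP c 0.
  apply: commutes_ae (commutes_cst 0) bE _.
  apply: (ae_eq_on circle_conull) => t /andP[t0 _].
  rewrite indicE memNset//= in_itv/= => /lt_le_trans/(_ c0) /(lt_trans t0).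
  by rewrite ltxx.
have [c1|c1] := leP (2 * pi) c.
  apply: commutes_ae (commutes_cst 1) bE _.
  apply: (ae_eq_on circle_conull) => t /andP[_ t1].
  by rewrite indicE mem_set//= in_itv/= (lt_le_trans t1).
(* This is 1/2 + (cos (c/2 - t) - cos (c/2)) / 4: the factor 1/4 keeps it in [0, 1], and it exceeds
   1/2 exactly on the arc. *)
pose y (t : R) : R := cos (c / 2) / 4 * cos t + sin (c / 2) / 4 * sin t +
  (2^-1 - cos (c / 2) / 4).
have y01 t : 0 <= y t <= 1.
  have -> : y t = 2^-1 + (cos (c / 2 - t) - cos (c / 2)) / 4.
    by rewrite cosB /y; field.
  have := cos_le1 (c / 2 - t); have := cos_geN1 (c / 2 - t).
  have := cos_le1 (c / 2); have := cos_geN1 (c / 2).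
  by move=> *; apply/andP; split; lra.
have yc : commutes (fun t => (y t)%:C) by exact: commutes_trig.
have hc : commutes (fun t => (step_limit (y t))%:C).
  apply: (@commutes_limit (fun n t => iter n (@smoothstep R) (y t))).
  - move=> n t; have /andP[h0 h1] := iter_smoothstep_bound n (y01 t).
    by rewrite ger0_norm.
  - by move=> t; exact: iter_smoothstep_cvg.
  - by move=> n; exact: commutes_smoothstep.
have := commutes_lin 2 (commutesM hc hc) (commutes_lin (-1) hc (commutes_cst 0)).
move=> /commutes_ae; apply=> //.
apply: (ae_eq_on circle_conull) => t t01.
have -> : 2 * ((step_limit (y t))%:C * (step_limit (y t))%:C) +
    (-1 * (step_limit (y t))%:C + 0) = (2 * step_limit (y t) ^+ 2 - step_limit (y t))%:C.
  by apply: complex_eqP => /=; ring.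
rewrite step_limit_indicator indicE; congr ((_%:R)%:C).
have -> : (2^-1 < y t)%R = (t < c).
  rewrite -(@arc_threshold c t)// ?c0//.
  by apply/idP/idP; rewrite /y => ?; lra.
by rewrite mem_setE in_itv.
Qed.

End CircleCommutant.

Section NullClasses.
Context d (T : measurableType d) (R : realType).
Variable mu : {measure set T -> \bar R}.

Lemma pi_eq0 (F : L2fun mu) :
  ae_eq mu setT (EFin \o (fun t => Re (conjR R (F t)))) (cst 0%E) ->
  ae_eq mu setT (EFin \o (fun t => Im (conjR R (F t)))) (cst 0%E) ->
  \pi_(L2 mu)%qT F = 0.
Proof.
move=> r0 i0; have -> : 0 = \pi_(L2 mu)%qT 0 by rewrite piE.
apply/L2_eqP; apply: filterS2 r0 i0 => x /(_ Logic.I)[r0] /(_ Logic.I)[i0] _.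
rewrite cRe_conj in r0; rewrite cIm_conj in i0.
by apply: complex_eqP; rewrite ?r0 // -[LHS]opprK i0 oppr0.
Qed.

Lemma pi_eq_off (E : set T) (F G : L2fun mu) : measurable E -> mu E = 0 ->
  (forall x, ~ E x -> F x = G x) -> \pi_(L2 mu)%qT F = \pi_(L2 mu)%qT G.
Proof.
move=> mE E0 FG; apply/L2_eqP; exists E; split => // x /= /not_implyP[_ nFG].
by apply: contrapT => /FG.
Qed.

Lemma hnorm_mulop_indic (E : set T) (F : L2fun mu) : measurable E ->
  ((hnorm (mulop (fun t => (\1_E t)%:C) (\pi_(L2 mu)%qT F)) ^+ 2)%:E =
   \int[mu]_x (\1_E x * (Re (F x) ^+ 2 + Im (F x) ^+ 2))%:E)%E.
Proof.
move=> mE.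
have bE := bounded_measurable_Linfty mu (bounded_measurable_indic R mE).
have [G GE ->] := mulop_ex bE F.
rewrite hnorm_pi /sqint -ge0_integralD//.
- apply: eq_integral => x _ /=; rewrite GE -EFinD; congr EFin.
  by rewrite cRe_realM cIm_realM !exprMn indicE; case: (_ \in _) => /=; ring.
- by move=> x _; rewrite lee_fin sqr_ge0.
- by apply: measurable_sqr; have /andP[/Lfun2P[]] := valP G.
- by move=> x _; rewrite lee_fin sqr_ge0.
- by apply: measurable_sqr; have /andP[_ /Lfun2P[]] := valP G.
Qed.

Lemma measure_indic_mass (E : set T) : measurable E ->
  mu E = (\int[mu]_x (\1_E x)%:E)%E.
Proof. by move=> mE; rewrite integral_indic// setIT. Qed.

End NullClasses.

(** * The symbol of an operator commuting with z *)

Section CircleSymbol.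
Context (R : realType).
Notation mu := (circle R).
Notation L := (L2 (circle R)).
Local Notation piL2 f := (\pi_(L2 (circle R))%qT f).

Context (A A' : bop L L).
Hypothesis AA' : forall f g, '[A f, g] = '[f, A' g].
Hypothesis Az : commutes A (expi 1).

Lemma commutes_indic (E : set (measurableTypeR R)) : measurable E ->
  commutes A (fun t => (\1_E t)%:C).
Proof.
have goodC F : good_set A F -> good_set A (~` F).
  move=> [mF cF]; split; first exact: measurableC.
  have := commutes_lin (-1) cF (commutes_cst A 1).
  apply: eq_commutes => t; rewrite !indicE in_setC.
  by apply: complex_eqP => /=; case: (_ \in _) => /=; ring.
suff : (@ocitv R).-sigma.-measurable `<=` good_set A by move=> h /h[].
rewrite RGenInftyO.measurableE; apply: smallest_sub; last first.
  by move=> _ [x ->]; exact: good_ray AA' Az x.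
split.
- split=> //; have := commutes_cst A 0; apply: eq_commutes => t.
  by rewrite indicE in_set0.
- by move=> F; rewrite setTD; exact: goodC.
- move=> F FG; rewrite -[X in good_set A X]setCK; apply: goodC; split.
    by apply: measurableC; apply: bigcupT_measurable => n; have [] := FG n.
  (* Finite products of complementary indicators lie in the commutant and converge to the indicator
     of the complement of the union. *)
  pose w n (t : R) : R := \prod_(k < n) (1 - \1_(F k) t).
  have w01 n t : 0 <= w n t <= 1.
    elim: n => [|n /andP[h0 h1]]; rewrite /w ?big_ord0 ?lexx ?ler01//.
    rewrite big_ord_recr/= indicE; case: (_ \in _); first by rewrite subrr mulr0 lexx ler01.
    by rewrite subr0 mulr1 h0 h1.
  apply: (@commutes_limit _ _ _ AA' w).
  + by move=> n t; have /andP[h0 h1] := w01 n t; rewrite ger0_norm.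
  + move=> t; rewrite indicE in_setC.
    have [[k _ Fk]|Ft] := pselect ((\bigcup_k F k) t).
      rewrite mem_set//=; last by exists k.
      apply: cvg_near_cst; exists k.+1 => // n /= kn.
      by rewrite /w (bigD1 (Ordinal kn))//= indicE mem_set// subrr mul0r.
    rewrite memNset//= (_ : w^~ t = cst 1); first exact: cvg_cst.
    apply/funext => n; rewrite /w big1// => k _.
    rewrite indicE memNset ?subr0// => Fk; apply: Ft; exists k => //.
  + elim=> [|n ih].
      by have := commutes_cst A 1; apply: eq_commutes => t; rewrite /w big_ord0.
    have := commutesM ih (commutes_lin (-1) (FG n).2 (commutes_cst A 1)).
    apply: eq_commutes => t; rewrite /w big_ord_recr/=.
    by apply: complex_eqP => /=; ring.
Qed.

Let one_L2 : (fun=> 1 : R[i]) \in cLfun mu 2%:E.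
Proof.
apply: bounded_measurable_L2; first exact: bounded_measurable_cst.
exact: fin_num_measure.
Qed.

Let one : L := piL2 (L2Fun one_L2).

(** The hypothesis says that the conjugate of [k] has integral zero over every measurable set, hence
    vanishes almost everywhere. *)
Lemma indic_total (k : L) :
  (forall E : set (measurableTypeR R), measurable E ->
     '[mulop (fun t => (\1_E t)%:C) one, k] = 0) -> k = 0.
Proof.
move: k; apply: L2_ind => K K0.
have KE : (fun t => conjR R (K t)) \in cLfun mu 1%E.
  rewrite (_ : (fun t => _) = fun t => 1 * conjR R (K t)).
    exact: cLfun1_conjM one_L2 (valP K).
  by apply/funext => t; rewrite mul1r.
have /andP[/Lfun1_integrable rK /Lfun1_integrable iK] := KE.
have zero (h : R -> R) : mu.-integrable [set: _] (EFin \o h) ->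
    (forall E : set (measurableTypeR R), measurable E ->
       (\int[mu]_x (\1_E x * h x))%R = 0) -> ae_eq mu setT (EFin \o h) (cst 0%E).
  move=> hi h0; apply: integral_ae_eq => // E _ mE.
  rewrite integral_mkcond/= integral0.
  have : (\int[mu]_x (\1_E x * h x))%R = 0 by exact: h0.
  rewrite /Rintegral => /eqP; rewrite fine_eq0.
    move=> /eqP <-; apply: eq_integral => x _.
    by rewrite patchE indicE; case: (_ \in _) => /=; rewrite ?mul1r ?mul0r.
  apply: integrable_fin_num => //; apply/Lfun1_integrable.
  apply: Lfun1_bounded_mul; first exact: measurable_indic.
    by move=> x; rewrite indicE; case: (_ \in _); rewrite ?normr1 ?normr0.
  exact/Lfun1_integrable.
have E0 (E : set (measurableTypeR R)) : measurable E ->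
    cintegral mu (fun t => (\1_E t)%:C * conjR R (K t)) = 0.
  move=> mE; rewrite -(K0 E mE) inner_mulop; last first.
    exact/bounded_measurable_Linfty/bounded_measurable_indic.
  by congr cintegral; apply/funext => t; rewrite mul1r.
have rK0 := zero _ rK _; have iK0 := zero _ iK _.
have {}rK0 : ae_eq mu setT (EFin \o (fun t => Re (conjR R (K t)))) (cst 0%E).
  apply: rK0 => E mE; have [+ _] := E0 E mE => <-.
  by apply: eq_Rintegral => t _; rewrite cRe_realM.
have {}iK0 : ae_eq mu setT (EFin \o (fun t => Im (conjR R (K t)))) (cst 0%E).
  apply: iK0 => E mE; have [_ +] := E0 E mE => <-.
  by apply: eq_Rintegral => t _; rewrite cIm_realM.
exact: pi_eq0.
Qed.

Let sqr_succ_le (M p : R) : 0 <= M -> 0 <= p ->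
  (M + 1) ^+ 2 * p <= M ^+ 2 * p -> p = 0.
Proof.
move=> M0 p0 Mp; apply/eqP; rewrite eq_le p0 andbT.
have M2 : 0 < 2 * M + 1 by lra.
by rewrite -(pmulr_rle0 _ M2); lra.
Qed.

(* The symbol is A 1; it is bounded off a null set because multiplication by it is
   bounded on indicator functions. *)
Theorem commutant_symbol : exists phi : Linf mu, forall f, A f = Linf_mul phi f.
Proof.
have [M M0 AM] := bop_bounded A.
pose F := repr (A one); have FE : piL2 F = A one by exact: L2_reprK.
have /andP[/Lfun2P[mr _] /Lfun2P[mi _]] := valP F.
pose h t : R := Re (F t) ^+ 2 + Im (F t) ^+ 2.
have mh : measurable_fun [set: measurableTypeR R] h.
  by apply: measurable_funD; exact: measurable_funX.
(* The threshold lies strictly above the bound [M] of [A]: comparing the norms of A 1_E and 1_E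
   gives (M + 1)^2 mu(E) <= M^2 mu(E), so mu(E) = 0. *)
pose E : set (measurableTypeR R) := h @^-1` `](M + 1) ^+ 2, +oo[%classic.
have mE : measurable E.
  by rewrite -[E]setTI; apply: mh => //; exact: measurable_itv.
have Efin : mu E \is a fin_num by exact: fin_num_measure.
have E0 : mu E = 0.
  have c1 : ((M + 1) ^+ 2 * fine (mu E) <= M ^+ 2 * fine (mu E)).
    have n1 : hnorm (mulop (fun t => (\1_E t)%:C) one) ^+ 2 = fine (mu E).
      apply: EFin_inj; rewrite hnorm_mulop_indic// fineK//.
      rewrite [RHS](measure_indic_mass mu mE); apply: eq_integral => x _ /=.
      by rewrite expr1n expr0n/= addr0 mulr1.
    have n2 : (M + 1) ^+ 2 * fine (mu E) <=
        hnorm (mulop (fun t => (\1_E t)%:C) (A one)) ^+ 2.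
      rewrite -lee_fin -FE hnorm_mulop_indic// EFinM fineK//.
      rewrite [X in (_ * X)%E](measure_indic_mass mu mE) -ge0_integralZl; last 4 first.
      - exact: measurableT.
      - exact/measurable_EFinP/measurable_indic.
      - by move=> x _; rewrite lee_fin indicE.
      - by rewrite lee_fin sqr_ge0.
      apply: ge0_le_integral => //.
      - by move=> x _; rewrite -EFinM lee_fin mulr_ge0 ?sqr_ge0// indicE.
      - rewrite (_ : (fun x => _) = EFin \o (fun x => (M + 1) ^+ 2 * \1_E x)).
          by apply/measurable_EFinP; apply: measurable_funM => //; exact: measurable_indic.
        by apply/funext => x; rewrite /= EFinM.
      - apply/measurable_EFinP; apply: (measurable_funM _ mh).
        exact: measurable_indic.
      - move=> x _; rewrite -EFinM lee_fin mulrC indicE.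
        have [xE|] := boolP (x \in E); last by rewrite !mul0r.
        rewrite !mul1r; move: xE; rewrite inE /E /= in_itv/= andbT.
        exact: ltW.
    apply: le_trans n2 _; rewrite -(commutes_indic mE).2 -n1 -exprMn.
    rewrite ler_pXn2r ?nnegrE ?hnorm_ge0// ?mulr_ge0 ?hnorm_ge0//.
  have e0 : 0 <= fine (mu E) by rewrite fine_ge0.
  by rewrite -(fineK Efin); congr EFin; exact: sqr_succ_le M0 e0 c1.
(* Zero on the null set [E]: same class as [A one], but bounded everywhere. *)
pose m t : R[i] := (\1_(~` E) t)%:C * F t.
have mb : bounded_measurable (m : measurableTypeR R -> _).
  have mnE : measurable (~` E) by exact: measurableC.
  split.
  - rewrite (_ : _ \o _ = fun t => \1_(~` E) t * Re (F t)).
      by apply: measurable_funM => //; exact: measurable_indic.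
    by apply/funext => t /=; rewrite cRe_realM.
  - rewrite (_ : _ \o _ = fun t => \1_(~` E) t * Im (F t)).
      by apply: measurable_funM => //; exact: measurable_indic.
    by apply/funext => t /=; rewrite cIm_realM.
  - exists (M + 1) => t; rewrite /m cRe_realM cIm_realM indicE in_setC.
    have [tE|tE] := boolP (t \in E).
      by rewrite /= !mul0r normr0 addr_ge0.
    rewrite /= !mul1r; have hM : h t <= (M + 1) ^+ 2.
      by move: tE; rewrite notin_setE /E /= in_itv/= andbT => /negP; rewrite -leNgt.
    have M1 : 0 <= M + 1 by rewrite addr_ge0.
    split; rewrite -(@ler_pXn2r _ 2) ?nnegrE// real_normK ?num_real//;
      apply: le_trans hM; rewrite /h.
      by rewrite lerDl sqr_ge0.
    by rewrite lerDr sqr_ge0.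
have mone : mulop m one = A one.
  have [G GE ->] := mulop_ex (bounded_measurable_Linfty mu mb) (L2Fun one_L2).
  rewrite -FE; apply: (pi_eq_off mE E0) => t Et.
  by rewrite GE /= mulr1 /m indicE mem_set// mul1r.
(* [A] is known on indicators only; pairing with them determines [A'] everywhere, and [A] is
   recovered from [A']. *)
have A'E g : A' g = mulop (fun t => conjR R (m t)) g.
  apply/eqP; rewrite -subr_eq0; apply/eqP; apply: indic_total => D mD.
  have bD := bounded_measurable_indic R mD.
  rewrite innerBr -AA' -mulop_adjoint// (commutes_indic mD).2 -mone !mulopM//.
  rewrite (_ : (fun x => _ * m x) = (fun x => m x * (\1_D x)%:C)) ?subrr//.
  by apply/funext => x; rewrite mulrC.
have AE f : A f = mulop m f.
  by apply: inner_eql => g; rewrite AA' mulop_adjoint// A'E.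
exists (LInf (bounded_measurable_Linfty mu mb)) => f; rewrite AE /mulop.
case: pselect => [p|]; last by move=> /(_ (bounded_measurable_Linfty mu mb)).
by rewrite (Prop_irrelevance p (bounded_measurable_Linfty mu mb)).
Qed.

End CircleSymbol.

(** * Averaging over the shift *)

Section BanachLimit.
Context (R : realType).
Implicit Types x y : nat -> R.

Definition bounded_seq x : Prop := exists C, forall n, `|x n| <= C.

Let cesaro x n : R := (\sum_(i < n.+1) x i) / n.+1%:R.

Let cesaro_le x C n : (forall n, x n <= C) -> cesaro x n <= C.
Proof.
move=> xC; rewrite /cesaro ler_pdivrMr// mulr_natr -[n.+1 in leRHS]card_ord.
by rewrite -sumr_const ler_sum.
Qed.

Let cesaro_lin a x y n :
  cesaro (fun n => a * x n + y n) n = a * cesaro x n + cesaro y n.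
Proof. by rewrite /cesaro big_split/= -mulr_sumr mulrDl mulrA. Qed.

Let cesaro_bounded x C n : (forall n, `|x n| <= C) -> `|cesaro x n| <= C.
Proof.
move=> xC; rewrite /cesaro normrM [`|_^-1|]ger0_norm// ler_pdivrMr//.
rewrite (le_trans (ler_norm_sum _ _ _))// mulr_natr -[n.+1 in leRHS]card_ord.
by rewrite -sumr_const ler_sum.
Qed.

(** The sum telescopes to [x n.+1 - x 0]. Without the means, an ultrafilter limit would not be shift
    invariant. *)
Let cesaro_shift x C n : (forall n, `|x n| <= C) ->
  `|cesaro (fun n => x n.+1) n - cesaro x n| <= 2 * C / n.+1%:R.
Proof.
move=> xC; rewrite /cesaro -mulrBl normrM [`|_^-1|]ger0_norm// ler_wpM2r//.
rewrite -sumrB -(big_mkord xpredT (fun i => x i.+1 - x i)) telescope_sumr//.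
by rewrite (le_trans (ler_normB _ _))// mulr_natl mulr2n lerD.
Qed.

(* Limit of the Cesaro means along an ultrafilter. *)
Theorem banach_limit : exists lim : (nat -> R) -> R,
  [/\ forall a x y, bounded_seq x -> bounded_seq y ->
        lim (fun n => a * x n + y n) = a * lim x + lim y,
      forall x C, bounded_seq x -> (forall n, x n <= C) -> lim x <= C &
      forall x, bounded_seq x -> lim (fun n => x n.+1) = lim x].
Proof.
have [U [UU ooU]] := @ultraFilterLemma nat (\oo)%classic _.
(* Compactness of [-C, C] gives a cluster point, and an ultrafilter converges to its cluster
   points. *)
have Ucvg (y : nat -> R) C : (forall n, `|y n| <= C) -> exists l : R, y @ U --> l.
  move=> yC; have FF : ProperFilter (y @ U) by exact: fmap_proper_filter.
  have yU : U (y @^-1` `[- C, C]%classic).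
    by apply: filterE => n; rewrite /= in_itv/= -ler_norml.
  have [l [_ lcl]] := @segment_compact R (- C) C (y @ U) FF yU.
  exists l => N Nl; have [//|UN] := in_ultra_setVsetC (y @^-1` N) UU.
  have [z [] //] := lcl (~` N) N UN Nl.
have /choice[lim limP] : forall x : nat -> R, exists l : R,
    bounded_seq x -> cesaro x @ U --> l.
  move=> x; have [[C xC]|xb] := pselect (bounded_seq x); last by exists 0.
  have [l xl] := @Ucvg (cesaro x) C (fun n => cesaro_bounded n xC).
  by exists l.
exists lim; split.
- move=> a x y xb yb.
  have b : bounded_seq (fun n => a * x n + y n).
    have [[C xC] [D yD]] := (xb, yb); exists (`|a| * C + D) => n.
    by rewrite (le_trans (ler_normD _ _))// normrM lerD// ler_wpM2l.
  apply: (@cvg_unique _ _ (cesaro (fun n => a * x n + y n) @ U)) => //.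
    exact: limP.
  rewrite (_ : cesaro _ = fun n => a * cesaro x n + cesaro y n); last first.
    by apply/funext => n; exact: cesaro_lin.
  by apply: cvgD; [apply: cvgM; [exact: cvg_cst|exact: limP]|exact: limP].
- move=> x C xb xC.
  apply: (closed_cvg (fun r : R => r <= C) (@closed_le R C) _ _ (limP x xb)).
  by apply: filterE => n; exact: cesaro_le.
- move=> x xb; have [C xC] := xb.
  have sb : bounded_seq (fun n => x n.+1) by exists C.
  have C0 : 0 <= C by exact: le_trans (normr_ge0 _) (xC 0%N).
  have d0 : (fun n => cesaro (fun n => x n.+1) n - cesaro x n) @ U --> (0 : R).
    apply/cvgrPdist_lt => e e0; apply: ooU.
    have e1 : 0 < e / (2 * C + 1) by rewrite divr_gt0// ltr_wpDl// mulr_ge0.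
    have [N _ NP] := near_infty_natSinv_lt (PosNum e1).
    exists N => // n /NP /= nN; rewrite sub0r normrN.
    apply: le_lt_trans (cesaro_shift n xC) _.
    rewrite ltr_pdivlMr in nN; last by rewrite ltr_wpDl// mulr_ge0.
    apply: le_lt_trans nN; rewrite mulrC ler_wpM2l ?invr_ge0// lerDl.
    exact: ler01.
  apply: (@cvg_unique _ _ (cesaro (fun n => x n.+1) @ U)) => //.
    exact: limP.
  rewrite -[lim x]add0r.
  rewrite (_ : cesaro _ = fun n => cesaro (fun n => x n.+1) n - cesaro x n + cesaro x n).
    by apply: cvgD; [exact: d0|exact: limP].
  by apply/funext => n; rewrite subrK.
Qed.

End BanachLimit.

(** * The shift and the Hardy space *)

Section HardyShift.
Context (R : realType).
Notation mu := (circle R).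
Notation L := (L2 (circle R)).
Local Notation piL2 f := (\pi_(L2 (circle R))%qT f).

Lemma bounded_measurable_expi k :
  bounded_measurable (expi k : measurableTypeR R -> R[i]).
Proof.
have mk : measurable_fun [set: measurableTypeR R] (fun t : R => k%:~R * t).
  by apply: measurable_funM.
split.
- apply: (measurableT_comp _ mk).
  by apply: continuous_measurable_fun; exact: continuous_cos.
- apply: (measurableT_comp _ mk).
  by apply: continuous_measurable_fun; exact: continuous_sin.
- exists 1 => t /=; rewrite !ler_norml.
  by rewrite cos_geN1 cos_le1 sin_geN1 sin_le1.
Qed.

Definition shift (f : L) : L := mulop (expi 1 : measurableTypeR R -> R[i]) f.

Lemma expi_conjM (t : R) : expi 1 t * conjR R (expi 1 t) = 1.
Proof.
apply: complex_eqP => /=; last by ring.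
by rewrite mulrN opprK -!expr2 cos2Dsin2.
Qed.

Lemma shift_linear a f g : shift (a *: f + g) = a *: shift f + shift g.
Proof. exact: mulop_linear (bounded_measurable_expi 1) _ _ _. Qed.

(** Surjectivity of the shift, true on L^2 but not on H^2; it turns invariance of the averaged form
    into commutation with z. *)
Lemma shift_adjointK g :
  shift (mulop (fun t : measurableTypeR R => conjR R (expi 1 t)) g) = g.
Proof.
have bz := bounded_measurable_expi 1.
rewrite /shift mulopM//; last exact: bounded_measurable_conj.
rewrite (_ : (fun x => _) = fun=> 1) ?mulop1//.
by apply/funext => t; rewrite expi_conjM.
Qed.

Lemma shift_isometry f g : '[shift f, shift g] = '[f, g].
Proof.
have bz := bounded_measurable_expi 1.
rewrite /shift mulop_adjoint// mulopM//; last exact: bounded_measurable_conj.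
rewrite (_ : (fun x => _) = fun=> 1) ?mulop1//.
by apply/funext => t; rewrite mulrC expi_conjM.
Qed.

Lemma iter_shift_isometry n f g : '[iter n shift f, iter n shift g] = '[f, g].
Proof. by elim: n => //= n ih; rewrite shift_isometry. Qed.

Lemma iter_shift_linear n a f g :
  iter n shift (a *: f + g) = a *: iter n shift f + iter n shift g.
Proof. by elim: n => //= n ->; rewrite shift_linear. Qed.

Lemma hnorm_iter_shift n f : hnorm (iter n shift f) = hnorm f.
Proof. by rewrite /hnorm iter_shift_isometry. Qed.

Lemma shift_hardy (f : L) : f \in @hardy R -> shift f \in @hardy R.
Proof.
rewrite !inE => f0 k k0; rewrite /fourier_coef /shift mulop_adjoint; last first.
  exact: bounded_measurable_expi.
(* Coefficient [k] of z f is coefficient [k - 1] of f, whose index is still negative. *)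
rewrite -(f0 (k - 1)); last by rewrite ltrBlDr (lt_trans k0).
rewrite /fourier_coef; congr ('[_, _]); apply: mulop_pi => [|t /=].
  exact/bounded_measurable_Linfty/bounded_measurable_conj/bounded_measurable_expi.
rewrite /expi rmorphB/= mulrBl mul1r cosB sinB.
by apply: complex_eqP => /=; ring.
Qed.

Lemma iter_shift_hardy n (f : L) : f \in @hardy R -> iter n shift f \in @hardy R.
Proof. by move=> fh; elim: n => //= n; exact: shift_hardy. Qed.

Lemma H2_inP (f : H2 R) : (f : L) \in @hardy R.
Proof. exact: valP. Qed.

Lemma inner_H2 (f g : H2 R) : '[f, g] = '[h2_L2 f, h2_L2 g].
Proof. by []. Qed.

Theorem hilbert_H2 : hilbert_space (H2 R).
Proof.
move=> u uC; have [l /[dup] lcv /hilbert_limP ul] := @hilbert_L2 _ _ _ mu (fun n => h2_L2 (u n)) uC.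
have lh : l \in @hardy R.
  rewrite inE => k k0.
  set e := piL2 (L2Fun (expi_L2 R k)).
  have E n (z : R[i]) : '[z *: (l - h2_L2 (u n)), e] = z * fourier_coef l k.
    rewrite innerZl innerBl; have := H2_inP (u n); rewrite inE => /(_ k k0).
    by rewrite /fourier_coef -/e => ->; rewrite subr0.
  (* The coefficient of [l] is also that of [l - u n], which tends to 0. Only real parts are
     bounded, so z is then taken to be 1, -1, i and -i. *)
  have key (z : R[i]) : Re (z * fourier_coef l k) <= 0.
    apply/ler_addgt0Pr => d d0; rewrite add0r.
    pose C := Normc.normc z * hnorm e + 1.
    have C0 : 0 < C.
      rewrite ltr_wpDl// mulr_ge0 ?hnorm_ge0//; case: (z) => ? ?; exact: sqrtr_ge0.
    have [N NP] := ul _ (divr_gt0 d0 C0).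
    rewrite -(E N); apply: le_trans (Re_CauchySchwarz _ _) _.
    rewrite hnormZ hnormBC mulrAC; apply: ltW.
    have := NP N (leqnn N); rewrite ltr_pdivlMr// => h; apply: le_lt_trans h.
    rewrite mulrC ler_wpM2l ?hnorm_ge0// /C lerDl.
    exact: ler01.
  have h1 := key 1; have h2 := key (-1); have h3 := key 'i; have h4 := key (- 'i).
  rewrite mul1r in h1; rewrite mulN1r cReN in h2; rewrite cReiM in h3.
  rewrite mulNr cReN cReiM in h4.
  move: (fourier_coef l k) h1 h2 h3 h4 => [a b] /= *.
  by apply: complex_eqP => /=; lra.
by exists (MkH2 lh).
Qed.

Lemma hardy_projection : exists Pr : L -> H2 R,
  [/\ forall a f g, Pr (a *: f + g) = a *: Pr f + Pr g,
      forall f, hnorm (Pr f) <= hnorm f &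
      forall f, f \in @hardy R -> h2_L2 (Pr f) = f].
Proof.
have /choice[Pr PrE] : forall f : L, exists p : H2 R, forall h, '[p, h] = '[f, h2_L2 h].
  move=> f; have [|h|p pE] := @riesz_representation R (H2 R)
      (fun h => '[h2_L2 h, f]) (hnorm f) hilbert_H2.
  - by move=> a x y; rewrite -innerZl -innerDl.
  - by rewrite mulrC Re_CauchySchwarz.
  - by exists p => h; rewrite innerC -pE -innerC.
exists Pr; split=> //.
- by move=> a f g; apply: inner_eql => h; rewrite innerDl innerZl !PrE innerDl innerZl.
- move=> f; apply: hnorm_le_pairing; first exact: hnorm_ge0.
  by move=> h; rewrite PrE Re_CauchySchwarz.
- move=> f fh; have -> : Pr f = MkH2 fh; last by [].
  by apply: inner_eql => h; rewrite PrE.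
Qed.

End HardyShift.

Section Adjoint.
Context (R : realType) (H : innerProductType R).

Lemma bop_adjoint (A : 'B(H)) : hilbert_space H ->
  exists A' : 'B(H), forall f g, '[A f, g] = '[f, A' g].
Proof.
move=> hH; have [M M0 AM] := bop_bounded A.
have [||x y|A' A'E] := @bop_of_form R H H (fun g f => '[g, A f]) M hH M0.
- by move=> a x x' y; rewrite innerDl innerZl.
- by move=> a x y y'; rewrite linearP innerDr innerZr.
- apply: le_trans (Re_CauchySchwarz _ _) _.
  by rewrite [M * _]mulrC -mulrA ler_wpM2l ?hnorm_ge0.
- by exists A' => f g; rewrite innerC -A'E -innerC.
Qed.

End Adjoint.

(** * The averaged form and the projection onto Toeplitz operators *)

Section ShiftAverage.
Context (R : realType).
Notation mu := (circle R).
Notation L := (L2 (circle R)).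

Context (lim : (nat -> R) -> R).
Hypothesis lim_lin : forall a (x y : nat -> R), bounded_seq x -> bounded_seq y ->
  lim (fun n => a * x n + y n) = a * lim x + lim y.
Hypothesis lim_le : forall x C, bounded_seq x -> (forall n, x n <= C) -> lim x <= C.
Hypothesis lim_shift : forall x, bounded_seq x -> lim (fun n => x n.+1) = lim x.

Definition bounded_cseq (u : nat -> R[i]) : Prop :=
  bounded_seq (fun n => Re (u n)) /\ bounded_seq (fun n => Im (u n)).

Definition clim (u : nat -> R[i]) : R[i] :=
  lim (fun n => Re (u n)) +i* lim (fun n => Im (u n)).

Let bounded_seq_lin (a : R) (x y : nat -> R) : bounded_seq x -> bounded_seq y ->
  bounded_seq (fun n => a * x n + y n).
Proof.
move=> [C xC] [D yD]; exists (`|a| * C + D) => n.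
by rewrite (le_trans (ler_normD _ _))// normrM lerD// ler_wpM2l.
Qed.

Let bounded_seq0 : bounded_seq (fun=> 0 : R).
Proof. by exists 0 => n; rewrite normr0. Qed.

Let lim0 : lim (fun=> 0) = 0.
Proof.
have := lim_lin 1 bounded_seq0 bounded_seq0.
by rewrite (_ : (fun n => _) = fun=> 0); [lra|apply/funext => n; rewrite mulr0 addr0].
Qed.

Let lim_cst a : lim (fun=> a) = a.
Proof.
have b1 : bounded_seq (fun=> 1 : R) by exists 1 => n; rewrite normr1.
have l1 : lim (fun=> 1) <= 1 by exact: lim_le.
have bN1 : bounded_seq (fun=> -1 : R) by exists 1 => n; rewrite normrN1.
have lN1 : lim (fun=> -1) <= -1 by exact: lim_le.
have := lim_lin (-1) b1 bounded_seq0.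
rewrite (_ : (fun n => _) = fun=> -1); last by apply/funext => n; rewrite mulr1 addr0.
rewrite lim0 => lE.
have := lim_lin a b1 bounded_seq0.
rewrite (_ : (fun n => _) = fun=> a); last by apply/funext => n; rewrite mulr1 addr0.
rewrite lim0 => ->; have -> : lim (fun=> 1) = 1 by lra.
by rewrite mulr1 addr0.
Qed.

Lemma bounded_cseq_lin a u v : bounded_cseq u -> bounded_cseq v ->
  bounded_cseq (fun n => a * u n + v n).
Proof.
move=> [ur ui] [vr vi]; split.
- rewrite (_ : (fun n => _) =
      fun n => Re a * Re (u n) + ((- Im a) * Im (u n) + Re (v n))).
    by do 2 apply: bounded_seq_lin => //.
  by apply/funext => n; rewrite cReD cReM mulNr addrA.
- rewrite (_ : (fun n => _) =
      fun n => Re a * Im (u n) + (Im a * Re (u n) + Im (v n))).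
    by do 2 apply: bounded_seq_lin => //.
  by apply/funext => n; rewrite cImD cImM addrA.
Qed.

Lemma clim_lin a u v : bounded_cseq u -> bounded_cseq v ->
  clim (fun n => a * u n + v n) = a * clim u + clim v.
Proof.
move=> [ur ui] [vr vi]; apply: complex_eqP; rewrite ?cReD ?cImD ?cReM ?cImM /=.
- rewrite (_ : (fun n => _) =
      fun n => Re a * Re (u n) + ((- Im a) * Im (u n) + Re (v n))).
    by rewrite !lim_lin//; [ring|exact: bounded_seq_lin].
  by apply/funext => n; rewrite cReD cReM mulNr addrA.
- rewrite (_ : (fun n => _) =
      fun n => Re a * Im (u n) + (Im a * Re (u n) + Im (v n))).
    by rewrite !lim_lin//; [ring|exact: bounded_seq_lin].
  by apply/funext => n; rewrite cImD cImM addrA.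
Qed.

Lemma clim_cst a : clim (fun=> a) = a.
Proof. by apply: complex_eqP; rewrite /= lim_cst. Qed.

Lemma clim_shift u : bounded_cseq u -> clim (fun n => u n.+1) = clim u.
Proof.
by move=> [ur ui]; apply: complex_eqP => /=; [rewrite (lim_shift ur)|rewrite (lim_shift ui)].
Qed.

Lemma clim_ge0 u : bounded_cseq u -> (forall n, 0 <= u n) -> 0 <= clim u.
Proof.
move=> [ur ui] u0.
have un n : 0 <= Re (u n) /\ Im (u n) = 0.
  by have := u0 n; rewrite lecE => /andP[/eqP].
rewrite lecE /=; apply/andP; split.
  rewrite (_ : (fun n => _) = fun=> 0) ?lim0//.
  by apply/funext => n; have [] := un n.
have := lim_lin (-1) ur bounded_seq0; rewrite lim0.
set x := (fun n => -1 * _ + _) => h.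
have : lim x <= 0.
  apply: lim_le; first exact: bounded_seq_lin.
  by move=> n; rewrite /x addr0 mulN1r oppr_le0; have [] := un n.
by rewrite h; lra.
Qed.

Lemma Re_clim_le u C : bounded_cseq u -> (forall n, Re (u n) <= C) ->
  Re (clim u) <= C.
Proof. by move=> [ur _] uC; exact: lim_le. Qed.

Lemma clim_sum n (u : 'I_n -> nat -> R[i]) : (forall i, bounded_cseq (u i)) ->
  bounded_cseq (fun k => \sum_i u i k) /\
  clim (fun k => \sum_i u i k) = \sum_i clim (u i).
Proof.
move=> ub; rewrite (_ : (fun k => _) = \sum_i u i); last first.
  by apply/funext => k; rewrite fct_sumE.
apply: (big_ind2 (fun v z => bounded_cseq v /\ clim v = z)) => //.
  split; last by rewrite (clim_cst 0).
  by split; exact: bounded_seq0.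
move=> v z v' z' [bv <-] [bv' <-].
have -> : v + v' = (fun n => 1 * v n + v' n).
  by apply/funext => k; rewrite mul1r.
by split; [exact: bounded_cseq_lin|rewrite clim_lin// mul1r].
Qed.

Context (Pr : L -> H2 R).
Hypothesis Prlin : forall a f g, Pr (a *: f + g) = a *: Pr f + Pr g.
Hypothesis Prle : forall f, hnorm (Pr f) <= hnorm f.
Hypothesis PrK : forall f, f \in @hardy R -> h2_L2 (Pr f) = f.

Let W n (f : L) : H2 R := Pr (iter n (@shift R) f).

Let Wlin n a f g : W n (a *: f + g) = a *: W n f + W n g.
Proof. by rewrite /W iter_shift_linear Prlin. Qed.

Let Wle n f : hnorm (W n f) <= hnorm f.
Proof. by rewrite (le_trans (Prle _))// hnorm_iter_shift. Qed.

Let W_val n (f : H2 R) : h2_L2 (W n (h2_L2 f)) = iter n (@shift R) (h2_L2 f).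
Proof. by rewrite PrK//; apply: iter_shift_hardy; exact: H2_inP. Qed.

(* The Banach limit of <T P_{H2} z^n f, P_{H2} z^n g>. *)
Definition avg (T : 'B(H2 R)) (f g : L) : R[i] :=
  clim (fun n => '[T (W n f), W n g]).

Let pair_le (T : 'B(H2 R)) M n f g : 0 <= M -> (forall x, hnorm (T x) <= M * hnorm x) ->
  hnorm (T (W n f)) * hnorm (W n g) <= M * hnorm f * hnorm g.
Proof.
move=> M0 TM; rewrite ler_pM ?hnorm_ge0//.
by rewrite (le_trans (TM _))// ler_wpM2l.
Qed.

Let pair_bounded (T : 'B(H2 R)) f g : bounded_cseq (fun n => '[T (W n f), W n g]).
Proof.
have [M M0 TM] := bop_bounded T.
split; exists (M * hnorm f * hnorm g) => n; apply: le_trans (pair_le n f g M0 TM).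
  rewrite ler_norml Re_CauchySchwarz andbT lerNl -cReN -(linearNl (@inner R (H2 R))).
  by rewrite -hnormN Re_CauchySchwarz.
exact: Im_CauchySchwarz.
Qed.

Lemma avg_linl T a f f' g : avg T (a *: f + f') g = a * avg T f g + avg T f' g.
Proof.
rewrite /avg -clim_lin//; congr clim; apply/funext => n.
by rewrite Wlin linearP innerDl innerZl.
Qed.

Lemma avg_linr T a f g g' :
  avg T f (a *: g + g') = conjR R a * avg T f g + avg T f g'.
Proof.
rewrite /avg -clim_lin//; congr clim; apply/funext => n.
by rewrite Wlin innerDr innerZr.
Qed.

Lemma avg_linop T T' a f g :
  avg (a *: T + T') f g = a * avg T f g + avg T' f g.
Proof.
rewrite /avg -clim_lin//; congr clim; apply/funext => n.
by rewrite bopD bopZ innerDl innerZl.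
Qed.

Lemma avg_le (T : 'B(H2 R)) M f g : 0 <= M -> (forall x, hnorm (T x) <= M * hnorm x) ->
  Re (avg T f g) <= M * hnorm f * hnorm g.
Proof.
move=> M0 TM; apply: Re_clim_le => // n.
exact: le_trans (Re_CauchySchwarz _ _) (pair_le n f g M0 TM).
Qed.

Lemma avg_shift T f g : avg T (shift f) (shift g) = avg T f g.
Proof.
rewrite /avg -[RHS]clim_shift//; congr clim; apply/funext => n.
by rewrite /W !iterSr.
Qed.

Lemma average_operator : exists P : 'B(H2 R) -> 'B(H2 R),
  forall T f g, '[P T f, g] = avg T (h2_L2 f) (h2_L2 g).
Proof.
suff /choice[P PE] : forall T : 'B(H2 R), exists S : 'B(H2 R), forall f g,
    '[S f, g] = avg T (h2_L2 f) (h2_L2 g) by exists P.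
move=> T; have [M M0 TM] := bop_bounded T.
apply: (@bop_of_form R _ _ (fun f g : H2 R => avg T (h2_L2 f) (h2_L2 g)) M) => //.
- exact: hilbert_H2.
- by move=> a x x' y; rewrite -avg_linl.
- by move=> a x y y'; rewrite -avg_linr.
- by move=> x y; exact: avg_le.
Qed.

Context (P : 'B(H2 R) -> 'B(H2 R)).
Hypothesis PE : forall T f g, '[P T f, g] = avg T (h2_L2 f) (h2_L2 g).

Lemma average_linear a S T : P (a *: S + T) = a *: P S + P T.
Proof.
apply: bop_ext => f; apply: inner_eql => g.
by rewrite bopD bopZ innerDl innerZl !PE avg_linop.
Qed.

Let Wf n m (x : {ffun 'I_m -> H2 R}) : {ffun 'I_m -> H2 R} :=
  [ffun i => W n (h2_L2 (x i))].

Let hnorm_Wf n m (x : {ffun 'I_m -> H2 R}) : hnorm (Wf n x) <= hnorm x.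
Proof.
rewrite -(@ler_pXn2r _ 2) ?nnegrE ?hnorm_ge0// !hnorm_dsum; apply: ler_sum => i _.
by rewrite ffunE ler_pXn2r ?nnegrE ?hnorm_ge0//; exact: Wle.
Qed.

(** The limit commutes with the finite double sum, so pairings of the averaged matrix are limits of
    pairings of [A] itself at vectors of no larger norm. Positivity and norm bounds then hold at
    every matrix size. *)
Let average_pairing m (A : 'M['B(H2 R)]_m) x y :
  bounded_cseq (fun n => '[mxop A (Wf n x), Wf n y]) /\
  clim (fun n => '[mxop A (Wf n x), Wf n y]) = '[mxop (map_mx P A) x, y].
Proof.
rewrite inner_mxop.
have -> : (fun n => '[mxop A (Wf n x), Wf n y]) =
    fun n => \sum_i \sum_j '[A i j (W n (h2_L2 (x j))), W n (h2_L2 (y i))].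
  apply/funext => n; rewrite inner_mxop; apply: eq_bigr => i _.
  by apply: eq_bigr => j _; rewrite !ffunE.
have row i := clim_sum (fun j => pair_bounded (A i j) (h2_L2 (x j)) (h2_L2 (y i))).
have [bs ->] := clim_sum (fun i => (row i).1); split => //.
apply: eq_bigr => i _; rewrite (row i).2; apply: eq_bigr => j _.
by rewrite mxE PE.
Qed.

Lemma average_completely_positive : completely_positive P.
Proof.
move=> m A A0 x; have [b <-] := average_pairing A x x.
by apply: clim_ge0 => // n; exact: A0.
Qed.

Lemma mxnorm_average m (A : 'M['B(H2 R)]_m) (c : R) : 0 <= c ->
  (mxnorm A <= c%:E)%E -> (mxnorm (map_mx P A) <= c%:E)%E.
Proof.
move=> c0 /(mxnorm_leP _ c0) Ac; apply/(mxnorm_leP _ c0) => x y.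
have [b <-] := average_pairing A x y; apply: Re_clim_le => // n.
apply: le_trans (Ac _ _) _; rewrite ler_pM ?mulr_ge0 ?hnorm_ge0 ?hnorm_Wf//.
by rewrite ler_wpM2l ?hnorm_Wf.
Qed.

Lemma average_toeplitz T : @toeplitz R (P T).
Proof.
have [M M0 TM] := bop_bounded T.
have [A AE] := bop_of_form (@hilbert_L2 _ _ _ mu) M0 (avg_linl T) (avg_linr T)
  (fun f g => avg_le f g M0 TM).
have [A' AA'] := bop_adjoint A (@hilbert_L2 _ _ _ mu).
have Az : commutes A (expi 1).
  split; first exact: bounded_measurable_expi.
  move=> f; apply: inner_eql => g; rewrite -/(shift f).
  (* Write g as z times (conj z) g, cancel z on both sides of the form, and move conj z back as
     z. *)
  rewrite -{1}[g]shift_adjointK AE avg_shift -AE mulop_adjoint//.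
  exact: bounded_measurable_expi.
have [phi Aphi] := commutant_symbol AA' Az.
exists phi => f; split; first exact: H2_inP.
move=> z zh; rewrite innerBl -Aphi AE.
have -> : z = h2_L2 (MkH2 zh) by [].
by rewrite -inner_H2 PE subrr.
Qed.

(** In the integrand the two factors multiply to |z|^2 = 1. *)
Lemma shift_Linf_mul (phi : Linf mu) f g :
  '[Linf_mul phi (shift f), shift g] = '[Linf_mul phi f, g].
Proof.
have mE h : Linf_mul phi h = mulop (phi : measurableTypeR R -> R[i]) h.
  rewrite /mulop; case: pselect => [p|/(_ (linfP phi))//].
  by case: phi p => p pP p'; rewrite (Prop_irrelevance pP p').
have zL := bounded_measurable_Linfty mu (bounded_measurable_expi R 1).
rewrite !mE; move: f g; apply: L2_ind => F; apply: L2_ind => G.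
have [F' FE sF] := mulop_ex zL F; have [G' GE sG] := mulop_ex zL G.
rewrite /shift sF sG !inner_mulop; try exact: linfP.
congr cintegral; apply/funext => t; rewrite FE GE rmorphM/= mulrACA.
by rewrite expi_conjM mul1r.
Qed.

Lemma average_fix T : @toeplitz R T -> P T = T.
Proof.
move=> [phi Tphi]; apply: bop_ext => f; apply: inner_eql => g; rewrite PE.
have pairE (h k : H2 R) : '[T h, k] = '[Linf_mul phi (h2_L2 h), h2_L2 k].
  apply/eqP; rewrite eq_sym -subr_eq0 inner_H2 -innerBl; apply/eqP.
  by have [_] := Tphi h; apply; exact: H2_inP.
rewrite /avg (_ : (fun n => _) = fun=> '[T f, g]) ?clim_cst//.
apply/funext => n; rewrite !pairE !W_val.
by elim: n => //= n ih; rewrite shift_Linf_mul.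
Qed.

End ShiftAverage.

(** * Injectivity from a completely contractive projection *)

Section InjectiveFromProjection.
Context (R : realType) (K : innerProductType R).

Lemma injective_of_projection (Y : set 'B(K)) (P : 'B(K) -> 'B(K)) :
  operator_space Y ->
  (forall a S T, P (a *: S + T) = a *: P S + P T) ->
  (forall T, Y (P T)) -> (forall T, Y T -> P T = T) ->
  (forall n (A : 'M['B(K)]_n) c, 0 <= c -> (mxnorm A <= c%:E)%E ->
     (mxnorm (map_mx P A) <= c%:E)%E) ->
  injective_operator_space Y.
Proof.
move=> opY Plin PY Pfix Pc; split => // H0 H1 X0 X1 phi psi0 [_ X00 X0lin _] [_ X10 _ _].
move=> [phiX philin] phiI [psiY psilin] psicb.
have hK : hilbert_space K by case: opY.
pose c := fine (cbnorm X0 psi0).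
have cE : cbnorm X0 psi0 = c%:E.
  by rewrite fineK// ge0_fin_numE// cbnorm_ge0.
have c0 : 0 <= c by rewrite fine_ge0// cbnorm_ge0.
have phi0 : phi 0 = 0.
  by have := philin (-1) 0 0 X00 X00; rewrite scaler0 addr0 scaleN1r addNr.
(* The isometry condition at matrix size 1. It makes the chosen preimage [s] linear on the image of
   [X0], so that [u] is psi0 composed with the inverse of phi. *)
have phi_inj S T : X0 S -> X0 T -> phi S = phi T -> S = T.
  move=> XS XT ST; apply/eqP; rewrite -subr_eq0; apply/eqP; apply: opnorm_eq0.
  have XD : X0 (S - T) by rewrite addrC -scaleN1r; exact: X0lin.
  have pD : phi (S - T) = 0 by rewrite addrC -scaleN1r philin// ST scaleN1r addNr.
  rewrite -opnorm_mx11 -(phiI 1%N (const_mx (S - T))); last by move=> i j; rewrite mxE.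
  rewrite map_const_mx pD opnorm_mx11.
  by apply: opnorm_le => x _; rewrite bop0 hnorm0.
pose V := phi @` X0.
have /choice[s sP] : forall S, exists T, V S -> X0 T /\ phi T = S.
  move=> S; have [[T XT TS]|VS] := pselect (V S); first by exists T.
  by exists 0.
pose u S := psi0 (s S).
have V0 : V 0 by exists 0.
have Vlin a S T : V S -> V T -> V (a *: S + T).
  by move=> [S' XS <-] [T' XT <-]; exists (a *: S' + T'); [exact: X0lin|exact: philin].
have slin a S T : V S -> V T -> s (a *: S + T) = a *: s S + s T.
  move=> VS VT; have [XS pS] := sP _ VS; have [XT pT] := sP _ VT.
  have [XST pST] := sP _ (Vlin a S T VS VT).
  by apply: phi_inj => //; [exact: X0lin|rewrite philin// pS pT].
have ulin a S T : V S -> V T -> u (a *: S + T) = a *: u S + u T.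
  move=> VS VT; rewrite /u slin// psilin//.
    by have [] := sP _ VS.
  by have [] := sP _ VT.
have uc : (cbnorm V u <= c%:E)%E.
  apply/cbnorm_leP => n A VA A1; rewrite (map_mx_comp s psi0).
  have XA i j : X0 ((map_mx s A) i j) by rewrite mxE; have [] := sP _ (VA i j).
  have psic : (cbnorm X0 psi0 <= c%:E)%E by rewrite cE.
  move/cbnorm_leP: psic; apply => //; rewrite -phiI//.
  rewrite -map_mx_comp (_ : map_mx _ A = A)//; apply/matrixP => i j; rewrite mxE /=.
  by have [] := sP _ (VA i j).
have [U [Ulin UV Uc]] := wittstock_extension V0 Vlin ulin c0 uc hK.
have Upsi T : X0 T -> P (U (phi T)) = psi0 T.
  move=> XT; have VT : V (phi T) by exists T.
  rewrite UV// /u; have [Xs ps] := sP _ VT.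
  by rewrite (phi_inj _ _ Xs XT ps) Pfix//; exact: psiY.
have psi_le : (cbnorm X1 (P \o U) <= c%:E)%E.
  apply/cbnorm_leP => n A _ A1; rewrite (map_mx_comp U P); apply: Pc => //.
  by move/cbnorm_leP: Uc; apply.
exists (P \o U); split => //.
- by split=> [T _|a S T _ _]; [exact: PY|rewrite /= Ulin Plin].
- exact: le_lt_trans psi_le (ltry _).
(* For the other inequality, [phi] carries each test matrix over [X0] to one over [X1] of the same
   norm, with the same image. *)
- apply/eqP; rewrite eq_le; apply/andP; split; first by rewrite cE.
  apply: ge_ereal_sup => _ [n [A [XA A1 ->]]].
  apply: ereal_sup_ubound; exists n, (map_mx phi A); split.
  + by move=> i j; rewrite mxE; exact: phiX.
  + by rewrite phiI.
  + congr mxnorm; apply/matrixP => i j; rewrite !mxE /=.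
    by rewrite Upsi.
Qed.

End InjectiveFromProjection.

Theorem corollary3p7 (R : realType) :
  (exists P : {linear 'B(H2 R) -> 'B(H2 R)},
     [/\ completely_positive P,
         completely_contractive [set: 'B(H2 R)] P,
         P \o P =1 P &
         range P = @toeplitz R]) /\
  injective_operator_space (@toeplitz R).
Proof.
have [lim [lim_lin lim_le lim_shift]] := banach_limit R.
have [Pr [Prlin Prle PrK]] := hardy_projection R.
have [P PE] := average_operator lim_lin lim_le Prlin Prle.
have Plin := average_linear lim_lin Prle PE.
have PT := average_toeplitz lim_lin lim_le lim_shift Prlin Prle PE.
have Pfix := average_fix lim_lin lim_le PrK PE.
have Pc := mxnorm_average lim_lin lim_le Prle PE.
have Pcp := average_completely_positive lim_lin lim_le Prle PE.
have Plinear : linear P by exact: Plin.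
split.
  pose PL : {linear 'B(H2 R) -> 'B(H2 R)} :=
    HB.pack P (GRing.isLinear.Build R[i] 'B(H2 R) 'B(H2 R) *:%R P Plinear).
  exists PL; split.
  - exact: Pcp.
  - by apply/cbnorm_leP => n A _; exact: Pc.
  - by move=> T; exact/Pfix/PT.
  - apply/seteqP; split=> [_ [T _ <-]|T TT]; first exact: PT.
    by exists T => //; exact: Pfix.
apply: (@injective_of_projection R (H2 R) (@toeplitz R) P) => //.
split.
- exact: hilbert_H2.
- have <- : P 0 = 0; last exact: PT.
  by have := Plin (-1) 0 0; rewrite scaler0 addr0 scaleN1r addNr.
- by move=> a S T /Pfix SE /Pfix TE; rewrite -SE -TE -Plin; exact: PT.
(* The fixed-point set of a linear contraction is closed: for Toeplitz [S], P T - T = P (T - S) - (T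
   - S), and both terms are small. The 1 in [d] covers [f = 0]. *)
- move=> T Tapp; have <- : P T = T; last exact: PT.
  apply: bop_ext => f; apply/eqP; rewrite -subr_eq0; apply/eqP/hnorm_eq0.
  apply/eqP; rewrite eq_le hnorm_ge0 andbT; apply/ler_addgt0Pr => e e0; rewrite add0r.
  pose d := e / (2 * (hnorm f + 1)).
  have f1 : 0 < 2 * (hnorm f + 1) by rewrite mulr_gt0// ltr_wpDl// hnorm_ge0.
  have d0 : 0 < d by rewrite divr_gt0.
  have [S ST TS] := Tapp d d0.
  have PTS : (opnorm (P (T - S)%R) <= d%:E)%E.
    rewrite -opnorm_mx11 -map_const_mx; apply: Pc; first exact: ltW.
    by rewrite opnorm_mx11 ltW.
  have E1 := bop_leP (ltW TS) f.
  have E2 := bop_leP PTS f.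
  have -> : P T f - T f = P (T - S)%R f - (T - S)%R f.
    have -> : P (T - S) = P T - S.
      by rewrite -{2}(Pfix _ ST) addrC -scaleN1r Plin scaleN1r addrC.
    by rewrite !bopB opprB addrA subrK.
  apply: le_trans (ler_hnormD _ _) _; rewrite hnormN.
  apply: le_trans (lerD E2 E1) _.
  have -> : e = d * (hnorm f + 1) + d * (hnorm f + 1).
    by rewrite /d; field; rewrite gt_eqF// ltr_wpDl// hnorm_ge0.
  by rewrite -mulrDr -mulrDr ler_wpM2l ?(ltW d0)// lerD// lerDl.
Qed.
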